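(* Let $p,p'\in\mathscr P_e$. Then $\Gamma(p)$ and $\Gamma(p')$ are adjacent if and only if $p$ and $p'$ belong to the closure of the same alcove.
   Context: Let $G$ be a connected semisimple algebraic group over $\mathbb C$ with Lie algebra $\mathfrak g$, and let $e\in\mathfrak g$ be nilpotent. An $\mathbb R$-grading $\mathfrak g=\bigoplus_{j\in\mathbb R}\mathfrak g_j$ (with $[\mathfrak g_i,\mathfrak g_j]\subseteq\mathfrak g_{i+j}$) is a good grading for $e$ if $e\in\mathfrak g_2$ and $\operatorname{ad}e:\mathfrak g_j\to\mathfrak g_{j+2}$ is injective for all $j\le-1$ and surjective for all $j\ge-1$. Two good gradings $\mathfrak g=\bigoplus_{i\in\mathbb R}\mathfrak g_i$ and $\mathfrak g=\bigoplus_{j\in\mathbb R}\mathfrak g'_j$ for $e$ are adjacent if $\mathfrak g=\bigoplus_{i^-\le j\le i^+}\mathfrak g_i\cap\mathfrak g'_j$ (sum over pairs of real numbers $i,j$ with $i^-\le j\le i^+$), where $i^-$ is the largest integer strictly smaller than $i$ and $i^+$ is the smallest integer strictly greater than $i$. Let $(e,h,f)$ be an $\mathfrak{sl}_2$-triple in $\mathfrak g$ containing $e$, so $[h,e]=2e$, $[h,f]=-2f$, $[e,f]=h$. Let $C$ be the centralizer of $h$ in $G$ and $C_e$ the centralizer of $e$ in $C$. Let $T$ be a maximal torus of $G$ contained in $C$ and containing a maximal torus of $C_e$, let $\mathfrak t$ be its Lie algebra (so $h\in\mathfrak t$), and let $\mathfrak t_e$ be the centralizer of $e$ in $\mathfrak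 t$. Let $E_e$ be the real vector space of all $p\in\mathfrak t_e$ such that the eigenvalues of $\operatorname{ad}p$ on $\mathfrak g$ are real; it is an $\mathbb R$-form of $\mathfrak t_e$. For $p\in E_e$, $\Gamma(p)$ denotes the $\mathbb R$-grading of $\mathfrak g$ whose degree $j$ piece is the $j$-eigenspace of $\operatorname{ad}(h+p)$. The good grading polytope is $\mathscr P_e=\{p\in E_e\mid\Gamma(p)\text{ is a good grading for }e\}$. Let $L$ be the centralizer of $\mathfrak t_e$ in $G$ (a Levi subgroup), fix a parabolic subgroup $P$ of $G$ having $L$ as a Levi factor, and let $\mathfrak u$ be the Lie algebra of the unipotent radical of $P$. Let $\Phi_e\subset\mathfrak t_e^*$ be the set of non-zero weights of $\mathfrak t_e$ on the centralizer of $e$ in $\mathfrak g$ (equivalently, on $\mathfrak g$), and let $\Phi_e^+$ be the set of weights of $\mathfrak t_e$ on $\mathfrak u$, so $\Phi_e=\Phi_e^+\sqcup(-\Phi_e^+)$. For $\alpha\in\Phi_e^+$ and $k\in\mathbb Z$ let $H_{\alpha,k}=\{p\in E_e\mid\alpha(p)=k\}$. The alcoves are the connected components of $E_e\setminus\bigcup_{\alpha\in\Phi_e^+,\,k\in\mathbb Z}H_{\alpha,k}$. *)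

(* Defs.v *)
(* The field of complex numbers is R[i], where R : realType is the reals. *)
From HB Require Import structures.
From mathcomp Require Import all_boot all_order all_algebra.
From mathcomp Require Import complex.
From mathcomp Require mpoly.
From mathcomp Require Import all_classical all_reals all_analysis.

Set Implicit Arguments.
Unset Strict Implicit.
Unset Printing Implicit Defensive.

Import Order.TTheory GRing.Theory Num.Theory.
Import numFieldNormedType.Exports.

Local Open Scope classical_set_scope.
Local Open Scope ring_scope.
Local Open Scope complex_scope.

(* The usual topology on the complex numbers, from which the matrix spaces
   'M[R[i]]_n get theirs. *)
HB.instance Definition _ (R : realType) :=
  PseudoPointedMetric.copy R[i] R[i]^o.

Definition maximal_among (V : Type) (Q : set V -> Prop) (S : set V) : Prop :=
  Q S /\ forall S', Q S' -> S `<=` S' -> S' = S.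

(* [W i] is only taken into account for [i] in the index set [D]; the sum has
   finite support. *)
Definition direct_sum (K : nzRingType) (V : lmodType K) (I : choiceType)
    (g : set V) (D : set I) (W : I -> set V) : Prop :=
  (forall i, D i -> W i `<=` g) /\
  forall x, g x -> exists! y : I -> V,
    [/\ finite_set [set i | y i != 0],
        forall i, D i -> W i (y i),
        forall i, ~ D i -> y i = 0
      & x = \sum_(i \in [set: I]) y i].

(* A linear algebraic group over the complex numbers is a Zariski closed
   subgroup of GL_n.  Sets of matrices are used for both groups and Lie
   algebras. *)
Section LinearAlgebraicGroups.
Variables (R : realType) (n : nat).
Local Notation mat := 'M[R[i]]_n.
Local Notation mxpoly := (mpoly.mpoly (n * n) R[i]).
Implicit Types (A B H G T U P L : set mat).

Definition mxeval (q : mxpoly) (g : mat) : R[i] :=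
  mpoly.meval (fun k => mxvec g 0 k) q.

Definition zclosed A : Prop :=
  exists I : set mxpoly,
    A = [set g | g \in unitmx /\ forall q, I q -> mxeval q g = 0].

Definition zconnected A : Prop :=
  forall F1 F2, zclosed F1 -> zclosed F2 ->
    A `<=` F1 `|` F2 -> A `&` F1 `&` F2 = set0 -> A `<=` F1 \/ A `<=` F2.

Definition is_subgroup H : Prop :=
  [/\ forall g, H g -> g \in unitmx, H 1%:M,
      forall g g', H g -> H g' -> H (g *m g')
    & forall g, H g -> H (invmx g)].

Definition algebraic_group G : Prop := is_subgroup G /\ zclosed G.

Definition normal_in H G : Prop :=
  H `<=` G /\ forall g x, G g -> H x -> H (g *m x *m invmx g).

Definition derived_group G : set mat :=
  smallest is_subgroup [set z | exists x y, [/\ G x, G y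
    & z = x *m y *m invmx x *m invmx y]].

Definition solvable_group G : Prop :=
  exists k, iter k derived_group G = [set 1%:M].

Definition unipotent_group G : Prop :=
  forall g, G g -> exists k : nat, (g - 1%:M) ^+ k = 0.

Definition connected_semisimple G : Prop :=
  [/\ algebraic_group G, zconnected G
    & forall H, algebraic_group H -> zconnected H -> solvable_group H ->
        normal_in H G -> H = [set 1%:M]].

(* A torus is a connected diagonalizable group. *)
Definition torus T : Prop :=
  [/\ algebraic_group T, zconnected T
    & exists2 a : mat, a \in unitmx &
        forall g, T g -> is_diag_mx (a *m g *m invmx a)].

Definition maximal_torus G T : Prop :=
  maximal_among (fun S => torus S /\ S `<=` G) T.

Definition borel_subgroup G B : Prop :=
  maximal_among (fun S => [/\ algebraic_group S, zconnected S,
    solvable_group S & S `<=` G]) B.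

Definition parabolic_subgroup G P : Prop :=
  [/\ algebraic_group P, P `<=` G & exists2 B, borel_subgroup G B & B `<=` P].

Definition unipotent_radical P U : Prop :=
  let Q := fun S => [/\ algebraic_group S, zconnected S, unipotent_group S
                      & normal_in S P] in
  Q U /\ forall S, Q S -> S `<=` U.

(* P is the semidirect product of L and its unipotent radical; the product map
   is then an isomorphism of varieties because the characteristic is 0. *)
Definition levi_factor P L : Prop :=
  [/\ algebraic_group L, L `<=` P
    & forall U, unipotent_radical P U ->
        L `&` U = [set 1%:M] /\
        P = [set z | exists x y, [/\ L x, U y & z = x *m y]]].

(* The tangent space at the identity: the matrices killed by the differentials
   at 1 of all polynomials vanishing on the group. *)
Definition Lie G : set mat :=
  [set X | forall q : mxpoly, (forall g, G g -> mxeval q g = 0) ->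
    \sum_(k < n * n) mxeval (mpoly.mderiv k q) 1%:M * mxvec X 0 k = 0].

Definition bracket (x y : mat) : mat := x *m y - y *m x.

(* As the elements are matrices, the adjoint action of G on its Lie algebra is
   conjugation, and g fixes z exactly when the two commute. *)
Definition centralizer G (Z : set mat) : set mat :=
  [set g | G g /\ forall z, Z z -> g *m z = z *m g].

Definition lie_centralizer (g Z : set mat) : set mat :=
  [set x | g x /\ forall z, Z z -> bracket x z = 0].

Definition nilpotent_mx (x : mat) : Prop := exists k : nat, x ^+ k = 0.

Definition sl2_triple (g : set mat) (e h f : mat) : Prop :=
  [/\ g e, g h & g f] /\
  [/\ bracket h e = 2%:R *: e, bracket h f = - (2%:R *: f)
    & bracket e f = h].

End LinearAlgebraicGroups.

Section GoodGradings.
Variables (R : realType) (n : nat).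
Local Notation mat := 'M[R[i]]_n.
Implicit Types (g t : set mat) (gr : R -> set mat) (e h p : mat).

Definition is_subspace (W : set mat) : Prop :=
  W 0 /\ forall (a : R[i]) x y, W x -> W y -> W (a *: x + y).

Definition grading g gr : Prop :=
  [/\ forall j, is_subspace (gr j),
      direct_sum g [set: R] gr
    & forall i j x y, gr i x -> gr j y -> gr (i + j) (bracket x y)].

Definition good_grading g e gr : Prop :=
  [/\ grading g gr, gr 2%:R e,
      forall j, j <= -1 -> forall x y, gr j x -> gr j y ->
        bracket e x = bracket e y -> x = y
    & forall j, -1 <= j -> forall y, gr (j + 2%:R) y ->
        exists2 x, gr j x & bracket e x = y].

(* The largest integer strictly smaller than i, and the smallest integer
   strictly greater than i. *)
Definition int_below (i : R) : R := (Num.ceil i - 1)%:~R.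
Definition int_above (i : R) : R := (Num.floor i + 1)%:~R.

Definition adjacent_gradings g gr gr' : Prop :=
  direct_sum g [set ij : R * R | int_below ij.1 <= ij.2 <= int_above ij.1]
    (fun ij => gr ij.1 `&` gr' ij.2).

Definition Gamma g h p : R -> set mat :=
  fun j => [set x | g x /\ bracket (h + p) x = j%:C *: x].

(* The real form of the subspace [te]: ad-eigenvalues on [g] are real. *)
Definition real_form g te : set mat :=
  [set p | te p /\ forall (c : R[i]) x, g x -> x != 0 ->
    bracket p x = c *: x -> c \is Num.real].

Definition good_grading_polytope g (E : set mat) e h : set mat :=
  [set p | E p /\ good_grading g e (Gamma g h p)].

(* The weights of [te] on [m].  A functional on [te] is represented by a
   function on all matrices, of which only the restriction to [te] matters;
   that restriction is automatically linear since the weight vector x is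
   nonzero. *)
Definition weights te (m : set mat) : set (mat -> R[i]) :=
  [set a | exists2 x, m x /\ x != 0 & forall z, te z -> bracket z x = a z *: x].

Definition hyperplane (E : set mat) (a : mat -> R[i]) (k : int) : set mat :=
  [set p | E p /\ a p = k%:~R].

Definition alcove (E : set mat) (Phip : set (mat -> R[i])) (A : set mat) : Prop :=
  let X := E `\` \bigcup_(a in Phip) \bigcup_k hyperplane E a k in
  exists2 q, X q & A = connected_component X q.

End GoodGradings.

(* Main.v *)
Require Import Defs.
From HB Require Import structures.
From mathcomp Require Import all_boot all_order all_algebra.
From mathcomp Require Import complex.
From mathcomp Require Import perm ring lra.
From mathcomp Require Import (canonicals, coercions) mpoly.
From mathcomp Require Import all_classical all_reals all_analysis.

Set Implicit Arguments.
Unset Strict Implicit.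
Unset Printing Implicit Defensive.

Import Order.TTheory GRing.Theory Num.Theory.
Import numFieldNormedType.Exports.

Local Open Scope classical_set_scope.
Local Open Scope ring_scope.
Local Open Scope complex_scope.

(** Let h + p have degree i and h + p' degree j on a nonzero vector. Since the
    eigenvalues of ad h are integers, i^- <= j <= i^+ holds exactly when no
    integer lies strictly between a(p) and a(p'), where a is a weight of te
    occurring in that bidegree. So the gradings are adjacent if and only if no
    hyperplane {a = k}, a any weight of te on g, strictly separates p and p',
    while p and p' lie in the closure of a common alcove if and only if this
    holds for the weights a of te on u.

    It remains to see that 0 is not a weight on u, and that each nonzero weight
    a on g satisfies: a or -a is a weight on u. The former holds because
    L meets U trivially. For the latter, if neither a nor -a occurs on Lie P,
    then a weight vector x for a is orthogonal to Lie P for the trace form; but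
    the orthogonal of the Lie algebra b of a Borel subgroup B is contained in b.
    Indeed, otherwise Lie-Kolchin gives x orthogonal to b, not in b, and fixed
    by B up to scalars modulo the nilpotent ideal formed by the elements of b
    orthogonal to b; then B and the one-parameter groups given by the Jordan
    parts of x stabilize a full flag and generate a larger connected solvable
    group.

    The passage between an algebraic group H and its Lie algebra rests on the
    ideal of H being stable under the invariant vector fields of Lie H: it
    follows that exp (s X) is in H for nilpotent X in Lie H, and that the
    replicas of any X in Lie H (the matrices acting as f(mu) on the generalized
    eigenspace of X for mu, with f additive) are in Lie H. *)

(** A parabolic subgroup is only known to contain a maximal connected solvable subgroup [B], so no
    roots are available beforehand and the symmetry of the weights has to come from the maximality
    of [B]. Hence an element outside its Lie algebra must be turned into an actual larger group. The
    exponential series is polynomial only for nilpotent elements; semisimple ones are integrated by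
    replicas for exponentials of additive functions. The real and the imaginary part suffice for
    this, so that only the real exponential occurs. Conjugation is additive as well, and its replica
    turns orthogonality for the trace form into the vanishing of a sum of [|mu|^2]; this positivity
    and the invariance of the form do the work of a nondegenerate Killing form. All weights are
    evaluated at one generic [v] in [te] with real coordinates. As [v] separates distinct weights,
    an eigenvector of the single operator [bracket v] is a joint eigenvector of [te]. The same [v]
    is a direction transversal to all walls, which leads from a point on walls into an alcove. *)

(** * Polynomial functions on matrices and invariant vector fields *)

Section PolynomialFunctions.
Variables (R : realType) (n : nat).
Local Notation K := R[i].
Local Notation mat := 'M[K]_n.
Local Notation mxp := (mpoly.mpoly (n * n) K).

Lemma mxevalD (p q : mxp) g : mxeval (p + q) g = mxeval p g + mxeval q g.
Proof. exact: mpoly.mevalD. Qed.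

Lemma mxevalN (p : mxp) g : mxeval (- p) g = - mxeval p g.
Proof. exact: mpoly.mevalN. Qed.

Lemma mxevalM (p q : mxp) g : mxeval (p * q) g = mxeval p g * mxeval q g.
Proof. exact: mpoly.mevalM. Qed.

Lemma mxevalZ c (p : mxp) g : mxeval (c *: p) g = c * mxeval p g.
Proof. exact: mpoly.mevalZ. Qed.

Lemma mxevalC c g : mxeval (mpoly.mpolyC (n * n) c : mxp) g = c.
Proof. exact: mpoly.mevalC. Qed.

Lemma mxeval0 g : mxeval (0 : mxp) g = 0.
Proof. exact: mpoly.meval0. Qed.

Lemma mxeval1 g : mxeval (1 : mxp) g = 1.
Proof. exact: mpoly.meval1. Qed.

Lemma mxeval_sum (I : Type) (r : seq I) (P : pred I) (F : I -> mxp) g :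
  mxeval (\sum_(i <- r | P i) F i) g = \sum_(i <- r | P i) mxeval (F i) g.
Proof.
apply: (big_morph (fun p : mxp => mxeval p g)) => [p q|].
  exact: mxevalD.
exact: mxeval0.
Qed.

Definition mxvar (k : 'I_(n * n)) : mxp := mpoly.mpolyX K (mpoly.mnm1 k).

Lemma mxeval_var k g : mxeval (mxvar k) g = mxvec g 0 k.
Proof. exact: mpoly.mevalXU. Qed.

(** Evaluation is a ring morphism and [Dmx X] a derivation, so facts about them need checking only
    on constants and coordinates. *)
Lemma mxp_ind (P : mxp -> Prop) :
  (forall c, P (mpoly.mpolyC _ c)) -> (forall k, P (mxvar k)) ->
  (forall p q, P p -> P q -> P (p + q)) ->
  (forall p q, P p -> P q -> P (p * q)) -> forall p, P p.
Proof.
move=> PC PX PD PM; elim/mpoly.mpolyind => [|c m p _ _ Pp].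
  by rewrite -mpoly.mpolyC0; exact: PC.
apply: PD => //; rewrite -mpoly.mul_mpolyC; apply: (PM) => //.
rewrite mpoly.mpolyXE_id.
have P1 : P 1 by rewrite -mpoly.mpolyC1.
apply: (big_ind _ P1 PM) => k _.
elim: (mpoly.fun_of_multinom m k) => [|j IH]; first by rewrite expr0.
rewrite exprS; by apply: (PM) => //; exact: PX.
Qed.

(** Takes a bare function, of which only the values at the matrix units matter; [eq_lpoly] can then
    rewrite it without repacking a linear structure. *)
Definition lpoly (l : mat -> K) : mxp :=
  \sum_k l (vec_mx (delta_mx 0 k)) *: mxvar k.

Lemma mxeval_lpoly (l : {linear mat -> K | *%R}) g : mxeval (lpoly l) g = l g.
Proof.
rewrite mxeval_sum -[in RHS](mxvecK g) (row_sum_delta (mxvec g)) !linear_sum /=.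
by apply: eq_bigr => k _; rewrite mxevalZ mxeval_var !linearZ /= mulrC.
Qed.

Lemma lpoly_coord (k : 'I_(n * n)) : mxvar k = lpoly (fun y => mxvec y 0 k).
Proof.
rewrite /lpoly (bigD1 k) //= vec_mxK mxE !eqxx scale1r big1 ?addr0 // => j jk.
by rewrite vec_mxK mxE eqxx eq_sym (negbTE jk) scale0r.
Qed.

Lemma eq_lpoly l1 l2 : l1 =1 l2 -> lpoly l1 = lpoly l2.
Proof. by move=> E; apply: eq_bigr => k _; rewrite E. Qed.

Lemma lpoly_sum (I : finType) (c : I -> K) (l : I -> mat -> K) :
  lpoly (fun y => \sum_i c i * l i y) = \sum_i c i *: lpoly (l i).
Proof.
rewrite /lpoly; under [RHS]eq_bigr do rewrite scaler_sumr.
rewrite exchange_big; apply: eq_bigr => k _; rewrite scaler_suml.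
by apply: eq_bigr => i _; rewrite scalerA.
Qed.

End PolynomialFunctions.

(* [Dmx X q] is the polynomial function y |-> d/ds q (y + s y X) at s = 0, the
   left invariant vector field of [X] applied to [q]. *)
HB.lock Definition Dmx (R : realType) (n : nat) (X : 'M[R[i]]_n)
    (q : mpoly.mpoly (n * n) R[i]) : mpoly.mpoly (n * n) R[i] :=
  \sum_k mpoly.mderiv k q * lpoly (fun y => mxvec (y *m X) 0 k).

Section Derivation.
Variables (R : realType) (n : nat).
Local Notation K := R[i].
Local Notation mat := 'M[K]_n.
Local Notation mxp := (mpoly.mpoly (n * n) K).
Implicit Types (X : mat) (p q : mxp).

Lemma DmxD X p q : Dmx X (p + q) = Dmx X p + Dmx X q.
Proof.
rewrite Dmx.unlock -big_split; apply: eq_bigr => k _.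
by rewrite mpoly.mderivD mulrDl.
Qed.

Lemma DmxZ X c q : Dmx X (c *: q) = c *: Dmx X q.
Proof.
rewrite Dmx.unlock scaler_sumr; apply: eq_bigr => k _.
by rewrite mpoly.mderivZ scalerAl.
Qed.

Lemma DmxM X p q : Dmx X (p * q) = Dmx X p * q + p * Dmx X q.
Proof.
rewrite Dmx.unlock mulr_suml mulr_sumr -big_split; apply: eq_bigr => k _ /=.
by rewrite mpoly.mderivM mulrDl mulrAC -!mulrA.
Qed.

Lemma DmxC X c : Dmx X (mpoly.mpolyC (n * n) c) = 0.
Proof.
by rewrite Dmx.unlock big1 // => k _; rewrite mpoly.mderivC mul0r.
Qed.

Lemma Dmx0 X : Dmx X 0 = 0.
Proof. by have := DmxZ X 0 0; rewrite !scale0r. Qed.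

Lemma DmxN X q : Dmx X (- q) = - Dmx X q.
Proof. by rewrite -scaleN1r DmxZ scaleN1r. Qed.

Lemma Dmx_sum X (I : Type) (r : seq I) (P : pred I) (F : I -> mxp) :
  Dmx X (\sum_(i <- r | P i) F i) = \sum_(i <- r | P i) Dmx X (F i).
Proof. apply: (big_morph _ (DmxD X)); exact: Dmx0. Qed.

Lemma Dmx_lpoly X (l : {linear mat -> K | *%R}) :
  Dmx X (lpoly l) = lpoly (fun y => l (y *m X)).
Proof.
rewrite Dmx.unlock.
have dl k : mpoly.mderiv k (lpoly l) = mpoly.mpolyC _ (l (vec_mx (delta_mx 0 k))).
  rewrite /lpoly (raddf_sum (mpoly.mderiv k)) /= (bigD1 k) //=.
  rewrite mpoly.mderivZ mpoly.mderivX mpoly.mnmE eqxx /= scale1r.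
  rewrite big1 => [|j jk].
    rewrite addr0 -mpoly.mul_mpolyC; set m := mpoly.mnm_sub _ _.
    suff -> : m = mpoly.mnm0 by rewrite mpoly.mpolyX0 mulr1.
    by apply/mpoly.mnmP => i; rewrite /m mpoly.mnmBE subnn mpoly.mnm0E.
  by rewrite mpoly.mderivZ mpoly.mderivX mpoly.mnm1E (negbTE jk) scale0r scaler0.
under eq_bigr do rewrite dl mpoly.mul_mpolyC.
rewrite -lpoly_sum; apply: eq_lpoly => y.
rewrite -[in RHS](mxvecK (y *m X)) [in RHS](row_sum_delta (mxvec (y *m X))) !linear_sum /=.
by apply: eq_bigr => k _; rewrite !linearZ /= mulrC.
Qed.

End Derivation.

Section LinearForms.
Variables (R : realType) (n : nat).
Local Notation K := R[i].
Local Notation mat := 'M[K]_n.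

Definition mxcoord (k : 'I_(n * n)) (y : mat) : K := mxvec y 0 k.

Fact mxcoord_linear k : GRing.linear_for *%R (mxcoord k).
Proof. by move=> c x y; rewrite /mxcoord linearP !mxE. Qed.

HB.instance Definition _ k :=
  GRing.isLinear.Build K mat K *%R (mxcoord k) (mxcoord_linear k).

Definition mxentry p q (A : 'M[K]_(p, n)) (B : 'M[K]_(n, q)) i j (y : mat) : K :=
  (A *m y *m B) i j.

Fact mxentry_linear p q A B i j : GRing.linear_for *%R (@mxentry p q A B i j).
Proof.
move=> c x y; rewrite /mxentry mulmxDr mulmxDl -scalemxAr -scalemxAl.
by rewrite mxE [X in X + _]mxE.
Qed.

HB.instance Definition _ p q A B i j :=
  GRing.isLinear.Build K mat K *%R (@mxentry p q A B i j) (mxentry_linear A B i j).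

Lemma lpolyP c (l1 l2 : mat -> K) :
  lpoly (fun y => c * l1 y + l2 y) = c *: lpoly l1 + lpoly l2.
Proof.
rewrite /lpoly scaler_sumr -big_split; apply: eq_bigr => k _ /=.
by rewrite scalerDl scalerA.
Qed.

Lemma mxvar_lpoly k : mxvar R k = lpoly (@mxcoord k).
Proof. exact: lpoly_coord. Qed.

End LinearForms.

(** * The Lie algebra of a linear group *)

Section LieAlgebra.
Variables (R : realType) (n : nat).
Local Notation K := R[i].
Local Notation mat := 'M[K]_n.
Local Notation mxp := (mpoly.mpoly (n * n) K).
Implicit Types (X Y g : mat) (p q : mxp) (H : set mat).

Lemma mxeval_Dvar X k g : mxeval (Dmx X (mxvar R k)) g = mxcoord k (g *m X).
Proof.
rewrite mxvar_lpoly Dmx_lpoly.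
have lin : GRing.linear_for *%R (fun y : mat => mxcoord k (y *m X)).
  by move=> c x y; rewrite mulmxDl -scalemxAl linearP.
pose l : {linear mat -> K | *%R} := HB.pack (fun y : mat => mxcoord k (y *m X))
  (GRing.isLinear.Build K mat K *%R _ lin).
exact: (mxeval_lpoly l).
Qed.

Lemma DmxDl c X Y q : Dmx (c *: X + Y) q = c *: Dmx X q + Dmx Y q.
Proof.
rewrite Dmx.unlock scaler_sumr -big_split; apply: eq_bigr => k _ /=.
have E : (fun y : mat => mxvec (y *m (c *: X + Y)) 0 k) =1
         (fun y => c * mxvec (y *m X) 0 k + mxvec (y *m Y) 0 k).
  by move=> y; rewrite mulmxDr -scalemxAr linearP !mxE.
by rewrite (eq_lpoly E) lpolyP mulrDr scalerAr.
Qed.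

Lemma Dmx_bracket X Y q :
  Dmx (bracket X Y) q = Dmx X (Dmx Y q) - Dmx Y (Dmx X q).
Proof.
elim/mxp_ind: q => [c|k|p q IHp IHq|p q IHp IHq].
- by rewrite !DmxC ?Dmx0 subr0.
- have lin Z : GRing.linear_for *%R (fun y : mat => mxcoord k (y *m Z)).
    by move=> c x y; rewrite mulmxDl -scalemxAl linearP.
  pose l Z : {linear mat -> K | *%R} := HB.pack (fun y : mat => mxcoord k (y *m Z))
    (GRing.isLinear.Build K mat K *%R _ (lin Z)).
  rewrite mxvar_lpoly !Dmx_lpoly (Dmx_lpoly X (l Y)) (Dmx_lpoly Y (l X)) /=.
  rewrite -[X in _ - X]scale1r -scaleNr addrC -lpolyP; apply: eq_lpoly => y.
  rewrite /bracket mulmxBr linearB /= !mulmxA mulN1r addrC //.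
- by rewrite !DmxD IHp IHq opprD addrACA.
- by rewrite !(DmxM, DmxD) IHp IHq; ring.
Qed.

Definition vanish H q := forall g, H g -> mxeval q g = 0.

Lemma LieE H X : Lie H X <-> forall q, vanish H q -> mxeval (Dmx X q) 1%:M = 0.
Proof.
suff E q : mxeval (Dmx X q) 1%:M =
    \sum_k mxeval (mpoly.mderiv k q) 1%:M * mxvec X 0 k.
  by split=> L q Hq; move: (L q Hq); rewrite E.
rewrite Dmx.unlock mxeval_sum; apply: eq_bigr => k _; rewrite mxevalM.
congr (_ * _).
have lin : GRing.linear_for *%R (fun y : mat => mxvec (y *m X) 0 k).
  by move=> c x y; rewrite mulmxDl -scalemxAl linearP !mxE.
pose l : {linear mat -> K | *%R} := HB.pack (fun y : mat => mxvec (y *m X) 0 k)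
  (GRing.isLinear.Build K mat K *%R _ lin).
by rewrite (mxeval_lpoly l) /= mul1mx.
Qed.

(** The curve [g (y + s y X) k] is [z + s z (k' X k)] with [z = g y k]. The case [k = 1] is left
    invariance; [k] inverse to the left factor gives the adjoint action. *)
Lemma translate g k k' q : k *m k' = 1%:M ->
  exists q', forall y, mxeval q' y = mxeval q (g *m y *m k) /\
    forall X, mxeval (Dmx X q') y = mxeval (Dmx (k' *m X *m k) q) (g *m y *m k).
Proof.
move=> kk'; elim/mxp_ind: q => [c|i|p q [p' Hp] [q' Hq]|p q [p' Hp] [q' Hq]].
- exists (mpoly.mpolyC _ c) => y; split=> [|X]; first by rewrite !mxevalC.
  by rewrite !DmxC !mxeval0.
- have lin Z : GRing.linear_for *%R (fun y : mat => mxcoord i (g *m y *m Z)).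
    by move=> c x y; rewrite mulmxDr mulmxDl -scalemxAr -scalemxAl linearP.
  pose l Z : {linear mat -> K | *%R} := HB.pack (fun y : mat => mxcoord i (g *m y *m Z))
    (GRing.isLinear.Build K mat K *%R _ (lin Z)).
  exists (lpoly (l k)) => y; split=> [|X].
    by rewrite (mxeval_lpoly (l k)) mxeval_var.
  rewrite Dmx_lpoly mxeval_Dvar.
  have -> : lpoly (fun y0 => l k (y0 *m X)) = lpoly (l (X *m k)).
    by apply: eq_lpoly => z /=; rewrite !mulmxA.
  rewrite (mxeval_lpoly (l (X *m k))) /=; congr mxcoord.
  by rewrite !mulmxA -(mulmxA _ k k') kk' mulmx1.
- exists (p' + q') => y; split=> [|X].
    by rewrite !mxevalD (Hp y).1 (Hq y).1.
  by rewrite !DmxD !mxevalD (Hp y).2 (Hq y).2.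
- exists (p' * q') => y; split=> [|X].
    by rewrite !mxevalM (Hp y).1 (Hq y).1.
  by rewrite !DmxM !mxevalD !mxevalM (Hp y).2 (Hq y).2 (Hp y).1 (Hq y).1.
Qed.

(** By left invariance the value of [Dmx X q] at a point [g] of [H] is the value of [Dmx X q'] at 1,
    where [q'] is the translate of [q] by [g] and still vanishes on [H]. *)
Lemma vanish_Dmx H X q : is_subgroup H -> Lie H X -> vanish H q -> vanish H (Dmx X q).
Proof.
move=> [_ _ HM _] /LieE LX Hq g Hg.
have [q' Eq'] := translate g q (mulmx1 1%:M).
have := LX q'; rewrite (Eq' 1%:M).2 !(mul1mx, mulmx1); apply=> y Hy.
by rewrite (Eq' y).1 mulmx1; apply/Hq/HM.
Qed.

Lemma zclosed_vanish H g : zclosed H -> g \in unitmx ->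
  (forall q, vanish H q -> mxeval q g = 0) -> H g.
Proof.
move=> [I ->] gU gH; split=> // q Iq; apply: gH => z [_]; exact.
Qed.

Lemma Lie_subspace H : is_subspace (Lie H).
Proof.
split=> [|c X Y /LieE LX /LieE LY]; apply/LieE => q Hq.
  have := DmxDl (-1) 0 0 q; rewrite scaler0 addr0 scaleN1r addNr => ->.
  exact: mxeval0.
by rewrite DmxDl mxevalD mxevalZ LX ?LY ?mulr0 ?addr0.
Qed.

Lemma LieS H H' : H `<=` H' -> Lie H `<=` Lie H'.
Proof. by move=> HH' X /LieE LX; apply/LieE => q Hq; apply: LX => g /HH' /Hq. Qed.

Lemma Lie_bracket H X Y :
  is_subgroup H -> Lie H X -> Lie H Y -> Lie H (bracket X Y).
Proof.
move=> sH LX LY; apply/LieE => q Hq; rewrite Dmx_bracket mxevalD mxevalN.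
have H1 : H 1%:M by case: sH.
rewrite (vanish_Dmx sH LX (vanish_Dmx sH LY Hq) H1).
by rewrite (vanish_Dmx sH LY (vanish_Dmx sH LX Hq) H1) subrr.
Qed.

(* The orientation of conjugation is the one that suits row vectors. *)
Lemma Lie_conj H H' X g : (forall z, H' z -> H (invmx g *m z *m g)) ->
  g \in unitmx -> Lie H' X -> Lie H (invmx g *m X *m g).
Proof.
move=> HH' gU /LieE LX; apply/LieE => q Hq.
have [q' Eq'] := translate (invmx g) q (mulmxV gU).
have := LX q'; rewrite (Eq' 1%:M).2 mulmx1 mulVmx //; apply=> y Hy.
by rewrite (Eq' y).1; apply/Hq/HH'.
Qed.

Lemma Lie_linear H X (l : {linear mat -> K | *%R}) c :
  (forall g, H g -> l g = c) -> Lie H X -> l X = 0.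
Proof.
move=> Hl /LieE /(_ (lpoly l - mpoly.mpolyC _ c)).
rewrite DmxD DmxN DmxC subr0 Dmx_lpoly.
have -> : lpoly (fun y => l (y *m X)) = Dmx X (lpoly l) by rewrite Dmx_lpoly.
have E : mxeval (Dmx X (lpoly l)) 1%:M = l X.
  have lin : GRing.linear_for *%R (fun y : mat => l (y *m X)).
    by move=> a x y; rewrite mulmxDl -scalemxAl linearP.
  pose m : {linear mat -> K | *%R} := HB.pack (fun y : mat => l (y *m X))
    (GRing.isLinear.Build K mat K *%R _ lin).
  by rewrite Dmx_lpoly (mxeval_lpoly m) /= mul1mx.
rewrite E; apply=> g Hg; rewrite mxevalD mxevalN mxevalC mxeval_lpoly Hl //.
exact: subrr.
Qed.

Lemma Lie_commute H (Z : mat) X : (forall g, H g -> g *m Z = Z *m g) ->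
  Lie H X -> X *m Z = Z *m X.
Proof.
move=> HZ LX; apply/matrixP => i j; apply/eqP; rewrite -subr_eq0; apply/eqP.
have lin : GRing.linear_for *%R (fun y : mat => (y *m Z) i j - (Z *m y) i j).
  move=> c x y; rewrite mulmxDl mulmxDr -scalemxAl -scalemxAr !mxE.
  by rewrite mulrBr opprD addrACA.
pose m : {linear mat -> K | *%R} := HB.pack
  (fun y : mat => (y *m Z) i j - (Z *m y) i j)
  (GRing.isLinear.Build K mat K *%R _ lin).
apply: (Lie_linear (l := m) (c := 0)) LX => g Hg /=.
by rewrite HZ // subrr.
Qed.

End LieAlgebra.

(** * Generalized eigenvectors of an operator on a module *)

Section GeneralizedEigenvectors.
Variables (K : fieldType) (V : lmodType K) (D : V -> V).
Hypothesis Dlin : forall c x y, D (c *: x + y) = c *: D x + D y.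

(** Formulated for functions on any module, since it is used for row vectors, for [bracket z], and
    for [Dmx X] on the infinite-dimensional ring of polynomials. *)
Definition geneig mu w := exists k, iter k (fun x => D x - mu *: x) w = 0.

Local Notation A mu := (fun x => D x - mu *: x).

Fact geneig_opP mu c x y : A mu (c *: x + y) = c *: A mu x + A mu y.
Proof. by rewrite /= Dlin scalerBr scalerDr opprD addrACA !scalerA (mulrC mu). Qed.

Fact geneig_iterP mu k c x y :
  iter k (A mu) (c *: x + y) = c *: iter k (A mu) x + iter k (A mu) y.
Proof. by elim: k => //= k ->; exact: geneig_opP. Qed.

Fact geneig_iter0 mu k : iter k (A mu) 0 = 0.
Proof. by have := geneig_iterP mu k (-1) 0 0; rewrite scaler0 addr0 scaleN1r addNr. Qed.

Fact geneig_iterD mu k x y : iter k (A mu) (x + y) = iter k (A mu) x + iter k (A mu) y.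
Proof. by have := geneig_iterP mu k 1 x y; rewrite !scale1r. Qed.

Fact geneig_opC mu nu x : A mu (A nu x) = A nu (A mu x).
Proof.
have E a y : D y - a *: y = (- a) *: y + D y by rewrite scaleNr addrC.
rewrite /= !E !Dlin !scalerDr !scalerA !addrA (mulrC (- mu)); congr (_ + _).
by rewrite -!addrA; congr (_ + _); rewrite addrC.
Qed.

Fact geneig_iterC mu nu k x : iter k (A mu) (A nu x) = A nu (iter k (A mu) x).
Proof. by elim: k => //= k ->; exact: geneig_opC. Qed.

Fact geneig_iter_iterC mu nu k l x :
  iter k (A mu) (iter l (A nu) x) = iter l (A nu) (iter k (A mu) x).
Proof. by elim: l => //= l IH; rewrite geneig_iterC IH. Qed.

Lemma geneig0 mu : geneig mu 0. Proof. by exists 0%N. Qed.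

Lemma geneig_iter_ge mu k l w : (k <= l)%N ->
  iter k (A mu) w = 0 -> iter l (A mu) w = 0.
Proof. by move=> /subnK <- E; rewrite iterD E geneig_iter0. Qed.

Lemma geneigP mu c w w' : geneig mu w -> geneig mu w' -> geneig mu (c *: w + w').
Proof.
move=> [k Ek] [l El]; exists (maxn k l); rewrite geneig_iterP.
rewrite (geneig_iter_ge (leq_maxl _ _) Ek) (geneig_iter_ge (leq_maxr _ _) El).
by rewrite scaler0 addr0.
Qed.

Lemma geneig_eigen mu w : D w = mu *: w -> geneig mu w.
Proof. by move=> E; exists 1%N; rewrite /= E subrr. Qed.

Variable W : V -> Prop.
Hypothesis W0 : W 0.
Hypothesis WP : forall c x y, W x -> W y -> W (c *: x + y).
Hypothesis WD : forall x, W x -> W (D x).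

Let WZ c x : W x -> W (c *: x).
Proof. by move=> Wx; rewrite -[_ *: x]addr0; apply: WP. Qed.

Let WB x y : W x -> W y -> W (x - y).
Proof. by move=> Wx Wy; rewrite addrC -scaleN1r; apply: WP. Qed.

Let WA mu x : W x -> W (A mu x).
Proof. by move=> Wx; apply: WB; [apply: WD | apply: WZ]. Qed.

(** Induction on the order of [y]: the difference of [A mu y] and [A nu y] is [(nu - mu) y], and
    [A nu y] has smaller order. *)
Fact geneig_op_inv mu nu y : mu != nu -> geneig nu y -> W (A mu y) -> W y.
Proof.
move=> ne [k]; elim: k y => [|k IH] y; first by move=> /= ->.
rewrite iterSr => Ek Wy.
have WAy : W (A nu y).
  by apply: IH => //; rewrite geneig_opC; apply: WA.
have E : A mu y - A nu y = (nu - mu) *: y.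
  by rewrite scalerBl opprB addrC addrA subrK.
have -> : y = (nu - mu)^-1 *: ((nu - mu) *: y).
  by rewrite scalerA mulVf ?scale1r // subr_eq0 eq_sym.
by rewrite -E; apply/WZ/WB.
Qed.

(** A power of [D - mu] kills the component at [mu]; by induction it sends the other components into
    [W], and [geneig_op_inv] undoes it on them. *)
Lemma geneig_uniq_sum (s : seq K) (w : K -> V) : uniq s ->
  (forall mu, geneig mu (w mu)) -> W (\sum_(mu <- s) w mu) ->
  forall mu, mu \in s -> W (w mu).
Proof.
elim: s w => [|mu s IH] w //= /andP[mus us] gw; rewrite big_cons => Ws.
have [k Ek] := gw mu.
have Wk : forall nu, nu \in s -> W (iter k (A mu) (w nu)).
  apply: IH => // [nu|].
    by have [l El] := gw nu; exists l; rewrite geneig_iter_iterC El geneig_iter0.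
  have -> : \sum_(j <- s) iter k (A mu) (w j) =
            iter k (A mu) (w mu + \sum_(j <- s) w j).
    rewrite geneig_iterD Ek add0r; apply/esym/(big_morph (iter k (A mu))).
      exact: geneig_iterD.
    exact: geneig_iter0.
  by elim: (k) => //= j; apply: WA.
have Wn nu : nu \in s -> W (w nu).
  move=> nus; have := Wk _ nus.
  have ne : mu != nu by apply: contraNneq mus => ->.
  elim: (k) => //= j IHj Wj; apply: IHj; apply: (geneig_op_inv ne) Wj.
  by have [l El] := gw nu; exists l; rewrite geneig_iter_iterC El geneig_iter0.
move=> nu; rewrite inE => /orP[/eqP->|]; last exact: Wn.
have -> : w mu = (w mu + \sum_(j <- s) w j) - \sum_(j <- s) w j by rewrite addrK.
apply: WB => //; rewrite big_seq; apply: (big_ind W) => // x y Wx Wy.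
by rewrite -[x]scale1r; apply: WP.
Qed.

(** With [W = 0] this is the independence of generalized eigenvectors, with [W] the ideal of a group
    it yields replicas, and an indicator function [f] gives the projection to one eigenvalue. The
    list may repeat eigenvalues. *)
Lemma geneig_sum (s : seq (K * V)) (f : K -> K) :
  (forall x, x \in s -> geneig x.1 x.2) ->
  W (\sum_(x <- s) x.2) -> W (\sum_(x <- s) f x.1 *: x.2).
Proof.
move=> gs Ws.
pose w nu := \sum_(x <- s | x.1 == nu) x.2.
have gw nu : geneig nu (w nu).
  rewrite /w big_seq_cond; apply: (big_ind (geneig nu)) => [||x].
  - exact: geneig0.
  - by move=> x y gx gy; rewrite -[x]scale1r; apply: geneigP.
  - by move=> /andP[xs /eqP <-]; apply: gs.
pose t := undup (map fst s).
have ut : uniq t by exact: undup_uniq.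
have Et (h : K -> K) : \sum_(nu <- t) h nu *: w nu = \sum_(x <- s) h x.1 *: x.2.
  under eq_bigr do rewrite /w scaler_sumr.
  rewrite (exchange_big_dep predT) //= big_seq [RHS]big_seq.
  apply: eq_bigr => x xs.
  rewrite big_mkcond (bigD1_seq x.1) ?mem_undup ?map_f //= eqxx.
  by rewrite big1 ?addr0 // => nu; rewrite eq_sym => /negbTE ->.
rewrite -Et big_seq; apply: (big_ind W) => // [x y Wx Wy|nu nut].
  by rewrite -[x]scale1r; apply: WP.
apply/WZ/(geneig_uniq_sum ut gw) => //.
have := Et (fun=> 1); under eq_bigr do rewrite scale1r; move=> ->.
by under eq_bigr do rewrite scale1r.
Qed.

End GeneralizedEigenvectors.

(* The truncated exponential series: the exponential of [X] if [X ^+ N = 0]. *)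
HB.lock Definition mexp (K : fieldType) (n N : nat) (X : 'M[K]_n) : 'M[K]_n :=
  \sum_(k < N) (k`!%:R)^-1 *: X ^+ k.

Lemma expmxZ (K : comNzRingType) n (c : K) (X : 'M[K]_n) k :
  (c *: X) ^+ k = c ^+ k *: X ^+ k.
Proof.
elim: k => [|k IH]; first by rewrite !expr0 scale1r.
rewrite !exprS IH -[LHS]/(c *: X *m (c ^+ k *: X ^+ k)).
by rewrite -scalemxAl -scalemxAr scalerA.
Qed.

(** * Exponentials of nilpotent matrices *)

Section NilpotentExponential.
Variables (R : realType) (n : nat).
Local Notation K := R[i].
Local Notation mat := 'M[K]_n.
Local Notation mxp := (mpoly.mpoly (n * n) K).
Variables (N : nat) (X : mat).
Hypothesis XN : X ^+ N = 0.
Implicit Types (q : mxp) (H : set mat) (s t : K).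
Local Notation E s := (mexp N (s *: X)).

Lemma mexp_line s : E s = \sum_(k < N) (s ^+ k / k`!%:R) *: X ^+ k.
Proof. by rewrite mexp.unlock; apply: eq_bigr => k _; rewrite expmxZ scalerA mulrC. Qed.

Lemma mexp0 : E 0 = 1%:M.
Proof.
rewrite mexp_line; case: N XN => [|M] XM.
  rewrite big_ord0; move: XM; rewrite expr0 => XM.
  by rewrite -[RHS]/(1 : mat) XM.
rewrite big_ord_recl big1 => [|k _]; first by rewrite expr0 divr1 scale1r addr0.
by rewrite expr0n /= mul0r scale0r.
Qed.

Lemma mexpD s t : E (s + t) = E s *m E t.
Proof.
pose e s : {poly K} := \poly_(k < N) (s ^+ k / k`!%:R).
suff H (m : nat) (Y : 'M[K]_m.+1) : Y ^+ N = 0 ->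
    mexp N ((s + t) *: Y) = mexp N (s *: Y) *m mexp N (t *: Y).
  case: n X XN => [|m] Y YN; last exact: H.
  by rewrite [LHS]flatmx0 [RHS]flatmx0.
move=> YN.
have Ee r : mexp N (r *: Y) = horner_mx Y (e r).
  rewrite mexp.unlock /e poly_def rmorph_sum /=; apply: eq_bigr => k _.
  by rewrite -mul_polyC rmorphM /= horner_mx_C rmorphXn /= horner_mx_X expmxZ
    scalerA mulrC -mul_scalar_mx.
(* Coefficientwise this is the binomial formula; the terms of degree at least [N] vanish at [Y]. *)
have ee : take_poly N (e s * e t) = e (s + t).
  apply/polyP => k; rewrite coef_take_poly coef_poly; case: ltnP => // kN.
  rewrite coefM (addrC s) exprDn mulr_suml; apply: eq_bigr => j _.
  have jk : (j <= k)%N by rewrite -ltnS.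
  rewrite !coef_poly (leq_ltn_trans jk kN) (leq_ltn_trans (leq_subr _ _) kN).
  have bf : ('C(k, j) * (j`! * (k - j)`!))%:R = (k`!)%:R :> K by rewrite bin_fact.
  have bn : 'C(k, j)%:R != 0 :> K by rewrite pnatr_eq0 -lt0n bin_gt0.
  rewrite -[_ *+ 'C(k, j)]mulr_natl -bf !natrM [in RHS]invfM [RHS]mulrACA divff // mul1r.
  by rewrite invfM [LHS]mulrACA (mulrC (s ^+ j)).
rewrite !Ee -[RHS]/(horner_mx Y (e s) * horner_mx Y (e t)) -rmorphM.
rewrite -[e s * e t](poly_take_drop N) ee rmorphD rmorphM /= rmorphXn /= horner_mx_X.
by rewrite YN mulr0 addr0.
Qed.

Lemma mexp_unit s : E s \in unitmx.
Proof.
have H : E s *m E (- s) = 1%:M by rewrite -mexpD subrr mexp0.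
by have [] := mulmx1_unit H.
Qed.

Lemma mexp_inv s : invmx (E s) = E (- s).
Proof.
by rewrite -[LHS]mulmx1 -mexp0 -(subrr s) mexpD mulmxA mulVmx ?mul1mx ?mexp_unit.
Qed.

(** Chain rule along the curve [E s], whose derivative is [E s X]; because [X ^+ N = 0] the
    truncated series satisfies this exactly. *)
Lemma mexp_poly q : exists r : {poly K}, forall s,
  r.[s] = mxeval q (E s) /\ (r^`()).[s] = mxeval (Dmx X q) (E s).
Proof.
elim/mxp_ind: q => [c|k|p q [r Hr] [r' Hr']|p q [r Hr] [r' Hr']].
- exists c%:P => s; rewrite derivC hornerC horner0 DmxC mxevalC.
  by rewrite (_ : mxeval _ _ = 0) // mxeval0.
- exists (\poly_(j < N) (mxcoord k (X ^+ j) / j`!%:R)) => s.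
  split.
    rewrite horner_poly mxeval_var -/(mxcoord k _) mexp_line linear_sum.
    by apply: eq_bigr => j _; rewrite linearZ /= [RHS]mulrAC mulrC mulrA.
  rewrite mxeval_Dvar mexp_line mulmx_suml linear_sum /=.
  case: N XN => [|M] XM.
    by rewrite big_ord0 poly_def big_ord0 derivC horner0.
  rewrite poly_def raddf_sum horner_sum big_ord_recl [RHS]big_ord_recr /=.
  rewrite derivZ expr0 derivC scaler0 horner0 add0r.
  rewrite -scalemxAl -[X ^+ M *m X]/(X ^+ M * X) -exprSr XM scaler0 linear0 addr0.
  apply: eq_bigr => j _; rewrite derivZ derivXn hornerZ hornerMn hornerXn /=.
  rewrite -scalemxAl linearZ /= -[X ^+ j *m X]/(X ^+ j * X) -exprSr /bump /= add1n.
  rewrite factS natrM -[s ^+ _ *+ _]mulr_natr invfM add0n.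
  have f2 : j.+1%:R != 0 :> K by rewrite pnatr_eq0.
  by rewrite mulrC mulrACA mulVKf // [RHS]mulrAC.
- exists (r + r') => s; rewrite derivD !hornerD DmxD !mxevalD.
  by rewrite !(Hr s).1 !(Hr s).2 (Hr' s).1 (Hr' s).2.
- exists (r * r') => s; rewrite derivM !hornerE DmxM mxevalD !mxevalM.
  by rewrite !(Hr s).1 !(Hr s).2 (Hr' s).1 (Hr' s).2.
Qed.

Lemma poly_fun_eq0 (r : {poly K}) : (forall s, r.[s] = 0) -> r = 0.
Proof.
move=> r0; apply/eqP; apply: contraT => rn0.
pose l := [seq (k%:R : K) | k <- iota 0 (size r)].
have ul : uniq l by rewrite map_inj_uniq ?iota_uniq // => i j /eqP; rewrite eqr_nat => /eqP.
have al : all (root r) l by apply/allP => s _; apply/rootP.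
by have := max_poly_roots rn0 al ul; rewrite size_map size_iota ltnn.
Qed.

Lemma poly_fun_eq (r r' : {poly K}) : (forall s, r.[s] = r'.[s]) -> r = r'.
Proof.
move=> rr; apply/eqP; rewrite -subr_eq0; apply/eqP/poly_fun_eq0 => s.
by rewrite hornerD hornerN rr subrr.
Qed.

(** Along the curve [q] becomes a polynomial [r] in [s]. Its derivative comes from [Dmx X q], which
    vanishes on [H] again, so it is zero by induction on the degree; then [r] is constant, with the
    value 0 of [q] at 1. *)
Lemma Lie_mexp H s : is_subgroup H -> zclosed H -> Lie H X -> H (E s).
Proof.
move=> sH zH LX; apply: zclosed_vanish (mexp_unit s) _ => // q Hq.
suff z m : forall q (r : {poly K}), vanish H q -> (size r <= m)%N ->
    (forall s, r.[s] = mxeval q (E s) /\ (r^`()).[s] = mxeval (Dmx X q) (E s)) ->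
    r = 0.
  by have [r Hr] := mexp_poly q; rewrite -(Hr s).1 (z _ _ _ Hq (leqnn _) Hr) horner0.
elim: m => [|m IH] {Hq}q r Hq szr Hr; first by apply/eqP; rewrite -size_poly_leq0.
have [r' Hr'] := mexp_poly (Dmx X q).
have r'E : r' = r^`() by apply: poly_fun_eq => t; rewrite (Hr t).2 (Hr' t).1.
have r'0 : r' = 0.
  apply: (IH _ _ (vanish_Dmx sH LX Hq)) => //.
  rewrite r'E; have [->|rn0] := eqVneq r 0; first by rewrite derivC size_poly0.
  by rewrite -ltnS (leq_trans (lt_size_deriv rn0)).
have rC : r = (r`_0)%:P.
  apply/polyP => -[|k]; rewrite coefC //=; apply/eqP.
  have /polyP /(_ k) : r^`() = 0 by rewrite -r'E.
  by rewrite coef_deriv coef0 => /eqP; rewrite -mulr_natr mulf_eq0 pnatr_eq0 orbF.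
rewrite rC; have := (Hr 0).1; rewrite mexp0 Hq; last by case: sH.
by rewrite horner_coef0 => ->.
Qed.

Lemma mexp_Lie H : (forall s, H (E s)) -> Lie H X.
Proof.
move=> HE; apply/LieE => q Hq; have [r Hr] := mexp_poly q.
have r0 : r = 0 by apply: poly_fun_eq0 => s; rewrite (Hr s).1 Hq.
by rewrite -mexp0 -(Hr 0).2 r0 derivC horner0.
Qed.

End NilpotentExponential.

(** * Generalized eigenbases and replicas of a matrix *)

Section RowEigenvectors.
Variables (R : realType) (n : nat).
Local Notation K := R[i].
Local Notation mat := 'M[K]_n.
Implicit Types (X : mat) (v : 'rV[K]_n) (mu : K).

Definition roweig X mu v := geneig (fun u : 'rV[K]_n => u *m X) mu v.

Lemma roweig_iter X mu k v :
  iter k (fun u => u *m X - mu *: u) v = v *m (X - mu%:M) ^+ k.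
Proof.
elim: k => [|k IH]; first by rewrite expr0 [RHS]mulmx1.
by rewrite exprSr /= IH [RHS]mulmxA mulmxBr mul_mx_scalar.
Qed.

Lemma mulmxr_lin X c (x y : 'rV[K]_n) : (c *: x + y) *m X = c *: (x *m X) + y *m X.
Proof. by rewrite mulmxDl -scalemxAl. Qed.

End RowEigenvectors.

Lemma geig_basis (R : realType) n (X : 'M[R[i]]_n) :
  exists ad : 'M[R[i]]_n * ('I_n -> R[i]),
  ad.1 \in unitmx /\ forall i, roweig X (ad.2 i) (row i ad.1).
Proof.
case: n X => [|m] X; first by exists (1%:M, fun=> 0); split=> [|[]//]; exact: unitmx1.
have [rs Ers] := closed_field_poly_normal (char_poly X).
have := char_poly_monic X; rewrite monicE => /eqP lc.
rewrite lc scale1r in Ers.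
pose t := undup rs; pose r (i : 'I_(size t)) := t`_i.
have r_inj : injective r.
  by move=> i j /eqP; rewrite nth_uniq ?undup_uniq // => /eqP/val_inj.
(* The size [m.+1], also the exponent in [geigenspace], bounds all multiplicities, so each root is
   needed only once. *)
pose Q := \prod_i ('X - (r i)%:P) ^+ m.+1.
have dQ : char_poly X %| Q.
  have ->: Q = \prod_(x <- t) ('X - x%:P) ^+ m.+1.
    by rewrite (big_nth 0) big_mkord.
  have szrs : size rs = m.+1.
    by have := size_char_poly X; rewrite Ers size_prod_XsubC => -[].
  rewrite Ers.
  have -> : \prod_(z <- rs) ('X - z%:P) =
            \prod_(x <- t) ('X - x%:P) ^+ count_mem x rs.
    by rewrite prodr_undup_exp_count.
  apply: (big_ind2 (fun p q : {poly R[i]} => p %| q)) => [||x _].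
  - exact: dvdpp.
  - by move=> p1 p2 q1 q2; apply: dvdp_mul.
  - by apply: dvdp_exp2l; rewrite -szrs count_size.
have full : (1%:M <= \sum_i geigenspace X (r i))%MS.
  have cop : {in predT &, forall i j : 'I_(size t), j != i ->
      coprimep (('X - (r i)%:P) ^+ m.+1) (('X - (r j)%:P) ^+ m.+1)}.
    move=> i j _ _ ji; rewrite coprimep_expr ?coprimep_expl // coprimep_XsubC.
    by rewrite root_XsubC (inj_eq r_inj).
  have /eqmxP := kermxpoly_prod X cop => /andP[le _]; apply: submx_trans le.
  apply/sub_kermxP; rewrite mul1mx; move: dQ => /dvdpP[q]; rewrite /Q => ->.
  by rewrite rmorphM /= Cayley_Hamilton mulr0.
pose I := ('I_(size t) * 'I_m.+1)%type.
pose S : 'M[R[i]]_(#|{: I}|, m.+1) :=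
  \matrix_k row (enum_val k).2 (geigenspace X (r (enum_val k).1)).
have fS : row_full S.
  rewrite -sub1mx; apply: submx_trans full _; apply/sumsmx_subP => i _.
  apply/row_subP => j.
  have -> : row j (geigenspace X (r i)) = row (enum_rank ((i, j) : I)) S.
    by rewrite rowK enum_rankK.
  exact: row_sub.
pose g := fullrankfun fS.
exists (rowsub g S, fun i => r (enum_val (g i)).1); split=> /= [|i].
  by rewrite -row_full_unit; exact: fullrowsub_full.
exists m.+1; rewrite roweig_iter row_rowsub rowK.
have : (row (enum_val (g i)).2 (geigenspace X (r (enum_val (g i)).1))
  <= geigenspace X (r (enum_val (g i)).1))%MS by exact: row_sub.
by rewrite geigenspaceE => /sub_kermxP.
Qed.

Section GeneralizedEigenbasis.
Variables (R : realType) (n : nat).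
Local Notation K := R[i].
Local Notation mat := 'M[K]_n.
Implicit Types (X : mat) (v : 'rV[K]_n) (mu : K).

Definition eigbasis X := (projT1 (cid (geig_basis X))).1.
Definition eigvals X := (projT1 (cid (geig_basis X))).2.

End GeneralizedEigenbasis.

(* [replica X f] acts on the generalized eigenspace of [X] for [mu] as the
   scalar [f mu]; in particular [replica X id] is the semisimple part of [X]. *)
HB.lock Definition replica (R : realType) n (X : 'M[R[i]]_n) (f : R[i] -> R[i]) :
    'M[R[i]]_n :=
  invmx (eigbasis X) *m diag_mx (\row_i f (eigvals X i)) *m eigbasis X.

Section Replica.
Variables (R : realType) (n : nat).
Local Notation K := R[i].
Local Notation mat := 'M[K]_n.
Implicit Types (X : mat) (v : 'rV[K]_n) (mu : K).

Let replicaE X f : replica X f =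
  invmx (eigbasis X) *m diag_mx (\row_i f (eigvals X i)) *m eigbasis X.
Proof. by rewrite replica.unlock. Qed.

Lemma eigbasis_unit X : eigbasis X \in unitmx.
Proof. by rewrite /eigbasis; case: cid => ad /= []. Qed.

Lemma eigbasis_row X i : roweig X (eigvals X i) (row i (eigbasis X)).
Proof. by rewrite /eigbasis /eigvals; case: cid => ad /= []. Qed.

Lemma eigbasis_replica X f i :
  row i (eigbasis X) *m replica X f = f (eigvals X i) *: row i (eigbasis X).
Proof.
rewrite !replicaE !mulmxA -row_mul mulmxV ?eigbasis_unit // row1 -rowE.
by rewrite row_diag_mx -scalemxAl mxE -rowE.
Qed.

Definition eigdec X v : seq (K * 'rV[K]_n) :=
  [seq (eigvals X i, (v *m invmx (eigbasis X)) 0 i *: row i (eigbasis X))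
     | i <- index_enum 'I_n].

Lemma eigdec_sum X v f :
  \sum_(x <- eigdec X v) f x.1 *: x.2 = v *m replica X f.
Proof.
rewrite big_map /= -[in RHS](mulmxKV (eigbasis_unit X) v).
rewrite (mulmx_sum_row (v *m invmx (eigbasis X))) mulmx_suml.
apply: eq_bigr => i _.
by rewrite -[in RHS]scalemxAl eigbasis_replica !scalerA mulrC.
Qed.

Lemma replica1 X : replica X (fun=> 1) = 1%:M.
Proof.
rewrite !replicaE (_ : \row_i 1 = const_mx 1); last by apply/rowP => i; rewrite !mxE.
by rewrite diag_const_mx mulmx1 mulVmx // eigbasis_unit.
Qed.

Lemma eigdec_sum1 X v : \sum_(x <- eigdec X v) x.2 = v.
Proof.
rewrite -[RHS]mulmx1 -(replica1 X) -eigdec_sum.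
by apply: eq_bigr => x _; rewrite scale1r.
Qed.

Lemma eigdec_geneig X v x : x \in eigdec X v -> roweig X x.1 x.2.
Proof.
move=> /mapP[i _ ->] /=; rewrite -[_ *: _]addr0; apply: geneigP.
- exact: mulmxr_lin.
- exact: eigbasis_row.
- exact: geneig0.
Qed.

(** Hence the replica does not depend on the chosen basis. The components of [v], together with
    [- v] placed at [mu], sum to zero, and by independence they still do after weighting by [f]. *)
Lemma replica_roweig X f mu v : roweig X mu v -> v *m replica X f = f mu *: v.
Proof.
move=> gv; pose s := (mu, - v) :: eigdec X v.
have sum0 (h : K -> K) : \sum_(x <- s) h x.1 *: x.2 = v *m replica X h - h mu *: v.
  by rewrite big_cons /= eigdec_sum scalerN addrC.
have := @geneig_sum _ _ _ (mulmxr_lin X) (fun v => v = 0) erefl _ _ s f.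
rewrite sum0 => E; apply/eqP; rewrite -subr_eq0; apply/eqP; apply: E.
- by move=> c x y -> ->; rewrite scaler0 addr0.
- by move=> x ->; rewrite mul0mx.
- move=> x; rewrite inE => /orP[/eqP-> /=|]; last exact: eigdec_geneig.
  rewrite -scaleN1r -[_ *: _]addr0; apply: geneigP => //; first exact: mulmxr_lin.
  exact: geneig0.
- by rewrite big_cons eigdec_sum1 /= addNr.
Qed.

Lemma replica_stable X f (W : 'rV[K]_n -> Prop) : W 0 ->
  (forall c x y, W x -> W y -> W (c *: x + y)) ->
  (forall x, W x -> W (x *m X)) -> forall x, W x -> W (x *m replica X f).
Proof.
move=> W0 WP WX x Wx; rewrite -eigdec_sum.
apply: (@geneig_sum _ _ _ (mulmxr_lin X) W W0 WP WX (eigdec X x) f).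
  by move=> y; exact: eigdec_geneig.
by rewrite eigdec_sum1.
Qed.

Lemma replica_comm X f Y : X *m Y = Y *m X -> replica X f *m Y = Y *m replica X f.
Proof.
move=> XY; apply: (can_inj (mulKmx (eigbasis_unit X))).
apply/row_matrixP => i; rewrite !row_mul !mulmxA. rewrite eigbasis_replica.
rewrite -scalemxAl (@replica_roweig X f (eigvals X i)) //.
have [k Ek] := eigbasis_row X i; exists k.
rewrite roweig_iter -mulmxA.
suff -> : Y *m (X - (eigvals X i)%:M) ^+ k = (X - (eigvals X i)%:M) ^+ k *m Y.
  by rewrite mulmxA -roweig_iter Ek mul0mx.
elim: k {Ek} => [|k IH]; first by rewrite expr0 [LHS]mulmx1 [RHS]mul1mx.
set A := X - _ in IH *; have -> : A ^+ k.+1 = A ^+ k *m A by exact: exprSr.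
rewrite mulmxA IH -!mulmxA; congr (_ *m _).
by rewrite /A mulmxBr mulmxBl XY scalar_mxC.
Qed.

Lemma replicaD X f g : replica X (fun x => f x + g x) = replica X f + replica X g.
Proof.
rewrite !replicaE -mulmxDl -mulmxDr -linearD /=.
by congr (_ *m diag_mx _ *m _); apply/rowP => i; rewrite !mxE.
Qed.

Lemma replicaZ X c f : replica X (fun x => c * f x) = c *: replica X f.
Proof.
rewrite !replicaE scalemxAl scalemxAr -linearZ /=.
by congr (_ *m diag_mx _ *m _); apply/rowP => i; rewrite !mxE.
Qed.

Lemma replicaM X f g : replica X (fun x => f x * g x) = replica X f *m replica X g.
Proof.
rewrite !replicaE; have aU := eigbasis_unit X; move: (eigbasis X) aU => b bU.
have -> : \row_i (f (eigvals X i) * g (eigvals X i)) =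
    \row_i ((\row_i0 f (eigvals X i0)) 0 i * (\row_i0 g (eigvals X i0)) 0 i).
  by apply/rowP => i; rewrite !mxE.
rewrite -mulmx_diag; move: (diag_mx _) (diag_mx _) => d d'.
by rewrite !mulmxA (mulmxK bU).
Qed.

Lemma eq_replica X f g : f =1 g -> replica X f = replica X g.
Proof. by move=> /funext ->. Qed.

Lemma replica_diag (b : mat) (d : 'rV[K]_n) f : b \in unitmx ->
  replica (invmx b *m diag_mx d *m b) f =
  invmx b *m diag_mx (\row_i f (d 0 i)) *m b.
Proof.
move=> bU; apply: (can_inj (mulKmx bU)); apply/row_matrixP => i.
rewrite !mulmxA mulmxV // mul1mx !row_mul row_diag_mx -scalemxAl -rowE mxE.
apply: replica_roweig; apply: geneig_eigen => /=.
by rewrite -row_mul !mulmxA mulmxV // mul1mx row_mul row_diag_mx -scalemxAl -rowE.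
Qed.

(** On a generalized eigenvector for [mu] the powers of this difference act as those of [X - mu]. *)
Lemma replica_nilpotent_part X : nilpotent_mx (X - replica X id).
Proof.
set Y := X - _.
have H (k : nat) i v : roweig X (eigvals X i) v ->
    iter k (fun u => u *m X - eigvals X i *: u) v = v *m Y ^+ k.
  elim: k v => [|k IH] v gv; first by rewrite expr0 [RHS]mulmx1.
  rewrite exprS iterSr [RHS]mulmxA IH.
    by congr (_ *m _); rewrite mulmxBr (replica_roweig id gv).
  by case: gv => l El; exists l; rewrite geneig_iterC ?El ?mul0mx ?scaler0 ?subrr //;
     exact: mulmxr_lin.
have /choice[k Hk] : forall i, exists k, row i (eigbasis X) *m Y ^+ k = 0.
  move=> i; have [k Ek] := eigbasis_row X i.
  by exists k; rewrite -(H _ i) ?Ek //; exact: eigbasis_row.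
exists (\max_i k i); apply: (can_inj (mulKmx (eigbasis_unit X))).
apply/row_matrixP => i; rewrite mulmx0 row_mul row0.
by rewrite -(subnKC (leq_bigmax i)) exprD [LHS]mulmxA Hk mul0mx.
Qed.

End Replica.

(** * A trace criterion for nilpotency *)

Section TraceCriterion.
Variables (R : realType) (n : nat).
Local Notation K := R[i].
Implicit Types (X Y : 'M[K]_n).

Lemma nilpotent_comm_mul X Y : nilpotent_mx X -> X *m Y = Y *m X ->
  nilpotent_mx (X *m Y).
Proof.
move=> [k Xk] XY; exists k; rewrite -[X *m Y]/(X * Y) exprMn_comm // Xk.
by rewrite mul0r.
Qed.

Lemma nilpotent_trace m (Y : 'M[K]_m) : nilpotent_mx Y -> \tr Y = 0.
Proof.
case: m Y => [|m] Y [k Yk]; first by rewrite /mxtrace big_ord0.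
have [rs Ers] := closed_field_poly_normal (char_poly Y).
have := char_poly_monic Y; rewrite monicE => /eqP lc.
rewrite lc scale1r in Ers.
have rs0 z : z \in rs -> z = 0.
  move=> zrs; have : root (char_poly Y) z by rewrite Ers root_prod_XsubC.
  rewrite -eigenvalue_root_char => /eigenvalueP[v vY vn0].
  have vk j : v *m Y ^+ j = z ^+ j *: v.
    elim: j => [|j IH]; first by rewrite !expr0 scale1r [LHS]mulmx1.
    have -> : Y ^+ j.+1 = Y *m Y ^+ j by exact: exprS.
    by rewrite mulmxA vY -scalemxAl IH scalerA -exprS.
  have /eqP := vk k; rewrite Yk mulmx0 eq_sym scaler_eq0 (negbTE vn0) orbF.
  by rewrite expf_eq0 => /andP[_ /eqP].
have szrs : size rs = m.+1.
  by have := size_char_poly Y; rewrite Ers size_prod_XsubC => -[].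
have E : char_poly Y = 'X^(m.+1).
  rewrite Ers (eq_big_seq (fun=> 'X : {poly R[i]})) => [|z zrs]; last by rewrite (rs0 _ zrs) subr0.
  by rewrite big_const_seq count_predT szrs iter_mulr mulr1.
have := char_poly_trace Y (ltn0Sn m); rewrite E coefXn /= ltn_eqF //.
by move/esym/eqP; rewrite oppr_eq0 => /eqP.
Qed.

(** The nilpotent part of [X] contributes nothing, so the trace is the sum of [|mu|^2] over the
    eigenvalues. Conjugation being additive, the second factor stays in any [Lie H] that contains
    [X]. *)
Lemma trace_conj_nilpotent X : \tr (X *m replica X Num.conj) = 0 -> nilpotent_mx X.
Proof.
have nX := replica_nilpotent_part X; set S := replica X id in nX.
rewrite -{1}(subrK S X) mulmxDl linearD /=.
have comX f : replica X f *m X = X *m replica X f by exact: replica_comm.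
rewrite nilpotent_trace ?add0r; last first.
  by apply: nilpotent_comm_mul => //; rewrite mulmxBl mulmxBr comX -!replicaM;
     congr (_ - _); apply: eq_replica => x; rewrite mulrC.
rewrite -replicaM replica.unlock mxtrace_mulC mulmxA mulmxV ?eigbasis_unit // mul1mx.
rewrite mxtrace_diag => tr0.
have d0 i : eigvals X i = 0.
  have pos j : true -> 0 <= (\row_i0 (eigvals X i0 * Num.conj (eigvals X i0))) 0 j.
    by rewrite mxE -normCK exprn_ge0 // normr_ge0.
  have : (\row_i0 (eigvals X i0 * Num.conj (eigvals X i0))) 0 i = 0.
    exact: (psumr_eq0P pos tr0).
  rewrite mxE -normCK => /eqP.
  by rewrite sqrf_eq0 normr_eq0 => /eqP.
have S0 : S = 0.
  rewrite /S replica.unlock (_ : \row_i _ = 0); last by apply/rowP => i; rewrite !mxE d0.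
  by rewrite linear0 mulmx0 mul0mx.
by move: nX; rewrite S0 subr0.
Qed.

End TraceCriterion.

(** * Replicas in algebraic groups and in their Lie algebras *)

Definition add_hom (V W : nmodType) (f : V -> W) :=
  f 0 = 0 /\ forall x y, f (x + y) = f x + f y.

Definition exp_hom (V : nmodType) (A : pzSemiRingType) (f : V -> A) :=
  f 0 = 1 /\ forall x y, f (x + y) = f x * f y.

Lemma lpolyZ (R : realType) n c (l : 'M[R[i]]_n -> R[i]) :
  lpoly (fun y => c * l y) = c *: lpoly l.
Proof. by rewrite /lpoly scaler_sumr; apply: eq_bigr => k _; rewrite scalerA. Qed.

Section ReplicasInGroups.
Variables (R : realType) (n : nat).
Local Notation K := R[i].
Local Notation mat := 'M[K]_n.
Local Notation mxp := (mpoly.mpoly (n * n) K).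
Variable X : mat.
Implicit Types (q : mxp) (H : set mat) (f : K -> K).

Lemma Dmx_lin c q q' : Dmx X (c *: q + q') = c *: Dmx X q + Dmx X q'.
Proof. by rewrite DmxD DmxZ. Qed.

(** The last two clauses describe how replicas act, by derivation and by right translation; a
    relation between weight components thus transfers to replicas in the Lie algebra and in the
    group alike. *)
Definition weight_poly (mu : K) q :=
  [/\ geneig (Dmx X) mu q,
      forall f, add_hom f -> forall y,
        mxeval (Dmx (replica X f) q) y = f mu * mxeval q y
    & forall f, exp_hom f -> forall y,
        mxeval q (y *m replica X f) = f mu * mxeval q y].

Lemma geneigM mu nu p q : geneig (Dmx X) mu p -> geneig (Dmx X) nu q ->
  geneig (Dmx X) (mu + nu) (p * q).
Proof.
move=> [k]; elim: k p q => [|k IHk] p q Ek.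
  by move: Ek => /= -> _; rewrite mul0r; exact: geneig0.
move=> [l]; elim: l q => [|l IHl] q El.
  by move: El => /= ->; rewrite mulr0; exact: geneig0.
suff [j Ej] : geneig (Dmx X) (mu + nu)
    (Dmx X (p * q) - (mu + nu) *: (p * q)) by exists j.+1; rewrite iterSr.
have -> : Dmx X (p * q) - (mu + nu) *: (p * q) =
    (Dmx X p - mu *: p) * q + p * (Dmx X q - nu *: q).
  by rewrite DmxM mulrBl mulrBr scalerDl opprD addrACA -scalerAl -scalerAr.
rewrite -[X in geneig _ _ (X + _)]scale1r; apply: geneigP.
- exact: Dmx_lin.
- apply: IHk; first by rewrite -iterSr.
  by exists l.+1.
- by apply: IHl; rewrite -iterSr.
Qed.

Lemma weight_polyM mu nu p q : weight_poly mu p -> weight_poly nu q ->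
  weight_poly (mu + nu) (p * q).
Proof.
move=> [gp ap ep] [gq aq eq]; split; first exact: geneigM.
- move=> f hf y; rewrite DmxM mxevalD !mxevalM ap // aq // hf.2 mulrDl.
  by rewrite -!mulrA [X in _ + X]mulrCA.
- move=> f hf y; rewrite !mxevalM ep // eq // hf.2.
  by rewrite mulrACA.
Qed.

Lemma weight_polyC c : weight_poly 0 (mpoly.mpolyC _ c).
Proof.
split.
- by apply: geneig_eigen; rewrite DmxC scale0r.
- by move=> f [f0 _] y; rewrite DmxC f0 mul0r; exact: mxeval0.
- by move=> f [f0 _] y; rewrite !mxevalC f0 mul1r.
Qed.

Lemma eigbasis_dual mu j v : roweig X mu v -> mu != eigvals X j ->
  (v *m invmx (eigbasis X)) 0 j = 0.
Proof.
move=> gv ne; pose f x : K := (x == eigvals X j)%:R.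
have : v *m replica X f = 0 by rewrite (replica_roweig _ gv) /f (negbTE ne) scale0r.
rewrite replica.unlock => /(congr1 (mulmx^~ (invmx (eigbasis X)))).
rewrite mul0mx !mulmxA mulmxK ?eigbasis_unit //.
move=> /matrixP /(_ 0 j); rewrite mul_mx_diag [LHS]mxE [X in _ * X]mxE [RHS]mxE.
by rewrite /f eqxx mulr1.
Qed.

(** The columns of the inverse are the dual basis, and the transposed action has the same
    generalized eigenvalues; the identity is tested against every row of the basis. *)
Lemma eigbasis_col j : exists k,
  (X - (eigvals X j)%:M) ^+ k *m col j (invmx (eigbasis X)) = 0.
Proof.
set A := X - _.
have /choice[k Hk] : forall i, exists k, forall l,
    row i (eigbasis X) *m A ^+ (l + k) *m col j (invmx (eigbasis X)) = 0.
  move=> i; have [k Ek] := eigbasis_row X i.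
  have [E|ne] := eqVneq (eigvals X i) (eigvals X j).
    exists k => l; rewrite addnC; have -> : A ^+ (k + l) = A ^+ k *m A ^+ l by exact: exprD.
    by move: Ek; rewrite E roweig_iter -/A mulmxA => ->; rewrite !mul0mx.
  exists 0%N => l; apply/matrixP => a b; rewrite !ord1.
  have E2 (u : 'rV[K]_n) (B : mat) : (u *m col j B) 0 0 = (u *m B) 0 j.
    by rewrite !mxE; apply: eq_bigr => c _; rewrite !mxE.
  rewrite E2 [RHS]mxE; apply: (eigbasis_dual (mu := eigvals X i)) => //.
  exists k; rewrite addn0 -roweig_iter geneig_iter_iterC; last exact: mulmxr_lin.
  by rewrite Ek geneig_iter0 //; exact: mulmxr_lin.
exists (\max_i k i); apply: (can_inj (mulKmx (eigbasis_unit X))).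
apply/row_matrixP => i; rewrite mulmx0 row0 row_mul mulmxA.
by rewrite -(subnK (leq_bigmax i)) Hk.
Qed.

(** The coordinate of row [i] of [y] along basis vector [j]. Right multiplication by [X] acts on
    each row, so these forms diagonalize all replicas. *)
Definition weight_form i j : mat -> K :=
  mxentry 1%:M (invmx (eigbasis X)) i j.

Lemma weight_polyX i j : weight_poly (eigvals X j) (lpoly (weight_form i j)).
Proof.
set b := invmx (eigbasis X).
have wE y : weight_form i j y = (row i y *m col j b) 0 0.
  by rewrite /weight_form /mxentry mul1mx !mxE; apply: eq_bigr => k _; rewrite !mxE.
have rb f : replica X f *m col j b = f (eigvals X j) *: col j b.
  rewrite replica.unlock colE -!mulmxA mulKVmx ?eigbasis_unit // scalemxAr.
  congr (_ *m _); apply/colP => k; rewrite mul_diag_mx !mxE.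
  by have [->|] := eqVneq k j; rewrite ?mulr0.
split.
- have [k Ek] := eigbasis_col j; exists k.
  have -> : iter k (fun q => Dmx X q - eigvals X j *: q) (lpoly (weight_form i j)) =
      lpoly (mxentry 1%:M ((X - (eigvals X j)%:M) ^+ k *m b) i j).
    elim: k {Ek} => [|k IH] /=.
      by rewrite expr0 -[1 *m b]/(1%:M *m b) mul1mx.
    rewrite IH Dmx_lpoly -[lpoly _ - _]addrC -scaleNr.
    rewrite -lpolyP; apply: eq_lpoly => y.
    rewrite /mxentry !mul1mx.
    have -> : (X - (eigvals X j)%:M) ^+ k.+1 =
        (X - (eigvals X j)%:M) *m (X - (eigvals X j)%:M) ^+ k by exact: exprS.
    rewrite -[in RHS]mulmxA mulmxBl mulmxBr mul_scalar_mx -scalemxAr.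
    rewrite [RHS]mxE [X in _ = _ + X]mxE [X in _ = _ - X]mxE mulNr addrC.
    by rewrite /= /mxentry mul1mx [in RHS]mulmxA.
  rewrite (eq_lpoly (l2 := fun y => 0 * 0 + 0)) ?lpolyP.
    by rewrite scale0r add0r /lpoly big1 // => l _; rewrite scale0r.
  move=> y; rewrite /mxentry mul1mx mul0r addr0.
  move/colP: Ek => Ek; rewrite mxE big1 // => l _.
  suff -> : ((X - (eigvals X j)%:M) ^+ k *m b) l j = 0 by rewrite mulr0.
  have := Ek l; rewrite mxE [RHS]mxE => <-; rewrite mxE.
  by apply: eq_bigr => c _; rewrite mxE.
- move=> f _ y; rewrite Dmx_lpoly.
  have E : (fun y => weight_form i j (y *m replica X f)) =1
      (fun y => f (eigvals X j) * weight_form i j y).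
    move=> z; rewrite !wE row_mul -mulmxA rb -scalemxAr.
    by rewrite mxE.
  by rewrite (eq_lpoly E) lpolyZ mxevalZ.
- move=> f _ y; rewrite !mxeval_lpoly /=.
  rewrite -/(weight_form i j (y *m _)) -/(weight_form i j y) !wE row_mul -mulmxA rb -scalemxAr.
  by rewrite mxE.
Qed.

Lemma weight_poly_dec q : exists s : seq (K * mxp),
  (forall x, x \in s -> weight_poly x.1 x.2) /\ q = \sum_(x <- s) x.2.
Proof.
elim/mxp_ind: q => [c|k|p q [s [Hs ->]] [t [Ht ->]]|p q [s [Hs ->]] [t [Ht ->]]].
- exists [:: (0, mpoly.mpolyC _ c)]; rewrite big_seq1; split=> // x.
  by rewrite inE => /eqP ->; exact: weight_polyC.
- have [i [j ->]] : exists i j, k = mxvec_index i j.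
    by case/mxvec_indexP: k => i j; exists i, j.
  exists [seq (eigvals X l, eigbasis X l j *: lpoly (weight_form i l)) | l <- index_enum 'I_n].
  split=> [x /mapP[l _ ->] /=|].
    have [g a e] := weight_polyX i l; split.
    + rewrite -[_ *: _]addr0; apply: geneigP => //; first exact: Dmx_lin.
      exact: geneig0.
    + by move=> f hf y; rewrite DmxZ !mxevalZ a // mulrCA.
    + by move=> f hf y; rewrite !mxevalZ e // mulrCA.
  rewrite big_map /= -lpoly_sum mxvar_lpoly; apply: eq_lpoly => y.
  rewrite /mxcoord mxvecE -[y in LHS](mulmxKV (eigbasis_unit X)) mxE.
  by apply: eq_bigr => l _; rewrite /weight_form /mxentry mul1mx mulrC.
- exists (s ++ t); split=> [x|]; last by rewrite big_cat.
  by rewrite mem_cat => /orP[/Hs|/Ht].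
- exists [seq (x.1 + y.1, x.2 * y.2) | x <- s, y <- t]; split=> [z|].
    by move=> /allpairsP[[x y] /= [xs yt ->]]; apply: weight_polyM; [exact: Hs|exact: Ht].
  by rewrite big_allpairs_dep mulr_suml; apply: eq_bigr => x _; rewrite mulr_sumr.
Qed.

Lemma vanish_weighted H (s : seq (K * mxp)) f : is_subgroup H -> Lie H X ->
  (forall x, x \in s -> weight_poly x.1 x.2) -> vanish H (\sum_(x <- s) x.2) ->
  vanish H (\sum_(x <- s) f x.1 *: x.2).
Proof.
move=> sH LX Hs Vs.
have V0 : vanish H 0 by move=> g _; exact: mxeval0.
have VP c p q : vanish H p -> vanish H q -> vanish H (c *: p + q).
  by move=> Hp Hq g Hg; rewrite mxevalD mxevalZ Hp // Hq // mulr0 addr0.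
apply: (@geneig_sum _ _ _ Dmx_lin _ V0 VP _ s f) => // [q|x /Hs[] //].
exact: vanish_Dmx.
Qed.

Lemma Lie_replica H f : is_subgroup H -> Lie H X -> add_hom f -> Lie H (replica X f).
Proof.
move=> sH LX hf; apply/LieE => q.
have [s [Hs ->]] := weight_poly_dec q => Vq.
have H1 : H 1%:M by case: sH.
rewrite Dmx_sum mxeval_sum; have E := vanish_weighted f sH LX Hs Vq H1.
rewrite mxeval_sum in E; rewrite -[RHS]E big_seq [RHS]big_seq; apply: eq_bigr => x xs.
by rewrite mxevalZ; case: (Hs x xs) => _ /(_ f hf) ->.
Qed.

Lemma replica_exp_unit f : exp_hom f -> replica X f \in unitmx.
Proof.
move=> [f0 fD]; have : replica X f *m replica X (f \o -%R) = 1%:M.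
  rewrite -replicaM -(replica1 X); apply: eq_replica => x /=.
  by rewrite -fD subrr.
by move/mulmx1_unit => [].
Qed.

Lemma replica_in_group H f : is_subgroup H -> zclosed H -> Lie H X -> exp_hom f ->
  H (replica X f).
Proof.
move=> sH zH LX hf; apply: zclosed_vanish (replica_exp_unit hf) _ => // q.
have [s [Hs ->]] := weight_poly_dec q => Vq.
have H1 : H 1%:M by case: sH.
rewrite mxeval_sum; have E := vanish_weighted f sH LX Hs Vq H1.
rewrite mxeval_sum in E; rewrite -[RHS]E big_seq [RHS]big_seq; apply: eq_bigr => x xs.
by rewrite mxevalZ; case: (Hs x xs) => _ _ /(_ f hf) <-; rewrite mul1mx.
Qed.

Lemma interpolation (zs : seq K) (F : K -> K) :
  exists p : {poly K}, forall z, z \in zs -> p.[z] = F z.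
Proof.
elim: zs => [|z zs [p Hp]]; first by exists 0.
have [zin|zn] := boolP (z \in zs).
  by exists p => w; rewrite inE => /orP[/eqP ->|]; exact: Hp.
pose Q := \prod_(w <- zs) ('X - w%:P).
have Qz : Q.[z] != 0 by rewrite -[_ == 0]/(root Q z) root_prod_XsubC.
exists (p + ((F z - p.[z]) / Q.[z]) *: Q) => w; rewrite inE hornerD hornerZ.
move=> /orP[/eqP ->|win]; first by rewrite divfK // addrC subrK.
have /rootP -> : root Q w by rewrite root_prod_XsubC.
by rewrite mulr0 addr0 Hp.
Qed.

Definition real_exp (f : K -> R) (s : R) : mat :=
  replica X (fun x => (expR (s * f x))%:C).

Lemma real_exp_hom (f : K -> R) s : add_hom f -> exp_hom (fun x => (expR (s * f x))%:C).
Proof.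
move=> [f0 fD]; split; first by rewrite f0 mulr0 expR0.
by move=> x y; rewrite fD mulrDr expRD rmorphM.
Qed.

(** No limit is taken: the group elements at [s = 0, 1, 2, ...] give a linear relation for every
    power of the numbers [z], hence for every polynomial in them, and a polynomial interpolating the
    logarithm turns these exponentials into [f]. *)
Lemma Lie_of_real_exp H (f : K -> R) : add_hom f -> (forall s, H (real_exp f s)) ->
  Lie H (replica X (fun x => (f x)%:C)).
Proof.
move=> hf HE; apply/LieE => q; have [s [Hs ->]] := weight_poly_dec q => Vq.
have H1 : H 1%:M.
  move: (HE 0); rewrite /real_exp (eq_replica X (g := fun=> 1)) ?replica1 // => x.
  by rewrite mul0r expR0.
pose z x := (expR (f x))%:C : K.
have sum0 (p : {poly K}) : \sum_(x <- s) p.[z x.1] * mxeval x.2 1%:M = 0.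
  under eq_bigr do rewrite horner_coef mulr_suml.
  rewrite exchange_big big1 //= => k _.
  under eq_bigr do rewrite -mulrA; rewrite -mulr_sumr.
  have E := Vq _ (HE k%:R); rewrite mxeval_sum in E.
  suff -> : \sum_(x <- s) z x.1 ^+ k * mxeval x.2 1%:M = 0 by rewrite mulr0.
  rewrite -[RHS]E big_seq [RHS]big_seq; apply: eq_bigr => x xs.
  have [_ _ e] := Hs x xs; rewrite -[real_exp _ _]mul1mx e; last exact: real_exp_hom.
  by rewrite /z -rmorphXn -expRM_natl mulr_natl.
have [p Hp] := interpolation [seq z x.1 | x <- s] (fun w => (ln (complex.Re w))%:C).
rewrite Dmx_sum mxeval_sum -[RHS](sum0 p) big_seq [RHS]big_seq.
apply: eq_bigr => x xs; rewrite Hp ?map_f //; last by apply/mapP; exists x.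
have [_ a _] := Hs x xs; rewrite a /z /= ?expRK //.
by split=> [|u v]; rewrite ?hf.1 ?hf.2 // rmorphD.
Qed.

End ReplicasInGroups.

(** * Regular functions and Zariski connectedness *)

Section RegularFunctions.
Variables (R : realType) (n : nat).
Local Notation K := R[i].
Local Notation mat := 'M[K]_n.
Local Notation mxp := (mpoly.mpoly (n * n) K).
Implicit Types (f : mat -> K) (A F H : set mat).

Lemma det_neq0 (g : mat) : g \in unitmx -> \det g != 0.
Proof. by rewrite unitmxE unitfE. Qed.

(** The coordinate ring of GL_n, realized by functions on all matrices; the last constructor
    therefore identifies functions that agree on invertible matrices. *)
Inductive regular : (mat -> K) -> Prop :=
| regular_const c : regular (fun=> c)
| regular_entry i j : regular (fun g => g i j)
| regularD f1 f2 : regular f1 -> regular f2 -> regular (fun g => f1 g + f2 g)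
| regularM f1 f2 : regular f1 -> regular f2 -> regular (fun g => f1 g * f2 g)
| regular_invdet : regular (fun g => (\det g)^-1)
| eq_regular f1 f2 : regular f1 -> (forall g, g \in unitmx -> f1 g = f2 g) ->
    regular f2.

Lemma regular_sum (I : Type) (r : seq I) (P : pred I) (F : I -> mat -> K) :
  (forall i, regular (F i)) -> regular (fun g => \sum_(i <- r | P i) F i g).
Proof.
move=> HF; elim: r => [|i r IH].
  by apply: eq_regular (regular_const 0) _ => g _; rewrite big_nil.
apply: (@eq_regular (fun g => (if P i then F i g else 0) + \sum_(i <- r | P i) F i g)).
  by apply: regularD => //; case: (P i) => //; exact: regular_const.
by move=> g _; rewrite big_cons; case: ifP; rewrite ?add0r.
Qed.

Lemma regular_prod (I : Type) (r : seq I) (P : pred I) (F : I -> mat -> K) :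
  (forall i, regular (F i)) -> regular (fun g => \prod_(i <- r | P i) F i g).
Proof.
move=> HF; elim: r => [|i r IH].
  by apply: eq_regular (regular_const 1) _ => g _; rewrite big_nil.
apply: (@eq_regular (fun g => (if P i then F i g else 1) * \prod_(i <- r | P i) F i g)).
  by apply: regularM => //; case: (P i) => //; exact: regular_const.
by move=> g _; rewrite big_cons; case: ifP; rewrite ?mul1r.
Qed.

Lemma regularZ c f : regular f -> regular (fun g => c * f g).
Proof. by apply: regularM; exact: regular_const. Qed.

Definition regular_mx p q (M : mat -> 'M[K]_(p, q)) :=
  forall i j, regular (fun g => M g i j).

Lemma regular_mxM p q r (M : mat -> 'M[K]_(p, q)) (N : mat -> 'M[K]_(q, r)) :
  regular_mx M -> regular_mx N -> regular_mx (fun g => M g *m N g).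
Proof.
move=> HM HN i j; apply: (@eq_regular (fun g => \sum_k M g i k * N g k j)).
  by apply: regular_sum => k; exact: regularM.
by move=> g _; rewrite mxE.
Qed.

Lemma regular_mx_const p q (A : 'M[K]_(p, q)) : regular_mx (fun=> A).
Proof. by move=> i j; exact: regular_const. Qed.

Lemma regular_mx_id : regular_mx (fun g => g).
Proof. by move=> i j; exact: regular_entry. Qed.

Lemma regular_det m (M : mat -> 'M[K]_m) : regular_mx M -> regular (fun g => \det (M g)).
Proof.
move=> HM; apply: regular_sum => s; apply: regularZ.
by apply: regular_prod => i; exact: HM.
Qed.

Lemma regular_mx_inv : regular_mx (fun g => invmx g).
Proof.
move=> i j; apply: (@eq_regular (fun g => (\det g)^-1 * ((\adj g) i j))).
  apply: regularM; first exact: regular_invdet.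
  apply: (@eq_regular (fun g => (-1) ^+ (j + i) * \det (row' j (col' i g)))).
    by apply/regularZ/regular_det => k l;
       apply: eq_regular (regular_entry (lift j k) (lift i l)) _ => g _; rewrite !mxE.
  by move=> g _; rewrite mxE.
move=> g gU; rewrite /invmx gU; by rewrite [RHS]mxE.
Qed.

Lemma regular_comp f (M : mat -> mat) : regular f -> regular_mx M ->
  regular (fun g => (\det (M g))^-1) -> (forall g, g \in unitmx -> M g \in unitmx) ->
  regular (fun g => f (M g)).
Proof.
move=> Hf HM Hd HU; elim: Hf => {f} [c|i j|f1 f2 _ IH1 _ IH2|f1 f2 _ IH1 _ IH2||].
- exact: regular_const.
- exact: HM.
- exact: regularD.
- exact: regularM.
- exact: Hd.
- by move=> f1 f2 _ IH E; apply: eq_regular IH _ => g /HU; exact: E.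
Qed.

Lemma regular_mxeval (q : mxp) : regular (mxeval q).
Proof.
elim/mxp_ind: q => [c|k|p q Hp Hq|p q Hp Hq].
- by apply: eq_regular (regular_const c) _ => g _; rewrite mxevalC.
- case/mxvec_indexP: k => i j.
  by apply: eq_regular (regular_entry i j) _ => g _; rewrite mxeval_var mxvecE.
- by apply: eq_regular (regularD Hp Hq) _ => g _; rewrite mxevalD.
- by apply: eq_regular (regularM Hp Hq) _ => g _; rewrite mxevalM.
Qed.

Lemma mxeval_det : exists q : mxp, forall g, mxeval q g = \det g.
Proof.
exists (\sum_(s : 'S_n) (-1) ^+ s *: \prod_i mxvar R (mxvec_index i (s i))) => g.
rewrite mxeval_sum; apply: eq_bigr => s _; rewrite mxevalZ; congr (_ * _).
rewrite (big_morph (fun p : mxp => mxeval p g) (fun p q => mxevalM p q g) (mxeval1 g)).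
by apply: eq_bigr => i _; rewrite mxeval_var mxvecE.
Qed.

Lemma regular_poly f : regular f ->
  exists (q : mxp) k, forall g, g \in unitmx -> f g * \det g ^+ k = mxeval q g.
Proof.
have [d Hd] := mxeval_det.
have dX k g : mxeval (d ^+ k) g = \det g ^+ k.
  by elim: k => [|k IH]; rewrite ?expr0 ?mxeval1 // !exprS mxevalM Hd IH.
elim => {f} [c|i j|f1 f2 _ [q1 [k1 E1]] _ [q2 [k2 E2]]|f1 f2 _ [q1 [k1 E1]] _ [q2 [k2 E2]]||].
- by exists (mpoly.mpolyC _ c), 0%N => g _; rewrite mxevalC mulr1.
- by exists (mxvar R (mxvec_index i j)), 0%N => g _; rewrite mxeval_var mxvecE mulr1.
- exists (q1 * d ^+ k2 + q2 * d ^+ k1), (k1 + k2)%N => g gU.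
  rewrite mxevalD !mxevalM !dX -E1 // -E2 // exprD mulrDl.
  by rewrite mulrA [f2 g * _]mulrCA mulrC [X in _ + X]mulrC [X in X + _]mulrC.
- exists (q1 * q2), (k1 + k2)%N => g gU.
  by rewrite mxevalM -E1 // -E2 // exprD mulrACA.
- by exists 1, 1%N => g gU; rewrite mxeval1 expr1 mulVf ?det_neq0.
- by move=> f1 f2 _ [q [k E]] E12; exists q, k => g gU; rewrite -E12 // E.
Qed.

Lemma zclosedP F : zclosed F <-> F `<=` [set g | g \in unitmx] /\
  forall g, g \in unitmx -> (forall q, vanish F q -> mxeval q g = 0) -> F g.
Proof.
split=> [zF|[FU Fv]].
  by split=> [g|g gU]; [case: zF => I -> [] | exact: zclosed_vanish].
exists (vanish F); apply/seteqP; split=> [g Fg|g [gU gv]]; last exact: Fv.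
by split=> [|q]; [exact: FU | exact].
Qed.

Lemma zclosed_regular (I : set (mat -> K)) : (forall f, I f -> regular f) ->
  zclosed [set g | g \in unitmx /\ forall f, I f -> f g = 0].
Proof.
move=> HI; apply/zclosedP; split=> [g []//|g gU gv]; split=> // f If.
have [q [k E]] := regular_poly (HI _ If).
have dn : \det g ^+ k != 0 by rewrite expf_neq0 // det_neq0.
apply: (mulIf dn); rewrite mul0r E //; apply: gv => z [zU zI].
by rewrite -E // zI // mul0r.
Qed.

Lemma zclosed_zero f : regular f -> zclosed [set g | g \in unitmx /\ f g = 0].
Proof.
move=> Hf; have H : forall f', [set f] f' -> regular f' by move=> _ ->.
have := zclosed_regular H; congr zclosed; apply/seteqP; split=> g [gU E]; split=> //.
  exact: E.
by move=> _ ->.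
Qed.

Lemma zclosed_preim (M : mat -> mat) F : regular_mx M ->
  regular (fun g => (\det (M g))^-1) -> (forall g, g \in unitmx -> M g \in unitmx) ->
  zclosed F -> zclosed [set g | g \in unitmx /\ F (M g)].
Proof.
move=> HM Hd HU zF.
pose I := [set f | exists2 q, vanish F q & f = fun g => mxeval q (M g)].
have HI f : I f -> regular f.
  by move=> [q _ ->]; exact: (regular_comp (regular_mxeval q) HM Hd HU).
have := zclosed_regular HI; congr zclosed; apply/seteqP; split=> g [gU E]; split=> //.
  apply: (zclosed_vanish zF (HU _ gU)) => q Hq.
  by apply: (E (fun g => mxeval q (M g))); exists q.
by move=> _ [q Hq ->]; exact: Hq.
Qed.

Lemma regular_mulmx (a b : mat) : a \in unitmx -> b \in unitmx ->
  [/\ regular_mx (fun g => a *m g *m b),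
      regular (fun g => (\det (a *m g *m b))^-1)
    & forall g, g \in unitmx -> a *m g *m b \in unitmx].
Proof.
move=> aU bU; split; last by move=> g gU; rewrite !unitmx_mul aU gU.
- apply: regular_mxM; last exact: regular_mx_const.
  by apply: regular_mxM; [exact: regular_mx_const | exact: regular_mx_id].
- apply: (@eq_regular (fun g => ((\det a)^-1 * (\det b)^-1) * (\det g)^-1)).
    exact/regularZ/regular_invdet.
  by move=> g _; rewrite !det_mulmx !invfM mulrAC.
Qed.

Lemma regular_conj (z w : mat) : z \in unitmx -> w \in unitmx ->
  [/\ regular_mx (fun g => g *m z *m invmx g *m w),
      regular (fun g => (\det (g *m z *m invmx g *m w))^-1)
    & forall g, g \in unitmx -> g *m z *m invmx g *m w \in unitmx].
Proof.
move=> zU wU; split; last by move=> g gU; rewrite !unitmx_mul gU zU unitmx_inv gU.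
- apply: regular_mxM; last exact: regular_mx_const.
  apply: regular_mxM; last exact: regular_mx_inv.
  by apply: regular_mxM; [exact: regular_mx_id | exact: regular_mx_const].
- apply: eq_regular (regular_const (\det z * \det w)^-1) _ => g gU.
  rewrite !det_mulmx det_inv [\det g * _]mulrC -[_ * \det g * _]mulrA.
  by rewrite divff ?mulr1 // det_neq0.
Qed.

(** The fibre of [f] through [g0] and the union of its other fibres over [s] are closed and
    disjoint. *)
Lemma fin_const A f (s : seq K) : zconnected A -> A `<=` [set g | g \in unitmx] ->
  regular f -> (forall g, A g -> f g \in s) -> forall g g', A g -> A g' -> f g = f g'.
Proof.
move=> cA AU Hf fs g0 g1 A0 A1.
pose F1 : set mat := [set g | g \in unitmx /\ f g + - f g0 = 0].
pose F2 : set mat := [set g | g \in unitmx /\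
  \prod_(c <- s | c != f g0) (f g + - c) = 0].
have zF1 : zclosed F1.
  by apply: zclosed_zero; apply: regularD => //; exact: regular_const.
have zF2 : zclosed F2.
  apply: zclosed_zero; apply: regular_prod => c.
  by apply: regularD => //; exact: regular_const.
have cov : A `<=` F1 `|` F2.
  move=> g Ag; have [E|ne] := eqVneq (f g) (f g0).
    by left; split; [exact: AU | rewrite E subrr].
  right; split; first exact: AU.
  apply/eqP; rewrite prodf_seq_eq0; apply/hasP; exists (f g); first exact: fs.
  by rewrite ne subrr eqxx.
have dis : A `&` F1 `&` F2 = set0.
  rewrite -subset0 => g [[Ag [_ /eqP]]]; rewrite subr_eq0 => /eqP E [_ /eqP].
  rewrite prodf_seq_eq0 => /hasP[c _ /andP[ne]].
  by rewrite subr_eq0 E => /eqP Ec; rewrite Ec eqxx in ne.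
have F10 : F1 g0 by split; [exact: AU | rewrite subrr].
have [sub|sub] := cA _ _ zF1 zF2 cov dis.
  by have [_ /eqP] := sub _ A1; rewrite subr_eq0 => /eqP.
have : (A `&` F1 `&` F2) g0 by split => //; exact: sub.
by rewrite dis.
Qed.

Lemma zconnected_image (M : mat -> mat) A : regular_mx M ->
  regular (fun g => (\det (M g))^-1) -> (forall g, g \in unitmx -> M g \in unitmx) ->
  A `<=` [set g | g \in unitmx] -> zconnected A -> zconnected (M @` A).
Proof.
move=> HM Hd HU AU cA F1 F2 z1 z2 cov dis.
have zp := zclosed_preim HM Hd HU.
have [||sub|sub] := cA _ _ (zp _ z1) (zp _ z2).
- move=> g Ag; have gU := AU _ Ag.
  by have [|F|F] := cov (M g); [exists g | left | right].
- rewrite -subset0 => g [[Ag [gU F1g]] [_ F2g]].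
  have : (M @` A `&` F1 `&` F2) (M g) by split=> //; split=> //; exists g.
  by rewrite dis.
- by left=> _ [g Ag <-]; have [] := sub _ Ag.
- by right=> _ [g Ag <-]; have [] := sub _ Ag.
Qed.

Section Separation.
Variables (H F1 F2 : set mat).
Hypotheses (sH : is_subgroup H) (z1 : zclosed F1) (z2 : zclosed F2).
Hypothesis cov : H `<=` F1 `|` F2.
Hypothesis dis : H `&` F1 `&` F2 = set0.

(** Reduces the connectedness of a group to its generators: those lying in connected sets through 1
    preserve both pieces of a separation, and the elements that do so form a group, closed if [H]
    is. *)
Definition separation_stab : set mat := [set g | H g /\ forall x, H x ->
  (F1 x -> F1 (x *m g)) /\ (F2 x -> F2 (x *m g))].

Lemma separation_stab_subgroup : is_subgroup separation_stab.
Proof.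
have [HU H1 HM HV] := sH; split.
- by move=> g [/HU].
- by split=> // x _; rewrite mulmx1.
- move=> g g' [Hg sg] [Hg' sg']; split=> [|x Hx]; first exact: HM.
  have Hxg := HM _ _ Hx Hg.
  by rewrite mulmxA; split=> [/(sg _ Hx).1|/(sg _ Hx).2]; apply sg'.
- move=> g [Hg sg]; split=> [|x Hx]; first exact: HV.
  have Hxg : H (x *m invmx g) by apply: HM => //; exact: HV.
  have xE : x *m invmx g *m g = x by rewrite mulmxKV // HU.
  have no : F1 x -> F2 x -> False.
    by move=> f1 f2; have : (H `&` F1 `&` F2) x by []; rewrite dis.
  have := sg _ Hxg; rewrite xE => -[s1 s2].
  by split=> Fx; have [f|f] := cov Hxg => //; case: no; auto.
Qed.

Lemma separation_stab_zclosed : zclosed H -> zclosed separation_stab.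
Proof.
have [HU H1 HM HV] := sH; move=> zH; apply/zclosedP; split=> [g [/HU] //|g gU gv].
split; first by apply: zclosed_vanish => // q Hq; apply: gv => z [Hz _]; exact: Hq.
have tr (F : set mat) x : zclosed F -> H x -> (forall z, separation_stab z -> F (x *m z)) ->
    F (x *m g).
  move=> zF Hx sF.
  have [] := regular_mulmx (HU _ Hx) (unitmx1 K n).
  set M := fun _ => _ => r1 r2 r3.
  have zp := zclosed_preim r1 r2 r3 zF.
  have : [set g | g \in unitmx /\ F (M g)] g.
    apply: (zclosed_vanish zp) => // q Hq; apply: gv => z sz; apply: Hq; split.
      by case: sz => /HU.
    by rewrite /M mulmx1; exact: sF.
  by rewrite /= /M mulmx1 => -[].
move=> x Hx; split=> Fx; apply: tr => // z [Hz sz].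
  exact: (sz x Hx).1.
exact: (sz x Hx).2.
Qed.

(* A translate x A is connected and contains x, so it stays in the piece of x. *)
Lemma zconnected_separation_stab A : zconnected A -> A `<=` H -> A 1%:M ->
  A `<=` separation_stab.
Proof.
have [HU H1 HM HV] := sH => cA AH A1 g Ag; split; first exact: AH.
move=> x Hx.
have [] := regular_mulmx (HU _ Hx) (unitmx1 K n).
set M := fun _ => _ => r1 r2 r3.
have AU : A `<=` [set g | g \in unitmx] by move=> z /AH /HU.
have cM := zconnected_image r1 r2 r3 AU cA.
have MH : M @` A `<=` H by move=> _ [z Az <-]; rewrite /M mulmx1; apply: HM => //; exact: AH.
have [||sub|sub] := cM _ _ z1 z2.
- by move=> z /MH; exact: cov.
- by rewrite -subset0 -dis => z [[/MH Hz f1] f2].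
- have Mx : F1 (x *m g) by rewrite -[_ *m g]mulmx1; apply: sub; exists g.
  split=> // f2; have : (H `&` F1 `&` F2) x; last by rewrite dis.
  by split=> //; split=> //; apply: sub; exists 1%:M; rewrite // /M !mulmx1.
- have Mx : F2 (x *m g) by rewrite -[_ *m g]mulmx1; apply: sub; exists g.
  split=> // f1; have : (H `&` F1 `&` F2) x; last by rewrite dis.
  by split=> //; apply: sub; exists 1%:M; rewrite // /M !mulmx1.
Qed.

Lemma separation_stab_all : H `<=` separation_stab -> H `<=` F1 \/ H `<=` F2.
Proof.
have [HU H1 HM HV] := sH => all.
by have [f|f] := cov H1; [left|right] => g /all [Hg /(_ _ H1)];
  rewrite mul1mx => -[s1 s2]; auto.
Qed.

End Separation.

Lemma smallest_sub (T : Type) (Q : set T -> Prop) (S M : set T) :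
  Q M -> S `<=` M -> smallest Q S `<=` M.
Proof. by move=> QM SM x; apply. Qed.

Lemma derived_subgroup H : is_subgroup H -> is_subgroup (derived_group H).
Proof.
move=> sH; have [HU H1 HM HV] := sH.
have sub : derived_group H `<=` H.
  apply: smallest_sub => // _ [x [y [Hx Hy ->]]].
  by apply/HM/HV => //; apply/HM/HV => //; exact: HM.
split=> [g /sub /HU //|M [[] //]|g g' Hg Hg' M QM|g Hg M QM].
  by case: (QM) => -[_ _ MM _] _; apply: MM; [exact: Hg | exact: Hg'].
by case: (QM) => -[_ _ _ MV] _; apply: MV; exact: Hg.
Qed.

Lemma derived_sub H : is_subgroup H -> derived_group H `<=` H.
Proof.
move=> sH; have [HU H1 HM HV] := sH; apply: smallest_sub => // _ [x [y [Hx Hy ->]]].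
by apply/HM/HV => //; apply/HM/HV => //; exact: HM.
Qed.

Lemma mem_commutator H x y : H x -> H y ->
  derived_group H (x *m y *m invmx x *m invmx y).
Proof. by move=> Hx Hy M [_]; apply; exists x, y. Qed.

(** For fixed [y] the commutators form the image of [H] under a regular map, and this image contains
    1. The derived group is not claimed to be closed; [zconnected] makes sense for any set. *)
Lemma derived_zconnected H : is_subgroup H -> zconnected H ->
  zconnected (derived_group H).
Proof.
move=> sH cH F1 F2 z1 z2 cov dis; have [HU H1 HM HV] := sH.
have sD := derived_subgroup sH.
apply: (separation_stab_all sD cov); apply: smallest_sub.
  exact: (separation_stab_subgroup sD cov dis).
move=> _ [x [y [Hx Hy ->]]].
have [] := regular_conj (HU _ Hy) (HU _ (HV _ Hy)).
set M := fun _ => _ => r1 r2 r3.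
have cM := zconnected_image r1 r2 r3 HU cH.
apply: (zconnected_separation_stab sD z1 z2 cov dis cM).
- by move=> _ [z Hz <-]; exact: mem_commutator.
- by exists 1%:M; rewrite // /M mul1mx invmx1 mulmx1 mulmxV // HU.
- by exists x.
Qed.

End RegularFunctions.

(** * Linear algebra modulo a stable subspace, without quotients *)

Section SubspacesModuloStable.
Variables (K : fieldType) (m : nat).
Implicit Types (P : 'rV[K]_m -> Prop) (W Z : 'M[K]_m) (v : 'rV[K]_m).

(** Among the matrices with row space inside [P], one of maximal rank exhausts [P]. *)
Lemma subspace_mx P : P 0 -> (forall c x y, P x -> P y -> P (c *: x + y)) ->
  exists A : 'M[K]_m, forall v, (v <= A)%MS <-> P v.
Proof.
move=> P0 PP.
pose good r := `[< exists A : 'M[K]_m, \rank A = r /\ forall v, (v <= A)%MS -> P v >].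
have good0 : exists r, good r.
  exists 0%N; apply/asboolP; exists 0; split; first exact: mxrank0.
  by move=> v; rewrite submx0 => /eqP ->.
have goodm r : good r -> (r <= m)%N.
  by move=> /asboolP[A [<- _]]; exact: rank_leq_row.
case: (ex_maxnP good0 goodm) => r /asboolP[A [rA PA]] maxr.
exists A => v; split=> [|Pv]; first exact: PA.
have sub w : (w <= A + v)%MS -> P w.
  move=> /sub_addsmxP[[a b] ->] /=.
  have -> : b *m v = b 0 0 *: v by rewrite [b]mx11_scalar mul_scalar_mx !mxE.
  by rewrite addrC; apply: PP => //; apply: PA; exact: submxMl.
have /maxr : good (\rank (A + v)%MS) by apply/asboolP; exists (A + v)%MS.
rewrite -rA => le; have [_ /esym] := mxrank_leqif_sup (addsmxSl A v).
rewrite eqn_leq le mxrankS ?addsmxSl //= => h.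
by apply: submx_trans (addsmxSr A v) _; rewrite h.
Qed.

Lemma sub_mulmx_row W Z : (forall v, (v <= W)%MS -> (v *m Z <= W)%MS) ->
  (W *m Z <= W)%MS.
Proof.
by move=> H; apply/row_subP => i; rewrite row_mul; apply/H/row_sub.
Qed.

Lemma sub_rows W W' : (forall v, (v <= W)%MS -> (v <= W')%MS) -> (W <= W')%MS.
Proof. by move=> H; apply/row_subP => i; apply/H/row_sub. Qed.

Lemma nsub_row W W' : ~~ (W' <= W)%MS -> exists v, (v <= W')%MS /\ ~~ (v <= W)%MS.
Proof.
move=> /row_subPn[i ni]; exists (row i W'); split=> //; exact: row_sub.
Qed.

Lemma stable_sub W Z v : (W *m Z <= W)%MS -> (v <= W)%MS -> (v *m Z <= W)%MS.
Proof. by move=> WZ vW; apply: submx_trans WZ; exact: submxMr. Qed.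

Lemma submxB W p (x y : 'M[K]_(p, m)) :
  (x <= W)%MS -> (y <= W)%MS -> (x - y <= W)%MS.
Proof. by move=> xW yW; rewrite addmx_sub // eqmx_opp. Qed.

(** If [Z - c] were injective it would map [W] onto itself, and [v] would lie in [W] along with its
    image. *)
Lemma eigenvalue_mod W Z v c : (W *m Z <= W)%MS -> ~~ (v <= W)%MS ->
  (v *m Z - c *: v <= W)%MS -> root (char_poly Z) c.
Proof.
move=> WZ vW E; rewrite -eigenvalue_root_char /eigenvalue /eigenspace kermx_eq0.
apply: contra vW => free.
have WZc : (W *m (Z - c%:M) <= W)%MS.
  by rewrite mulmxBr mul_mx_scalar submxB // scalemx_sub.
have WW : (W <= W *m (Z - c%:M))%MS.
  by rewrite -(geq_leqif (mxrank_leqif_sup WZc)) mxrankMfree.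
have : (v *m (Z - c%:M) <= W *m (Z - c%:M))%MS.
  by apply: submx_trans WW; rewrite mulmxBr mul_mx_scalar.
by move=> /submxP[D]; rewrite mulmxA => /(row_free_inj free) ->; exact: submxMl.
Qed.

Lemma functional_mod W v : ~~ (v <= W)%MS ->
  exists d : 'cV[K]_m, W *m d = 0 /\ v *m d = 1%:M.
Proof.
rewrite submxE => /eqP nz; have [j nj] : exists j, (v *m cokermx W) 0 j != 0.
  apply/existsP; apply: contra_notT nz => /existsPn nz.
  by apply/rowP => j; rewrite [RHS]mxE; apply/eqP; have := nz j; rewrite negbK.
have vc : v *m col j (cokermx W) = ((v *m cokermx W) 0 j)%:M.
  apply/matrixP => a b; rewrite !ord1 [RHS]mxE eqxx mulr1n !mxE.
  by apply: eq_bigr => k _; rewrite mxE.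
exists (((v *m cokermx W) 0 j)^-1 *: col j (cokermx W)); split.
  by rewrite -scalemxAr colE (mulmxA W (cokermx W)) mulmx_coker mul0mx scaler0.
by rewrite -scalemxAr vc -mul_scalar_mx -scalar_mxM mulVf.
Qed.

End SubspacesModuloStable.

(** Apply the linear factors of the characteristic polynomial one at a time to a vector outside [W];
    the last image outside [W] is an eigenvector modulo [W]. *)
Lemma eigenvector_mod (K : closedFieldType) m (W W1 Z : 'M[K]_m) :
  (W *m Z <= W)%MS -> (W1 *m Z <= W1)%MS -> ~~ (W1 <= W)%MS ->
  exists (v : 'rV[K]_m) (c : K), [/\ (v <= W1)%MS, ~~ (v <= W)%MS & (v *m Z - c *: v <= W)%MS].
Proof.
case: m W W1 Z => [|m] W W1 Z WZ W1Z nW.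
  by case/negP: nW; rewrite [W1]flatmx0 sub0mx.
have [rs Ers] := closed_field_poly_normal (char_poly Z).
have := char_poly_monic Z; rewrite monicE => /eqP lc.
rewrite lc scale1r in Ers.
have [v [vW1 vW]] := nsub_row nW.
have : (v *m horner_mx Z (\prod_(z <- rs) ('X - z%:P)) <= W)%MS.
  by rewrite -Ers Cayley_Hamilton mulmx0 sub0mx.
elim: rs {Ers lc nW} v vW1 vW => [|r rs IH] v vW1 vW.
  by rewrite big_nil rmorph1 mulmx1 (negbTE vW).
rewrite big_cons rmorphM rmorphB /= horner_mx_X horner_mx_C.
rewrite -[(Z - r%:M) * _]/((Z - r%:M) *m _) mulmxA => E.
have [sub|nsub] := boolP (v *m Z - r *: v <= W)%MS; first by exists v, r.
apply: (IH (v *m (Z - r%:M))) => //; rewrite mulmxBr mul_mx_scalar //.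
by rewrite submxB ?scalemx_sub // stable_sub.
Qed.

(** * The Lie-Kolchin theorem *)

Section LieKolchin.
Variables (R : realType) (n : nat).
Local Notation K := R[i].
Local Notation mat := 'M[K]_n.
Implicit Types (H : set mat).

Section Representation.
Variables (m : nat) (rho : mat -> 'M[K]_m).

Definition representation H :=
  rho 1%:M = 1%:M /\ forall x y, H x -> H y -> rho (x *m y) = rho x *m rho y.

Definition stable_under H (W : 'M[K]_m) := forall g, H g -> (W *m rho g <= W)%MS.

(** Relative to [W], so that it serves for quotients. Induction on the derived length and, inside,
    on the rank of [W1]. Closedness of [H] is not assumed, because the induction passes to derived
    groups. That the character of the derived group is trivial on commutators follows from the
    finiteness of spectra and [fin_const] rather than from determinants. *)
Lemma lie_kolchin k H (W W1 : 'M[K]_m) : is_subgroup H -> zconnected H ->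
  iter k (@derived_group R n) H = [set 1%:M] -> representation H -> regular_mx rho ->
  stable_under H W -> stable_under H W1 -> (W <= W1)%MS -> ~~ (W1 <= W)%MS ->
  exists v : 'rV[K]_m, [/\ (v <= W1)%MS, ~~ (v <= W)%MS &
    forall g, H g -> exists c, (v *m rho g - c *: v <= W)%MS].
Proof.
elim: k H W1 => [|k IHk] H W1 sH cH der rep reg sW.
  move=> sW1 WW1 /nsub_row[v [vW1 vW]]; exists v; split=> // g.
  by move: der => /= -> ->; exists 1; rewrite rep.1 mulmx1 scale1r subrr sub0mx.
have [HU H1 HM HV] := sH; have [rep1 repM] := rep.
have [r] := ubnP (\rank W1); elim: r W1 => // r IHr W1 rkW1 sW1 WW1 nW1.
have [[W2 [sW2 WW2 W21 nW2 nW12]]|nomin] := pselect (exists W2 : 'M[K]_m,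
    [/\ stable_under H W2, (W <= W2)%MS, (W2 <= W1)%MS, ~~ (W2 <= W)%MS
      & ~~ (W1 <= W2)%MS]).
  have [|v [vW2 vW vE]] := IHr W2 _ sW2 WW2 nW2.
    rewrite -ltnS; apply: leq_trans rkW1; rewrite ltnS ltn_neqAle mxrankS // andbT.
    by have [_ ->] := mxrank_leqif_sup W21.
  by exists v; split=> //; exact: submx_trans vW2 W21.
(* W1 is now irreducible modulo W. *)
have minW1 (P : 'rV[K]_m -> Prop) : P 0 -> (forall c x y, P x -> P y -> P (c *: x + y)) ->
    (forall v, (v <= W)%MS -> P v) -> (forall v, P v -> (v <= W1)%MS) ->
    (forall v g, P v -> H g -> P (v *m rho g)) ->
    (exists2 v, P v & ~~ (v <= W)%MS) -> forall v, (v <= W1)%MS -> P v.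
  move=> P0 PP PW PW1 PH [v Pv nv] w wW1.
  have [A HA] := subspace_mx P0 PP; apply/HA.
  apply: contra_notT nomin => nwA; exists A; split.
  - by move=> g Hg; apply: sub_mulmx_row => u /HA Pu; apply/HA/PH.
  - by apply: sub_rows => u uW; apply/HA/PW.
  - by apply: sub_rows => u /HA; exact: PW1.
  - by apply: contra nv => AW; apply: submx_trans AW; apply/HA.
  - by apply: contra nwA => W1A; apply: submx_trans W1A.
have sD := derived_subgroup sH; have DH := derived_sub sH.
have [||v0 [v0W1 v0W v0E]] := IHk (derived_group H) W1 sD (derived_zconnected sH cH)
  _ _ reg (fun g Dg => sW g (DH _ Dg)) (fun g Dg => sW1 g (DH _ Dg)) WW1 nW1.
- by rewrite -iterSr.
- by split=> // x y Dx Dy; apply: repM; exact: DH.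
have [d [Wd v0d]] := functional_mod v0W.
pose chi z := (v0 *m rho z *m d) 0 0.
have Wd0 (w : 'rV[K]_m) : (w <= W)%MS -> w *m d = 0.
  by move=> /submxP[D ->]; rewrite -mulmxA Wd mulmx0.
have chiE z c : (v0 *m rho z - c *: v0 <= W)%MS -> c = chi z.
  move=> /Wd0; rewrite mulmxBl -scalemxAl v0d => /eqP; rewrite subr_eq0 => /eqP E.
  by rewrite /chi E !mxE mulr1.
have v0chi z : derived_group H z -> (v0 *m rho z - chi z *: v0 <= W)%MS.
  by move=> /v0E[c Ec]; rewrite -(chiE _ _ Ec).
have chi_reg : regular chi.
  exact: (regular_mxM (regular_mxM (regular_mx_const _ v0) reg) (regular_mx_const _ d) 0 0).
have chi1 : chi 1%:M = 1.
  by apply/esym/chiE; rewrite rep1 mulmx1 scale1r subrr sub0mx.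
have nWrho (v : 'rV[K]_m) h : H h -> ~~ (v <= W)%MS -> ~~ (v *m rho h <= W)%MS.
  move=> Hh; apply: contra => vh; have := stable_sub (sW _ (HV _ Hh)) vh.
  by rewrite -mulmxA -repM ?mulmxV ?HU ?rep1 ?mulmx1 //; exact: HV.
(* The eigenvalues modulo [W] lie in a finite list depending only on [z], as [fin_const]
   requires. *)
have spec z : exists s : seq K, forall (v : 'rV[K]_m) c, (W *m rho z <= W)%MS ->
    ~~ (v <= W)%MS -> (v *m rho z - c *: v <= W)%MS -> c \in s.
  have [rs Ers] := closed_field_poly_normal (char_poly (rho z)).
  exists rs => v c Wz vW vz; have := eigenvalue_mod Wz vW vz.
  rewrite Ers rootZ ?root_prod_XsubC // lead_coef_eq0.
  exact/monic_neq0/char_poly_monic.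
have chi_conj_reg z w : H z -> H w -> regular (fun h => chi (h *m z *m invmx h *m w)).
  by move=> Hz Hw; have [r1 r2 r3] := regular_conj (HU _ Hz) (HU _ Hw); exact: regular_comp.
have D_conj h z : H h -> derived_group H z -> derived_group H (h *m z *m invmx h).
  move=> Hh Dz; have Hz := DH _ Dz.
  have := mem_commutator Hh Hz; case: (sD) => _ _ DM _ => /DM /(_ Dz).
  by rewrite mulmxKV // HU.
(* chi (h z h^-1) is an eigenvalue of rho z, so as a regular function of h on
   the connected group H it is constant. *)
have chi_conj z h : derived_group H z -> H h -> chi (h *m z *m invmx h) = chi z.
  move=> Dz Hh; have Hz := DH _ Dz; have [s Hs] := spec z.
  have f_reg := chi_conj_reg z 1%:M Hz H1.
  have fin g : H g -> chi (g *m z *m invmx g *m 1%:M) \in s.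
    move=> Hg; rewrite mulmx1; apply: (Hs (v0 *m rho g)); [exact: sW | exact: nWrho|].
    have Dg := D_conj _ _ Hg Dz; have Hgz := DH _ Dg.
    have E : g *m z = g *m z *m invmx g *m g by rewrite mulmxKV ?HU.
    set z' := g *m z *m invmx g in E Dg Hgz *; rewrite -mulmxA -repM // E.
    rewrite repM // mulmxA scalemxAl -mulmxBl; apply: stable_sub (sW _ Hg) _.
    exact: v0chi.
  have := fin_const cH HU f_reg fin Hh H1.
  by rewrite !mulmx1 invmx1 mul1mx mulmx1.
have W1chi (v : 'rV[K]_m) z : (v <= W1)%MS -> derived_group H z -> (v *m rho z - chi z *: v <= W)%MS.
  move=> vW1; move: z; suff [] : (v <= W1)%MS /\ forall z, derived_group H z ->
      (v *m rho z - chi z *: v <= W)%MS by [].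
  move: v vW1; apply: minW1.
  - by split=> [|z _]; rewrite ?mul0mx ?scaler0 ?subrr sub0mx.
  - move=> c x y [xW1 xE] [yW1 yE]; split=> [|z Dz].
      by rewrite addmx_sub // scalemx_sub.
    rewrite mulmxDl -scalemxAl scalerDr opprD addrACA scalerA mulrC -scalerA.
    by rewrite -scalerBr addmx_sub ?scalemx_sub ?xE ?yE.
  - move=> v vW; split=> [|z Dz]; first exact: submx_trans vW WW1.
    by rewrite submxB ?scalemx_sub // stable_sub //; apply/sW/DH.
  - by move=> v [].
  - move=> v h [vW1 vE] Hh; split=> [|z Dz]; first by rewrite stable_sub // sW1.
    have Hz := DH _ Dz; have Dc := D_conj _ _ Hh Dz; have Hc := DH _ Dc.
    have E : h *m z = h *m z *m invmx h *m h by rewrite mulmxKV ?HU.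
    rewrite -(chi_conj z h) //.
    set z' := h *m z *m invmx h in E Dc Hc *; rewrite -mulmxA -repM // E.
    rewrite repM // mulmxA scalemxAl -mulmxBl; apply: stable_sub (sW _ Hh) _.
    exact: vE.
  - by exists v0.
(* If c is an eigenvalue of rho x, so is c chi (y x y^-1 x^-1). *)
have chi_comm x y : H x -> H y -> chi (y *m x *m invmx y *m invmx x) = 1.
  move=> Hx Hy; have [s Hs] := spec x.
  have [v [c [vW1 vW vc]]] := eigenvector_mod (sW _ Hx) (sW1 _ Hx) nW1.
  have cn0 : c != 0.
    apply: contraNneq vW => c0; rewrite c0 scale0r subr0 in vc.
    by apply: contraT => nv; have := nWrho _ _ Hx nv; rewrite vc.
  have f_reg := chi_conj_reg x (invmx x) Hx (HV _ Hx).
  have fin g : H g -> c * chi (g *m x *m invmx g *m invmx x) \in s.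
    move=> Hg; apply: (Hs (v *m rho g)); [exact: sW | exact: nWrho|].
    set z := _ *m invmx x; have Dz : derived_group H z by exact: mem_commutator.
    have Hz := DH _ Dz.
    have -> : v *m rho g *m rho x = v *m rho z *m rho x *m rho g.
      rewrite -!mulmxA -!repM //; last exact: HM.
      by congr (_ *m rho _); rewrite /z !mulmxA !mulmxKV ?HU.
    have vz := W1chi _ _ vW1 Dz.
    have -> : v *m rho z *m rho x *m rho g - (c * chi z) *: (v *m rho g) =
        ((v *m rho z - chi z *: v) *m rho x + chi z *: (v *m rho x - c *: v)) *m rho g.
      rewrite mulmxDl mulmxBl mulmxBl -!scalemxAl mulmxBl scalerBr -!scalemxAl.
      by rewrite addrA subrK scalerA mulrC.
    apply: (stable_sub (sW _ Hg)); apply: addmx_sub; last exact: scalemx_sub.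
    exact: stable_sub (sW _ Hx) vz.
  have := fin_const cH HU (regularZ c f_reg) fin Hy H1.
  by rewrite mul1mx invmx1 mulmx1 mulmxV ?HU // chi1 => /(mulfI cn0).
(* Since [chi] is 1 on commutators, [H] acts commutatively on [W1] modulo [W]. An eigenspace of one
   [rho x] is then stable under [H], hence everything by irreducibility. *)
have comm (v : 'rV[K]_m) x y : (v <= W1)%MS -> H x -> H y ->
    (v *m rho y *m rho x - v *m rho x *m rho y <= W)%MS.
  move=> vW1 Hx Hy; set z := y *m x *m invmx y *m invmx x.
  have Dz : derived_group H z by exact: mem_commutator.
  have Hz := DH _ Dz; have := W1chi _ _ vW1 Dz; rewrite chi_comm // scale1r => vz.
  have -> : v *m rho y *m rho x = v *m rho z *m rho x *m rho y.
    rewrite -!mulmxA -!repM //; last exact: HM.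
    by congr (_ *m rho _); rewrite /z !mulmxA !mulmxKV ?HU.
  by rewrite -!mulmxBl; apply: stable_sub (sW _ Hy) _; apply: stable_sub (sW _ Hx) _.
exists v0; split=> // x Hx.
have [v [c [vW1 vW vc]]] := eigenvector_mod (sW _ Hx) (sW1 _ Hx) nW1.
exists c; suff [] : (v0 <= W1)%MS /\ (v0 *m rho x - c *: v0 <= W)%MS by [].
move: v0 v0W1 {v0W v0E v0d chi chiE v0chi chi_reg chi1 chi_conj_reg chi_conj W1chi chi_comm}.
apply: minW1.
- by rewrite mul0mx scaler0 subrr !sub0mx.
- move=> a u w [uW1 uE] [wW1 wE]; split; first by rewrite addmx_sub // scalemx_sub.
  rewrite mulmxDl -scalemxAl scalerDr opprD addrACA scalerA mulrC -scalerA.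
  by rewrite -scalerBr addmx_sub ?scalemx_sub.
- move=> u uW; split; first exact: submx_trans uW WW1.
  by rewrite submxB ?scalemx_sub // stable_sub // sW.
- by move=> u [].
- move=> u g [uW1 uE] Hg; split; first by rewrite stable_sub // sW1.
  have -> : u *m rho g *m rho x - c *: (u *m rho g) =
     (u *m rho g *m rho x - u *m rho x *m rho g) + (u *m rho x - c *: u) *m rho g.
    by rewrite mulmxBl -scalemxAl addrA subrK.
  by rewrite addmx_sub ?comm // stable_sub // sW.
- by exists v.
Qed.

End Representation.

End LieKolchin.

(** In expanded form, [[x - c, y - d] = [x, y]] for scalars [c] and [d]. *)
Fact subr_cross (K : comPzRingType) p q (a a' b c d : 'M[K]_(p, q)) :
  a - b - (c - d) - (a' - c - (b - d)) = a - a'.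
Proof. by apply/matrixP => i j; rewrite !mxE; ring. Qed.

(** * Flags and solvability *)

Section FlagSolvable.
Variables (R : realType) (n : nat).
Local Notation K := R[i].
Local Notation mat := 'M[K]_n.
Implicit Types (S H : set mat) (F : nat -> mat) (W : mat).

Definition stabilizes (W g : mat) := (W *m g <= W)%MS.

Lemma stabilizesV W g : g \in unitmx -> stabilizes W g -> stabilizes W (invmx g).
Proof.
move=> gU Wg; rewrite /stabilizes.
have WW : (W <= W *m g)%MS.
  by rewrite -(geq_leqif (mxrank_leqif_sup Wg)) mxrankMfree // row_free_unit.
by have := submxMr (invmx g) WW; rewrite mulmxK.
Qed.

Lemma flag_solvable H F N : is_subgroup H -> F 0%N = 0 -> (1%:M <= F N)%MS ->
  (forall i, (F i <= F i.+1)%MS) ->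
  (forall g i, H g -> stabilizes (F i) g) ->
  (forall g i, H g -> exists c, (F i.+1 *m (g - c%:M) <= F i)%MS) ->
  solvable_group H.
Proof.
move=> sH F0 FN Fle Fst Fsc; have [HU H1 HM HV] := sH.
pose M k : set mat := [set g | H g /\ forall i, (F (i + k)%N *m (g - 1%:M) <= F i)%MS].
have monF i j : (i <= j)%N -> (F i <= F j)%MS.
  by move=> /subnK <-; elim: (j - i)%N => //= k IH; apply: submx_trans IH (Fle _).
have st W g i : H g -> (W <= F i)%MS -> (W *m g <= F i)%MS.
  by move=> Hg WF; apply: submx_trans (submxMr g WF) (Fst _ _ Hg).
have comE x y : H x -> H y -> x *m y *m invmx x *m invmx y - 1%:M =
    (x *m y - y *m x) *m invmx x *m invmx y.
  move=> Hx Hy; rewrite !mulmxBl; congr (_ - _).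
  by rewrite mulmxK ?HU // mulmxV ?HU.
have Hcom x y : H x -> H y -> H (x *m y *m invmx x *m invmx y).
  by move=> Hx Hy; apply/HM/HV => //; apply/HM/HV => //; exact: HM.
have sM k : is_subgroup (M k).
  split=> [g [/HU //]||g g' [Hg Mg] [Hg' Mg']|g [Hg Mg]].
  - by split=> // i; rewrite subrr mulmx0 sub0mx.
  - split=> [|i]; first exact: HM.
    have -> : g *m g' - 1%:M = (g - 1%:M) *m g' + (g' - 1%:M).
      by rewrite mulmxBl mul1mx addrA subrK.
    by rewrite mulmxDr mulmxA addmx_sub // st.
  - split=> [|i]; first exact: HV.
    have -> : invmx g - 1%:M = - ((g - 1%:M) *m invmx g).
      by rewrite mulmxBl mulmxV ?HU // mul1mx opprB.
    by rewrite mulmxN eqmx_opp mulmxA; apply: st => //; exact: HV.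
have step k : iter k.+1 (@derived_group R n) H `<=` M k.+1.
  elim: k => [|k IH].
    apply: smallest_sub => // _ [x [y [Hx Hy ->]]]; split=> [|i]; first exact: Hcom.
    rewrite comE // !mulmxA addn1; apply/st/st; try exact: HV.
    have [c xc] := Fsc x i Hx; have [d yd] := Fsc y i Hy.
    have -> : x *m y - y *m x =
        (x - c%:M) *m (y - d%:M) - (y - d%:M) *m (x - c%:M).
      rewrite !mulmxBl !mulmxBr -!scalar_mxM (mulrC d) -(scalar_mxC c y).
      by rewrite -(scalar_mxC d x) subr_cross.
    have aux z z' a a' : H z' -> (F i.+1 *m (z - a%:M) <= F i)%MS ->
        (F i.+1 *m ((z - a%:M) *m (z' - a'%:M)) <= F i)%MS.
      move=> Hz' le; rewrite mulmxA [_ *m (z' - _)]mulmxBr mul_mx_scalar.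
      by rewrite submxB ?scalemx_sub //; exact: st.
    by rewrite mulmxBr submxB // aux.
  move=> z /= Dz; move: z Dz; apply: smallest_sub => // _ [x [y [Dx Dy ->]]].
  have [Hx Mx] := IH _ Dx; have [Hy My] := IH _ Dy; split=> [|i]; first exact: Hcom.
  rewrite comE // !mulmxA; apply/st/st; try exact: HV.
  have -> : x *m y - y *m x =
      (x - 1%:M) *m (y - 1%:M) - (y - 1%:M) *m (x - 1%:M).
    by rewrite !mulmxBl !mulmxBr !mul1mx !mulmx1 subr_cross.
  have aux g g' : M k.+1 g -> M k.+1 g' ->
      (F (i + k.+2)%N *m ((g - 1%:M) *m (g' - 1%:M)) <= F i)%MS.
    move=> [Hg Mg] [Hg' Mg']; rewrite mulmxA.
    have := Mg i.+1; rewrite addSnnS => le.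
    apply: submx_trans (submxMr _ le) _.
    apply: submx_trans (submxMr _ (monF _ (i + k.+1)%N _)) (Mg' i).
    by rewrite addnS ltnS leq_addr.
  by rewrite mulmxBr submxB // aux.
exists N.+1; apply/seteqP; split=> [g /step[_ /(_ 0%N)]|_ ->].
  rewrite F0 add0n => le.
  have := submx_trans (submxMr _ (submx_trans FN (Fle N))) le.
  by rewrite mul1mx submx0 subr_eq0 => /eqP.
have [_ D1 _ _] : is_subgroup (iter N.+1 (@derived_group R n) H).
  by elim: (N.+1) => //= k sk; exact: derived_subgroup.
exact: D1.
Qed.

(** The rank grows at every step until the space is full and it stays full afterwards, so [n] steps
    suffice. *)
Lemma flag_exists (st : mat -> Prop) : st 0 ->
  (forall W, st W -> ~~ (1%:M <= W)%MS ->
     exists v : 'rV[K]_n, ~~ (v <= W)%MS /\ exists2 W', st W' & (W' :=: W + v)%MS) ->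
  exists F, [/\ F 0%N = 0, (1%:M <= F n)%MS, forall i, (F i <= F i.+1)%MS,
    forall i, st (F i) & forall i, exists v : 'rV[K]_n, (F i.+1 <= F i + v)%MS].
Proof.
move=> st0 ext.
have next (W : {W | st W}) : exists W' : {W | st W},
    [/\ (sval W <= sval W')%MS, (1%:M <= sval W)%MS \/ (\rank (sval W) < \rank (sval W'))%N
      & exists v : 'rV[K]_n, (sval W' <= sval W + v)%MS].
  case: W => W sW /=; have [le|nle] := boolP (1%:M <= W)%MS.
    exists (exist _ W sW); split=> //=; first by left.
    by exists 0; exact: addsmxSl.
  have [v [nv [W' sW' E]]] := ext _ sW nle.
  exists (exist _ W' sW'); split=> /=; [by rewrite E addsmxSl | right | by exists v; rewrite E].
  have lt : (W <= W')%MS by rewrite E addsmxSl.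
  rewrite ltn_neqAle mxrankS // andbT; have [_ ->] := mxrank_leqif_sup lt.
  by apply: contra nv; apply: submx_trans; rewrite E addsmxSr.
have [f Hf] := choice next.
pose F i := sval (iter i f (exist _ 0 st0)).
exists F; split=> //.
- suff rk i : (1%:M <= F i)%MS \/ (i <= \rank (F i))%N.
    by have [//|le] := rk n; rewrite sub1mx /row_full eqn_leq rank_leq_row le.
  elim: i => [|i [le|le]]; first by right.
    by left; apply: submx_trans le _; case: (Hf (iter i f (exist _ 0 st0))).
  case: (Hf (iter i f (exist _ 0 st0))) => lei [lt|lt] _.
    by left; apply: submx_trans lt lei.
  by right; apply: leq_ltn_trans le lt.
- by move=> i; case: (Hf (iter i f (exist _ 0 st0))).
- by move=> i; rewrite /F; case: (iter _ _ _).
- by move=> i; case: (Hf (iter i f (exist _ 0 st0))).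
Qed.

End FlagSolvable.

(** * Algebraic groups generated by connected sets *)

Section GeneratedAlgebraicGroup.
Variables (R : realType) (n : nat).
Local Notation K := R[i].
Local Notation mat := 'M[K]_n.
Implicit Types (S H A : set mat).

Definition alg_gen S : set mat := smallest (@algebraic_group R n) S.

Lemma unitmx_algebraic : algebraic_group [set g : mat | g \in unitmx].
Proof.
split; last by apply/zclosedP; split.
split=> [//|/=|g1 g2 /= ? ?|g1 /= ?]; first exact: unitmx1.
  by rewrite unitmx_mul; apply/andP.
by rewrite unitmx_inv.
Qed.

Lemma alg_gen_sub S : S `<=` alg_gen S.
Proof. by move=> g Sg H [_]; apply. Qed.

Lemma alg_gen_algebraic S : S `<=` [set g | g \in unitmx] -> algebraic_group (alg_gen S).
Proof.
move=> SU; have AU : alg_gen S `<=` [set g | g \in unitmx].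
  by apply: smallest_sub => //; exact: unitmx_algebraic.
split; last first.
  apply/zclosedP; split=> // g gU gv H [[sH zH] SH].
  apply: (zclosed_vanish zH gU) => q Hq; apply: gv => z Az; apply: Hq.
  by apply: Az; split.
split=> [//|H [[[]//]]|g g' Ag Ag' H HH|g Ag H HH].
- by case: (HH) => -[[_ _ HM _] _] _; apply: HM; [exact: Ag | exact: Ag'].
- by case: (HH) => -[[_ _ _ HV] _] _; apply: HV; exact: Ag.
Qed.

Lemma alg_gen_zconnected S : S `<=` [set g | g \in unitmx] ->
  (forall g, S g -> exists A, [/\ zconnected A, A 1%:M, A g & A `<=` S]) ->
  zconnected (alg_gen S).
Proof.
move=> SU SA F1 F2 z1 z2 cov dis; have [sG zG] := alg_gen_algebraic SU.
apply: (separation_stab_all sG cov); apply: smallest_sub.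
  split; first exact: (separation_stab_subgroup sG cov dis).
  exact: (separation_stab_zclosed sG z1 z2 zG).
move=> g Sg; have [A [cA A1 Ag AS]] := SA _ Sg.
apply: (zconnected_separation_stab sG z1 z2 cov dis cA) Ag => //.
by move=> z /AS; exact: alg_gen_sub.
Qed.

Lemma stabilizer_algebraic (I : Type) (F : I -> mat) :
  algebraic_group [set g | g \in unitmx /\ forall i, stabilizes (F i) g].
Proof.
split.
  split=> [g []//||g g' [gU Fg] [gU' Fg']|g [gU Fg]].
  - by split=> [|i]; rewrite ?unitmx1 // /stabilizes mulmx1.
  - split=> [|i]; first by rewrite unitmx_mul gU.
    rewrite /stabilizes mulmxA; apply: submx_trans (submxMr _ (Fg i)) (Fg' i).
  - by split=> [|i]; rewrite ?unitmx_inv // ; exact: stabilizesV.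
pose J : set (mat -> K) := [set f | exists i j k,
  f = fun g => (F i *m g *m cokermx (F i)) j k].
have HJ f : J f -> regular f.
  move=> [i [j [k ->]]].
  exact: (regular_mxM (regular_mxM (regular_mx_const _ (F i)) (@regular_mx_id R n))
    (regular_mx_const _ (cokermx (F i))) j k).
have := zclosed_regular HJ; congr zclosed; apply/seteqP; split=> g [gU E]; split=> //.
  move=> i; rewrite /stabilizes submxE; apply/eqP/matrixP => j k; rewrite [RHS]mxE.
  by apply: (E (fun g => (F i *m g *m cokermx (F i)) j k)); exists i, j, k.
move=> _ [i [j [k ->]]]; move: (E i); rewrite /stabilizes submxE => /eqP ->.
by rewrite mxE.
Qed.

(** The stabilizer of a flag is algebraic, so it contains the group generated by [S] once it
    contains [S]. Each step of the flag adds at most one dimension, on which the group acts by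
    scalars. *)
Lemma alg_gen_solvable S (st : mat -> Prop) : S `<=` [set g | g \in unitmx] ->
  (forall W g, st W -> S g -> stabilizes W g) -> st 0 ->
  (forall W, st W -> ~~ (1%:M <= W)%MS ->
     exists v : 'rV[K]_n, ~~ (v <= W)%MS /\ exists2 W', st W' & (W' :=: W + v)%MS) ->
  solvable_group (alg_gen S).
Proof.
move=> SU stS st0 ext; have [F [F0 Fn Fle Fst Fv]] := flag_exists st0 ext.
have GF : alg_gen S `<=` [set g | g \in unitmx /\ forall i, stabilizes (F i) g].
  apply: smallest_sub; first exact: stabilizer_algebraic.
  by move=> g Sg; split=> [|i]; [exact: SU | exact: stS].
have [sG _] := alg_gen_algebraic SU.
apply: (flag_solvable sG F0 Fn Fle) => [g i /GF[] //|g i Hg].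
have [v vE] := Fv i; have [_ Fg] := GF _ Hg.
have sub1 c : (v *m (g - c%:M) <= F i)%MS -> (F i.+1 *m (g - c%:M) <= F i)%MS.
  move=> vc; apply: submx_trans (submxMr _ vE) _; rewrite addsmxMr addsmx_sub vc andbT.
  rewrite mulmxBr mul_mx_scalar submxB ?scalemx_sub //; exact: Fg.
have [vF|nv] := boolP (v <= F i.+1)%MS; last first.
  exists 0; rewrite raddf0 subr0; apply: submx_trans (Fg i); apply: submxMr.
  apply/sub_rows => w wF; have /sub_addsmxP[[a b] /= E] := submx_trans wF vE.
  have bE : b *m v = b 0 0 *: v by rewrite [b]mx11_scalar mul_scalar_mx !mxE.
  have [b0|bn0] := eqVneq (b 0 0) 0.
    by rewrite E bE b0 scale0r addr0 submxMl.
  case/negP: nv; have -> : v = (b 0 0)^-1 *: (w - a *m F i).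
    by rewrite E addrC addKr bE scalerA mulVf // scale1r.
  by rewrite scalemx_sub // submxB // (submx_trans _ (Fle i)) // submxMl.
have /sub_addsmxP[[a b] /= E] := submx_trans (submx_trans (submxMr g vF) (Fg _)) vE.
exists (b 0 0); apply: sub1; rewrite mulmxBr mul_mx_scalar E.
by rewrite [b]mx11_scalar mul_scalar_mx !mxE mulr1n addrK submxMl.
Qed.

(** Irreducibility of the line: if neither closed set contained the curve, each would give a nonzero
    polynomial in the parameter, and their product would vanish everywhere. *)
Lemma zconnected_mexp N (X : mat) : X ^+ N = 0 ->
  zconnected (range (fun s : K => mexp N (s *: X))).
Proof.
move=> XN F1 F2 z1 z2 cov _.
have [|n1] := pselect (range (fun s : K => mexp N (s *: X)) `<=` F1); first by left.
have [|n2] := pselect (range (fun s : K => mexp N (s *: X)) `<=` F2); first by right.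
have wit F : zclosed F -> ~ range (fun s : K => mexp N (s *: X)) `<=` F ->
    exists r : {poly K}, r != 0 /\ forall s, F (mexp N (s *: X)) -> r.[s] = 0.
  move=> zF /existsNP[g /not_implyP[[s _ <-] nF]].
  have : ~ forall q, vanish F q -> mxeval q (mexp N (s *: X)) = 0.
    by move=> all; apply: nF; apply: (zclosed_vanish zF (mexp_unit XN s)).
  move=> /existsNP[q /not_implyP[Vq /eqP qn]].
  have [r Hr] := mexp_poly XN q; exists r; split=> [|t Ft].
    by apply: contraNneq qn => r0; rewrite -(Hr s).1 r0 horner0.
  by rewrite (Hr t).1; exact: Vq.
have [r1 [rn1 E1]] := wit _ z1 n1; have [r2 [rn2 E2]] := wit _ z2 n2.
have : r1 * r2 = 0.
  apply: poly_fun_eq0 => s; rewrite hornerM.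
  have [|/E1 ->|/E2 ->] := cov (mexp N (s *: X)); rewrite ?mul0r ?mulr0 //.
by move/eqP; rewrite mulf_eq0 (negbTE rn1) (negbTE rn2).
Qed.

(** Stated through real coordinates, so that only the topology of the reals is involved. *)
Definition ccont (u : R -> K) := exists a b : R -> R,
  [/\ continuous a, continuous b & forall s, u s = (a s +i* b s)%C].

Lemma ccontD u v : ccont u -> ccont v -> ccont (fun s => u s + v s).
Proof.
move=> [a [b [ca cb E]]] [a' [b' [ca' cb' E']]].
exists (fun s => a s + a' s), (fun s => b s + b' s); split=> [s|s|s].
- by apply: cvgD; [exact: ca | exact: ca'].
- by apply: cvgD; [exact: cb | exact: cb'].
- by rewrite E E'.
Qed.

Lemma ccontM u v : ccont u -> ccont v -> ccont (fun s => u s * v s).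
Proof.
move=> [a [b [ca cb E]]] [a' [b' [ca' cb' E']]].
exists (fun s => a s * a' s - b s * b' s), (fun s => a s * b' s + b s * a' s).
split=> [s|s|s] /=.
- by apply: cvgB; apply: cvgM; [exact: ca | exact: ca' | exact: cb | exact: cb'].
- by apply: cvgD; apply: cvgM; [exact: ca | exact: cb' | exact: cb | exact: ca'].
- by rewrite E E'.
Qed.

Lemma ccont_cst c : ccont (fun=> c).
Proof.
by exists (fun=> complex.Re c), (fun=> complex.Im c); split;
   [exact: cst_continuous | exact: cst_continuous | case: c].
Qed.

Lemma ccont_sum (I : Type) (r : seq I) (u : I -> R -> K) :
  (forall i, ccont (u i)) -> ccont (fun s => \sum_(i <- r) u i s).
Proof.
move=> cu; elim: r => [|i r IH].
  rewrite (_ : (fun _ => _) = fun=> 0); first exact: ccont_cst.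
  by apply/funext => s; rewrite big_nil.
rewrite (_ : (fun _ => _) = fun s => u i s + \sum_(j <- r) u j s); first exact: ccontD.
by apply/funext => s; rewrite big_cons.
Qed.

Lemma ccont_expR (c : R) : ccont (fun s => (expR (s * c))%:C).
Proof.
exists (fun s => expR (s * c)), (fun=> 0); split=> //; last exact: cst_continuous.
move=> s; apply: (cvg_comp (fun s => s * c) expR _ (@continuous_expR R (s * c))).
by apply: cvgM; [exact: cvg_id | exact: cvg_cst].
Qed.

Lemma ccont_mxeval_real_exp (X : mat) (f : K -> R) q :
  ccont (fun s => mxeval q (real_exp X f s)).
Proof.
elim/mxp_ind: q => [c|k|p q cp cq|p q cp cq].
- rewrite (_ : (fun _ => _) = fun=> c); first exact: ccont_cst.
  by apply/funext => s; rewrite mxevalC.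
- case/mxvec_indexP: k => i j.
  rewrite (_ : (fun _ => _) = fun s => \sum_l ((invmx (eigbasis X) i l * eigbasis X l j) *
      (expR (s * f (eigvals X l)))%:C)).
    by apply: ccont_sum => l; apply: ccontM; [exact: ccont_cst | exact: ccont_expR].
  apply/funext => s; rewrite mxeval_var mxvecE /real_exp replica.unlock mul_mx_diag mxE.
  by apply: eq_bigr => l _; rewrite !mxE mulrAC.
- rewrite (_ : (fun _ => _) = fun s => mxeval p (real_exp X f s) +
    mxeval q (real_exp X f s)); first exact: ccontD.
  by apply/funext => s; rewrite mxevalD.
- rewrite (_ : (fun _ => _) = fun s => mxeval p (real_exp X f s) *
    mxeval q (real_exp X f s)); first exact: ccontM.
  by apply/funext => s; rewrite mxevalM.
Qed.

(** The curve is not polynomial in [s], so the usual topology of the real line is used: a separation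
    of the curve pulls back to a separation of the line into closed sets. *)
Lemma zconnected_real_exp (X : mat) (f : K -> R) : add_hom f ->
  zconnected (range (real_exp X f)).
Proof.
move=> hf F1 F2 z1 z2 cov dis.
have EU s : real_exp X f s \in unitmx by apply: replica_exp_unit; exact: real_exp_hom.
pose T (F : set mat) : set R := [set s | F (real_exp X f s)].
have cT F : zclosed F -> closed (T F).
  move=> zF; rewrite (_ : T F = \bigcap_(q in vanish F)
      [set s | mxeval q (real_exp X f s) = 0]).
    apply: closed_bigI => q _.
    have [a [b [ca cb E]]] := ccont_mxeval_real_exp X f q.
    rewrite (_ : [set s | _] = (a @^-1` [set 0]) `&` (b @^-1` [set 0])).
      by apply: closedI; apply: closed_comp => //; exact: closed_eq.
    by apply/seteqP; split=> s /=; rewrite E => -[-> ->].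
  apply/seteqP; split=> s; first by move=> Fs q Vq; exact: Vq.
  by move=> all; apply: (zclosed_vanish zF (EU s)).
have T12 : T F2 = ~` T F1.
  apply/seteqP; split=> s /=.
    move=> f2 f1; have : (range (real_exp X f) `&` F1 `&` F2) (real_exp X f s).
      by split=> //; split=> //; exists s.
    by rewrite dis.
  move=> n1; have rs : range (real_exp X f) (real_exp X f s) by exists s.
  by case: (cov _ rs).
have conn : connected [set: R] by apply/connected_intervalP => ? ? ? ? ?.
have [e|/set0P ne] := eqVneq (T F1) set0.
  right=> _ [s _ <-]; suff : T F2 s by []; by rewrite T12 e.
left=> _ [s _ <-]; suff E : T F1 = setT by have : T F1 s by rewrite E.
apply: conn => //.
- exists (T F1); last by rewrite setTI.
  by rewrite -[T F1]setCK -T12; apply: closed_openC; exact: cT.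
- by exists (T F1); [exact: cT | rewrite setTI].
Qed.

End GeneratedAlgebraicGroup.

(** * Unipotent elements modulo a stable subspace *)

Section Unipotent.
Variables (R : realType) (n : nat).
Local Notation K := R[i].
Local Notation mat := 'M[K]_n.

(** [u] is the series of [(exp y - 1) / y], equal to 1 plus a nilpotent. It serves to pass between
    vectors fixed by [exp y] and vectors killed by [y], also modulo a stable subspace. *)
Lemma mexp1_factor N (y : mat) : y ^+ N = 0 ->
  exists u, [/\ u \in unitmx, mexp N y - 1%:M = y *m u, y *m u = u *m y
    & forall W : mat, stabilizes W y -> stabilizes W u].
Proof.
move=> yN; case: N yN => [|N] yN.
  have e0 (z : mat) : z = 0 by rewrite -[z]mul1mx -[1%:M]/(1 : mat) -(expr0 y) yN mul0mx.
  exists 1%:M; split; first exact: unitmx1.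
  - by rewrite [LHS]e0 [RHS]e0.
  - by rewrite mulmx1 mul1mx.
  - by move=> W _; rewrite /stabilizes mulmx1.
have mulZ a (z : mat) : y * (a *: z) = a *: (y * z) by exact/esym/scalemxAr.
have mulZl a (z : mat) : (a *: z) * y = a *: (z * y) by exact/esym/scalemxAl.
pose u : mat := \sum_(k < N.+1) (k.+1`!%:R)^-1 *: y ^+ k.
pose w : mat := \sum_(k < N) (k.+2`!%:R)^-1 *: y ^+ k.
have uE : u = 1 + y * w.
  rewrite /u big_ord_recl /= invr1 scale1r expr0; congr (_ + _).
  rewrite /w mulr_sumr; apply: eq_bigr => k _.
  by rewrite mulZ -exprS.
have comy (c : nat -> K) M : y * (\sum_(k < M) c k *: y ^+ k) = (\sum_(k < M) c k *: y ^+ k) * y.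
  rewrite mulr_sumr mulr_suml; apply: eq_bigr => k _.
  by rewrite mulZ mulZl -exprS exprSr.
have cyw : y * w = w * y by exact: (comy (fun k => (k.+2`!%:R)^-1)).
exists u; split.
- have : (1 - (- (y * w)) ^+ N.+1) = 1 :> mat.
    by rewrite exprNn exprMn_comm // yN mul0r mulr0 subr0.
  have := subrX1 (- (y * w)) N.+1; rewrite -opprB => /eqP; rewrite eqr_oppLR => /eqP ->.
  rewrite -mulNr opprB opprK -uE => E.
  by have [] := mulmx1_unit (E : u *m _ = 1%:M).
- rewrite mexp.unlock big_ord_recl expr0 invr1 scale1r -[1%:M]/(1 : mat) addrC addKr.
  rewrite -[RHS]/(y * u) mulr_sumr big_ord_recr /= mulZ.
  rewrite -exprS yN scaler0 addr0; apply: eq_bigr => k _.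
  by rewrite mulZ -exprS.
- exact: (comy (fun k => (k.+1`!%:R)^-1)).
- move=> W Wy; rewrite /stabilizes mulmx_sumr summx_sub // => k _.
  rewrite -scalemxAr scalemx_sub //; elim: (k : nat) => [|j IH].
    by rewrite expr0 mulmx1.
  rewrite exprS -[y * _]/(y *m _) mulmxA; exact: submx_trans (submxMr _ Wy) IH.
Qed.

Lemma mexp_stabilizes N (y W : mat) s : y ^+ N = 0 -> stabilizes W y ->
  stabilizes W (mexp N (s *: y)).
Proof.
move=> yN Wy; have sN : (s *: y) ^+ N = 0 by rewrite expmxZ yN scaler0.
have Wsy : stabilizes W (s *: y) by rewrite /stabilizes -scalemxAr scalemx_sub.
have [u [_ E _ Wu]] := mexp1_factor sN.
rewrite /stabilizes -(subrK 1%:M (mexp N _)) E mulmxDr mulmx1 addmx_sub //.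
by rewrite mulmxA; exact: submx_trans (submxMr _ Wsy) (Wu _ Wsy).
Qed.

(** [exp y - 1 = y u] is nilpotent, so its eigenvalue [c - 1] modulo [W] is zero; then [u] is
    cancelled. *)
Lemma mexp_eigen_mod N (y W : mat) (v : 'rV[K]_n) c : y ^+ N = 0 -> stabilizes W y ->
  ~~ (v <= W)%MS -> (v *m mexp N y - c *: v <= W)%MS -> (v *m y <= W)%MS.
Proof.
move=> yN Wy nv vE; have [u [uU E yu Wu]] := mexp1_factor yN.
have Ev : (v *m (y *m u) - (c - 1) *: v <= W)%MS.
  by rewrite -E mulmxBr mulmx1 scalerBl scale1r opprB addrA subrK.
have Wyu : stabilizes W (y *m u).
  by rewrite /stabilizes mulmxA; exact: submx_trans (submxMr _ Wy) (Wu _ Wy).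
have iterE k : (v *m (y *m u) ^+ k - (c - 1) ^+ k *: v <= W)%MS.
  elim: k => [|k IH]; first by rewrite !expr0 scale1r mulmx1 subrr sub0mx.
  have -> : (y *m u) ^+ k.+1 = (y *m u) ^+ k *m (y *m u) by exact: exprSr.
  have -> : v *m ((y *m u) ^+ k *m (y *m u)) - (c - 1) ^+ k.+1 *: v =
     (v *m (y *m u) ^+ k - (c - 1) ^+ k *: v) *m (y *m u) +
     (c - 1) ^+ k *: (v *m (y *m u) - (c - 1) *: v).
    by rewrite mulmxBl -scalemxAl scalerBr addrA subrK scalerA -exprSr mulmxA.
  by rewrite addmx_sub ?scalemx_sub //; exact: submx_trans (submxMr _ IH) Wyu.
have [c1|cn] := eqVneq c 1.
  move: Ev; rewrite c1 subrr scale0r subr0 => Ev.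
  have := stabilizesV uU (Wu _ Wy); rewrite /stabilizes => WuV.
  rewrite -(mulmxK uU (v *m y)) -(mulmxA v); exact: submx_trans (submxMr _ Ev) WuV.
have := iterE N; rewrite -[y *m u]/(y * u) exprMn_comm // yN mul0r mulmx0 sub0r eqmx_opp.
move=> sub; case/negP: nv; rewrite -(scalerK (expf_neq0 N (_ : c - 1 != 0)) v).
  exact: scalemx_sub.
by rewrite subr_eq0.
Qed.

End Unipotent.

(** * The orthogonal of the Lie algebra of a Borel subgroup *)

Section BorelOrthogonal.
Variables (R : realType) (n : nat).
Local Notation K := R[i].
Local Notation mat := 'M[K]_n.
Implicit Types (G B : set mat) (g x y : mat).

Definition conj_rep g : 'M[K]_(n * n) := lin_mx (fun x : mat => invmx g *m x *m g).

Lemma conj_repE g (v : 'rV[K]_(n * n)) :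
  v *m conj_rep g = mxvec (invmx g *m vec_mx v *m g).
Proof.
have lin : linear (fun x : mat => invmx g *m x *m g).
  by move=> c x y; rewrite mulmxDr mulmxDl -scalemxAr -scalemxAl.
pose f : {linear mat -> mat} := HB.pack (fun x : mat => invmx g *m x *m g)
  (GRing.isLinear.Build K mat mat _ _ lin).
by rewrite -[v in LHS]vec_mxK -[conj_rep g]/(lin_mx f) mul_vec_lin.
Qed.

Lemma conj_rep_representation H : is_subgroup H -> representation conj_rep H.
Proof.
move=> [HU _ _ _]; split=> [|x y Hx Hy].
  apply/row_matrixP => i; rewrite !rowE conj_repE mulmx1 invmx1 mulmx1 mul1mx.
  by rewrite vec_mxK.
apply/row_matrixP => i; rewrite !rowE mulmxA !conj_repE mxvecK; congr mxvec.
have xU := HU _ Hx; have yU := HU _ Hy.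
have -> : invmx (x *m y) = invmx y *m invmx x.
  have xyU : x *m y \in unitmx by rewrite unitmx_mul xU.
  apply: (can_inj (mulKmx xyU)); rewrite mulmxV // mulmxA -(mulmxA x) mulmxV //.
  by rewrite mulmx1 mulmxV.
by rewrite !mulmxA.
Qed.

Lemma conj_rep_regular : regular_mx conj_rep.
Proof.
move=> i j; case/mxvec_indexP: j => k l.
apply: (@eq_regular _ _ (fun g => (invmx g *m vec_mx (delta_mx 0 i) *m g) k l)).
  exact: (regular_mxM (regular_mxM (@regular_mx_inv R n) (regular_mx_const _ _))
    (@regular_mx_id R n) k l).
move=> g _; have := conj_repE g (delta_mx 0 i); rewrite -rowE.
by move/rowP/(_ (mxvec_index k l)); rewrite mxvecE mxE.
Qed.

Lemma Re_add_hom : add_hom (@complex.Re R).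
Proof. by split=> // -[a b] [c d]. Qed.

Lemma Im_add_hom : add_hom (@complex.Im R).
Proof. by split=> // -[a b] [c d]. Qed.

Variables (G B : set mat).
Hypotheses (aG : algebraic_group G) (bB : borel_subgroup G B).

Let aB : algebraic_group B. Proof. by case: bB => -[]. Qed.
Let cB : zconnected B. Proof. by case: bB => -[]. Qed.
Let solvB : solvable_group B. Proof. by case: bB => -[]. Qed.
Let BG : B `<=` G. Proof. by case: bB => -[]. Qed.
Let sB : is_subgroup B. Proof. by case: aB. Qed.
Let sG : is_subgroup G. Proof. by case: aG. Qed.
Let BU g : B g -> g \in unitmx. Proof. by case: sB => BU _ _ _; exact: BU. Qed.
Let BV g : B g -> B (invmx g). Proof. by case: sB => _ _ _ BV; exact: BV. Qed.

Definition lie_perp (g b : set mat) : set mat :=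
  [set x | g x /\ forall y, b y -> \tr (x *m y) = 0].

Local Notation N := (lie_perp (Lie G) (Lie B)).
Local Notation N0 := (N `&` Lie B).

Lemma Lie_conj_sub H H' g X : is_subgroup H -> H' `<=` H -> H' g -> Lie H X ->
  Lie H (invmx g *m X *m g).
Proof.
move=> [HU _ HM HV] sub H'g; apply: Lie_conj (HU _ (sub _ H'g)) => z Hz.
by apply/HM/(sub _ H'g)/HM => //; apply: HV; exact: sub.
Qed.

Let perp_conj g x : B g -> N x -> N (invmx g *m x *m g).
Proof.
move=> Bg [gx xb]; split; first exact: (Lie_conj_sub sG BG).
move=> y by_; have -> : invmx g *m x *m g *m y = invmx g *m (x *m (g *m y)).
  by rewrite !mulmxA.
rewrite mxtrace_mulC -!mulmxA; apply: xb.
have := Lie_conj_sub sB (fun _ => id) (BV Bg) by_.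
by rewrite invmxK mulmxA.
Qed.

Let perp0_conj g x : B g -> N0 x -> N0 (invmx g *m x *m g).
Proof.
move=> Bg [Nx bx]; split; first exact: perp_conj.
exact: (Lie_conj_sub sB (fun _ => id)).
Qed.

Let perp0_conjV g x : B g -> N0 x -> N0 (g *m x *m invmx g).
Proof. by move=> Bg /(perp0_conj (BV Bg)); rewrite invmxK. Qed.

(** The conjugation replica of [y] lies in [Lie B], to which [y] is orthogonal. *)
Let perp0_nilpotent y : N0 y -> nilpotent_mx y.
Proof.
move=> [[_ yb] by_]; apply/trace_conj_nilpotent/yb/Lie_replica => //.
by split=> [|u v]; rewrite ?rmorph0 ?rmorphD.
Qed.

Let perp_subspace : is_subspace N.
Proof.
have [g0 gP] := Lie_subspace G.
split=> [|a x y [gx xb] [gy yb]]; split=> //.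
- by move=> y _; rewrite mul0mx linear0.
- exact: gP.
- by move=> z bz; rewrite mulmxDl -scalemxAl linearP /= xb // yb // mulr0 addr0.
Qed.

Let perp0_subspace : is_subspace N0.
Proof.
have [p0 pP] := perp_subspace; have [b0 bP] := Lie_subspace B.
by split=> // a x y [Nx bx] [Ny by_]; split; [exact: pP | exact: bP].
Qed.

Section Extension.
Variables (x : mat) (chi : mat -> K).
Hypotheses (Nx : N x) (chi_reg : regular chi) (chi1 : chi 1%:M = 1).
Hypothesis chi_n0 : forall g, B g -> chi g != 0.
Hypothesis chiE : forall g, B g -> N0 (invmx g *m x *m g - chi g *: x).

(** The members of the flag for the larger group. Stability under [N0] is carried along because [B]
    fixes [x] only up to scalars and elements of [N0]. *)
Let st (W : mat) := [/\ forall g, B g -> stabilizes W g, stabilizes W x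
  & forall y, N0 y -> stabilizes W y].

Let lk (W W1 : mat) : (forall g, B g -> stabilizes W g) ->
  (forall g, B g -> stabilizes W1 g) -> (W <= W1)%MS -> ~~ (W1 <= W)%MS ->
  exists v : 'rV[K]_n, [/\ (v <= W1)%MS, ~~ (v <= W)%MS &
    forall g, B g -> exists c, (v *m g - c *: v <= W)%MS].
Proof.
have [k dB] := solvB.
apply: (@lie_kolchin R n n id k B W W1 sB cB dB); first by split.
exact: regular_mx_id.
Qed.

Let extend (W : mat) : st W -> ~~ (1%:M <= W)%MS ->
  exists v : 'rV[K]_n, ~~ (v <= W)%MS /\ exists2 W', st W' & (W' :=: W + v)%MS.
Proof.
move=> [WB Wx WN] nW.
have expB M y : y ^+ M = 0 -> Lie B y -> B (mexp M y).
  by move=> yM by_; have [sB' zB] := aB; rewrite -[y]scale1r; exact: Lie_mexp.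
(* B acts on v by scalars modulo W, and exp y is unipotent. *)
have lkN (v : 'rV[K]_n) : ~~ (v <= W)%MS -> (forall g, B g -> exists c, (v *m g - c *: v <= W)%MS) ->
    forall y, N0 y -> (v *m y <= W)%MS.
  move=> nv vB y Ny; have [M yM] := perp0_nilpotent Ny.
  have [c vc] := vB _ (expB _ _ yM Ny.2).
  exact: (mexp_eigen_mod yM (WN _ Ny) nv vc).
(* On the vectors that [N0] kills modulo [W], the element [x] and the group [B] commute up to
   [chi]. *)
have [W1 HW1] : exists A : mat, forall v : 'rV[K]_n,
    (v <= A)%MS <-> (forall y, N0 y -> (v *m y <= W)%MS).
  apply: subspace_mx => [y _|c u v uN vN y Ny]; first by rewrite mul0mx sub0mx.
  by rewrite mulmxDl -scalemxAl addmx_sub ?scalemx_sub ?uN ?vN.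
have WW1 : (W <= W1)%MS.
  by apply: sub_rows => v vW; apply/HW1 => y /WN Wy; exact: (stable_sub Wy vW).
have W1B g : B g -> stabilizes W1 g.
  move=> Bg; apply: sub_mulmx_row => v /HW1 vN; apply/HW1 => y Ny.
  have -> : v *m g *m y = v *m (g *m y *m invmx g) *m g.
    by rewrite !mulmxA mulmxKV ?BU.
  by apply: stable_sub (WB _ Bg) _; apply/vN/perp0_conjV.
have xconj g (v : 'rV[K]_n) : B g -> (v <= W1)%MS ->
    (v *m x *m g - chi g *: (v *m g *m x) <= W)%MS.
  move=> Bg vW1; have vgW1 := stable_sub (W1B _ Bg) vW1.
  have -> : v *m x *m g - chi g *: (v *m g *m x) =
      v *m g *m (invmx g *m x *m g - chi g *: x).
    by rewrite mulmxBr -scalemxAr !mulmxA mulmxK ?BU.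
  by move/HW1: vgW1; apply; exact: chiE.
(* For [v] in [W1], [g = exp y] fixes [v] modulo [W], so [v x] is there an eigenvector of [g] with
   eigenvalue [chi g]; as [g] is unipotent, [y] kills it modulo [W]. *)
have W1x : stabilizes W1 x.
  apply: sub_mulmx_row => v vW1; apply/HW1 => y Ny.
  have [vxW|nvx] := boolP (v *m x <= W)%MS; first exact: stable_sub (WN _ Ny) vxW.
  have [M yM] := perp0_nilpotent Ny; have Bg := expB _ _ yM Ny.2.
  apply: (mexp_eigen_mod (c := chi (mexp M y)) yM (WN _ Ny) nvx).
  have := xconj _ _ Bg vW1; set g := mexp M y => le.
  have vg : (v *m g - v <= W)%MS.
    have [u [_ E _ Wu]] := mexp1_factor yM.
    rewrite -[X in _ - X]mulmx1 -mulmxBr E mulmxA; apply: stable_sub (Wu _ (WN _ Ny)) _.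
    by move/HW1: vW1; apply.
  have -> : v *m x *m g - chi g *: (v *m x) =
      (v *m x *m g - chi g *: (v *m g *m x)) + chi g *: ((v *m g - v) *m x).
    by rewrite mulmxBl scalerBr addrA subrK.
  by rewrite addmx_sub // scalemx_sub // stable_sub.
(* A common eigenvector of [B] modulo [W] is killed by [N0] modulo [W]. *)
have nW1 : ~~ (W1 <= W)%MS.
  have [|v [_ nv vB]] := lk WB _ (submx1 W) nW.
    by move=> g _; exact: submx1.
  apply/negP => W1W; case/negP: (nv); apply: submx_trans W1W; apply/HW1 => y.
  exact: (lkN v nv vB).
have [v1 [lam [v1W1 nv1 v1x]]] := eigenvector_mod Wx W1x nW1.
have nWg (v : 'rV[K]_n) g : B g -> ~~ (v <= W)%MS -> ~~ (v *m g <= W)%MS.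
  move=> Bg; apply: contra => vg; have := stable_sub (WB _ (BV Bg)) vg.
  by rewrite mulmxK ?BU.
have xg g (v : 'rV[K]_n) : B g -> (v <= W1)%MS -> (v *m x - lam *: v <= W)%MS ->
    (v *m g *m x - (lam / chi g) *: (v *m g) <= W)%MS.
  move=> Bg vW1 vx; have c0 := chi_n0 Bg.
  have -> : v *m g *m x - (lam / chi g) *: (v *m g) = (chi g)^-1 *:
     ((v *m x - lam *: v) *m g - (v *m x *m g - chi g *: (v *m g *m x))).
    rewrite mulmxBl opprB [X in _ = _ *: X]addrC addrA subrK -scalemxAl scalerBr.
    by rewrite (scalerA _ (chi g)) (mulVf c0) scale1r scalerA [_ * lam]mulrC.
  apply/scalemx_sub/submxB; last exact: xconj.
  exact: stable_sub (WB _ Bg) vx.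
(* lam / chi g is an eigenvalue of x, hence chi = 1 unless lam = 0. *)
have chi_lam g : B g -> lam / chi g = lam.
  move=> Bg; have [->|l0] := eqVneq lam 0; first by rewrite mul0r.
  have [rs Ers] := closed_field_poly_normal (char_poly x).
  have fin g' : B g' -> chi g' \in [seq lam / mu | mu <- rs].
    move=> Bg'; apply/mapP; exists (lam / chi g').
      have := eigenvalue_mod Wx (nWg _ _ Bg' nv1) (xg _ _ Bg' v1W1 v1x).
      rewrite Ers rootZ ?root_prod_XsubC // lead_coef_eq0.
      exact/monic_neq0/char_poly_monic.
    by rewrite invf_div mulrCA divff // mulr1.
  have B1 : B 1%:M by case: sB.
  have chi_eq1 : chi g = 1 by rewrite -chi1; exact: (fin_const cB BU chi_reg fin Bg B1).
  by rewrite chi_eq1 divr1.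
(* This eigenspace of [x] is [B]-stable by [chi_lam]; a common eigenvector of [B] in it extends the
   flag. *)
have [W2 HW2] : exists A : mat, forall v : 'rV[K]_n,
    (v <= A)%MS <-> ((v <= W1)%MS /\ (v *m x - lam *: v <= W)%MS).
  apply: subspace_mx => [|c u v [u1 ux] [v1' vx]].
    by rewrite mul0mx scaler0 subrr !sub0mx.
  split; first by rewrite addmx_sub // scalemx_sub.
  rewrite mulmxDl -scalemxAl scalerDr opprD addrACA scalerA mulrC -scalerA.
  by rewrite -scalerBr addmx_sub ?scalemx_sub.
have W2B g : B g -> stabilizes W2 g.
  move=> Bg; apply: sub_mulmx_row => v /HW2[vW1 vx]; apply/HW2; split.
    exact: stable_sub (W1B _ Bg) vW1.
  by have := xg _ _ Bg vW1 vx; rewrite chi_lam.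
have WW2 : (W <= W2)%MS.
  apply: sub_rows => v vW; apply/HW2; split; first exact: submx_trans vW WW1.
  by rewrite submxB ?scalemx_sub // stable_sub.
have nW2 : ~~ (W2 <= W)%MS.
  by apply: contra nv1 => W21; apply: submx_trans W21; apply/HW2.
have [v [/HW2[vW1 vx] nv vB]] := lk WB W2B WW2 nW2.
exists v; split=> //; exists (W + v)%MS; last by [].
have addst z : stabilizes W z -> (exists c, (v *m z - c *: v <= W)%MS) -> stabilizes (W + v)%MS z.
  move=> Wz [c vc]; rewrite /stabilizes addsmxMr addsmx_sub; apply/andP; split.
    exact: submx_trans Wz (addsmxSl _ _).
  rewrite -(subrK (c *: v) (v *m z)) addmx_sub //.
    exact: submx_trans vc (addsmxSl _ _).
  by rewrite scalemx_sub // addsmxSr.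
split=> [g Bg||y Ny].
- by apply: addst; [exact: WB | exact: vB].
- by apply: addst => //; exists lam.
- apply: addst; first exact: WN.
  by exists 0; rewrite scale0r subr0; exact: lkN.
Qed.

(* The semisimple and nilpotent parts of x integrate to one-parameter groups,
   which together with B generate a connected solvable group. *)
Lemma perp_eigenvector_in : Lie B x.
Proof.
have [sG' zG] := aG; have [gx xb] := Nx.
have [M xM] := replica_nilpotent_part x; set xn := x - _ in xM.
have Lss : Lie G (replica x id) by apply: Lie_replica.
have Lxn : Lie G xn.
  by rewrite /xn addrC -scaleN1r; case: (Lie_subspace G) => _; apply.
pose S : set mat := B `|` range (real_exp x (@complex.Re R)) `|`
  range (real_exp x (@complex.Im R)) `|` range (fun s : K => mexp M (s *: xn)).
have SU : S `<=` [set g | g \in unitmx].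
  move=> g [[[/BU //|]|]|] [s _ <-] /=.
  - by apply: replica_exp_unit; apply: real_exp_hom; exact: Re_add_hom.
  - by apply: replica_exp_unit; apply: real_exp_hom; exact: Im_add_hom.
  - exact: mexp_unit.
have real0 f : real_exp x f 0 = 1%:M.
  by rewrite -(replica1 x); apply: eq_replica => z; rewrite mul0r expR0.
have cS : zconnected (alg_gen S).
  apply: alg_gen_zconnected => // g [[[Bg|rg]|rg]|rg].
  - by exists B; split=> //; [case: sB | move=> z Bz; do 3 left].
  - exists (range (real_exp x (@complex.Re R))); split=> //.
    + exact/zconnected_real_exp/Re_add_hom.
    + by exists 0.
    + by move=> z rz; do 2 left; right.
  - exists (range (real_exp x (@complex.Im R))); split=> //.
    + exact/zconnected_real_exp/Im_add_hom.
    + by exists 0.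
    + by move=> z rz; left; right.
  - exists (range (fun s : K => mexp M (s *: xn))); split=> //.
    + exact: zconnected_mexp.
    + by exists 0; rewrite ?mexp0.
    + by move=> z rz; right.
have stR W f : stabilizes W x -> stabilizes W (replica x f).
  move=> Wx; apply: sub_mulmx_row => v vW.
  apply: (@replica_stable _ _ x f (fun v => (v <= W)%MS)) => //.
  - exact: sub0mx.
  - by move=> c u w uW wW; rewrite addmx_sub // scalemx_sub.
  - by move=> u; exact: stable_sub.
have solvS : solvable_group (alg_gen S).
  apply: (@alg_gen_solvable _ _ S st) => //; last first.
  - by split=> *; rewrite /stabilizes mul0mx sub0mx.
  - move=> W g [WB Wx WN] [[[Bg|]|]|]; first exact: WB.
    + by move=> [s _ <-]; exact: stR.
    + by move=> [s _ <-]; exact: stR.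
    + move=> [s _ <-]; apply: mexp_stabilizes => //.
      by rewrite /stabilizes /xn mulmxBr submxB //; exact: stR.
have GS : alg_gen S `<=` G.
  apply: smallest_sub => // g [[[/BG //|]|]|] [s _ <-] /=.
  - by apply: replica_in_group => //; apply: real_exp_hom; exact: Re_add_hom.
  - by apply: replica_in_group => //; apply: real_exp_hom; exact: Im_add_hom.
  - exact: Lie_mexp.
have SB : alg_gen S = B.
  case: bB => _; apply; first by split=> //; exact: alg_gen_algebraic.
  by move=> z Bz; apply: alg_gen_sub; do 3 left.
have SsubB : S `<=` B by rewrite -SB; exact: alg_gen_sub.
have [b0 bP] := Lie_subspace B.
have LRe : Lie B (replica x (fun z => (complex.Re z)%:C)).
  by apply: Lie_of_real_exp Re_add_hom _ => s; apply: SsubB; do 2 left; right; exists s.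
have LIm : Lie B (replica x (fun z => (complex.Im z)%:C)).
  by apply: Lie_of_real_exp Im_add_hom _ => s; apply: SsubB; left; right; exists s.
have Ln : Lie B xn.
  by apply: (mexp_Lie xM) => s; apply: SsubB; right; exists s.
have idE : replica x id = (0 +i* 1)%C *: replica x (fun z => (complex.Im z)%:C) +
    replica x (fun z => (complex.Re z)%:C).
  by rewrite -replicaZ -replicaD; apply: eq_replica => -[a b]; simpc.
have -> : x = 1 *: replica x id + xn by rewrite scale1r /xn addrC subrK.
rewrite idE.
by apply: (bP) => //; exact: (bP).
Qed.

End Extension.

Lemma borel_perp x : Lie G x -> (forall y, Lie B y -> \tr (x *m y) = 0) -> Lie B x.
Proof.
move=> gx xb; apply: contrapT => nbx; have Nx : N x by [].
have vecs (P : set mat) : is_subspace P -> exists A : 'M[K]_(n * n),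
    forall v : 'rV[K]_(n * n), (v <= A)%MS <-> P (vec_mx v).
  move=> [P0 PP]; apply: subspace_mx => [|c u v Pu Pv]; first by rewrite linear0.
  by rewrite linearP; exact: PP.
have [A HA] := vecs _ perp_subspace; have [A0 HA0] := vecs _ perp0_subspace.
have [k dB] := solvB.
have sA0 : stable_under conj_rep B A0.
  move=> g Bg; apply: sub_mulmx_row => v /HA0 Nv; apply/HA0.
  by rewrite conj_repE mxvecK; exact: perp0_conj.
have [|||v [/HA Nv nv vB]] := lie_kolchin sB cB dB (conj_rep_representation sB)
  conj_rep_regular sA0 (W1 := A).
- move=> g Bg; apply: sub_mulmx_row => v /HA Nv; apply/HA.
  by rewrite conj_repE mxvecK; exact: perp_conj.
- by apply: sub_rows => v /HA0[Nv _]; apply/HA.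
- apply/negP => sub; apply: nbx; have : (mxvec x <= A)%MS by apply/HA; rewrite mxvecK.
  by move=> /submx_trans /(_ sub) /HA0; rewrite mxvecK => -[].
have [d [A0d vd]] := functional_mod nv.
(* Read off by a functional that vanishes on [N0], the scalar is a matrix coefficient and hence
   regular in [g]. *)
pose chi g := (v *m conj_rep g *m d) 0 0.
have chiE g : B g -> (v *m conj_rep g - chi g *: v <= A0)%MS.
  move=> Bg; have [c vc] := vB _ Bg; suff -> : chi g = c by [].
  have [D] := submxP vc; move/(congr1 (mulmx^~ d)).
  rewrite -mulmxA A0d mulmx0 mulmxBl -scalemxAl vd => /eqP; rewrite subr_eq0 => /eqP E.
  by rewrite /chi E !mxE mulr1.
(* An element of [N] in [Lie B] would lie in [N0], against the choice of [v]. *)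
case/negP: nv; apply/HA0; split=> //.
apply: (perp_eigenvector_in (x := vec_mx v) (chi := chi)) => //.
- exact: (regular_mxM (regular_mxM (regular_mx_const _ v) conj_rep_regular)
    (regular_mx_const _ d) 0 0).
- by rewrite /chi (conj_rep_representation sB).1 mulmx1 vd mxE.
- move=> g Bg; apply/eqP => c0; have := chiE _ Bg; rewrite c0 scale0r subr0 => vA0.
  have := stable_sub (sA0 _ (BV Bg)) vA0.
  have [r1 rM] := conj_rep_representation sB.
  rewrite -mulmxA -rM ?mulmxV ?BU // ?r1 ?mulmx1; last exact: BV.
  by move=> vA; have [D] := submxP vA; move/(congr1 (mulmx^~ d)); rewrite vd -mulmxA A0d mulmx0;
     move/matrixP/(_ 0 0)/eqP; rewrite !mxE oner_eq0.
- move=> g Bg; have /HA0 := chiE _ Bg.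
  by rewrite linearB /= linearZ /= conj_repE mxvecK.
Qed.

End BorelOrthogonal.

(** * Weights of a diagonalizable Lie algebra and a generic element *)

Section TorusWeights.
Variables (R : realType) (n : nat).
Local Notation K := R[i].
Local Notation mat := 'M[K]_n.
Implicit Types (x y z v : mat).

Lemma bracket_linr x c y z : bracket x (c *: y + z) = c *: bracket x y + bracket x z.
Proof.
by rewrite /bracket mulmxDr mulmxDl -scalemxAr -scalemxAl scalerBr opprD addrACA.
Qed.

Lemma bracket_linl x c y z : bracket (c *: y + z) x = c *: bracket y x + bracket z x.
Proof.
by rewrite /bracket mulmxDr mulmxDl -scalemxAr -scalemxAl scalerBr opprD addrACA.
Qed.

Variable a : mat.
Hypothesis aU : a \in unitmx.

Definition tconj x : mat := a *m x *m invmx a.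
Definition tcoord z i : K := tconj z i i.
Definition tdiag z := is_diag_mx (tconj z).
(** The weight of the matrix unit at [(i, j)] in the diagonalizing basis. Every weight on a space of
    matrices has this form, so the weights are indexed by a finite type. *)
Definition wt i j z : K := tcoord z i - tcoord z j.

Lemma tconjK x : invmx a *m tconj x *m a = x.
Proof. by rewrite /tconj !mulmxA mulVmx // mul1mx mulmxKV. Qed.

Lemma tconj_inj : injective tconj.
Proof. by move=> x y E; rewrite -(tconjK x) E tconjK. Qed.

Lemma tconjM x y : tconj (x *m y) = tconj x *m tconj y.
Proof. by rewrite /tconj !mulmxA mulmxKV. Qed.

Lemma tconjP c x y : tconj (c *: x + y) = c *: tconj x + tconj y.
Proof. by rewrite /tconj mulmxDr mulmxDl -scalemxAr -scalemxAl. Qed.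

Lemma tconj0 : tconj 0 = 0. Proof. by rewrite /tconj mulmx0 mul0mx. Qed.

Lemma tdiagE z : tdiag z -> tconj z = diag_mx (\row_i tcoord z i).
Proof.
move=> /is_diag_mxP dz; apply/matrixP => i j; rewrite [RHS]mxE [X in _ = X *+ _]mxE.
have [->|ij] := eqVneq i j; first by rewrite mulr1n.
by rewrite mulr0n; apply: dz.
Qed.

Lemma tdiag_repr z : tdiag z -> z = invmx a *m diag_mx (\row_i tcoord z i) *m a.
Proof. by move=> dz; rewrite -tdiagE // tconjK. Qed.

Lemma tcoordP c x y i : tcoord (c *: x + y) i = c * tcoord x i + tcoord y i.
Proof. by rewrite /tcoord tconjP !mxE. Qed.

Lemma wtP i j c x y : wt i j (c *: x + y) = c * wt i j x + wt i j y.
Proof. by rewrite /wt !tcoordP mulrBr opprD addrACA. Qed.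

Lemma tconj_bracket z x i j : tdiag z -> tconj (bracket z x) i j = wt i j z * tconj x i j.
Proof.
move=> dz; have -> : tconj (bracket z x) = tconj z *m tconj x - tconj x *m tconj z.
  by rewrite /bracket -scaleN1r addrC tconjP !tconjM scaleN1r addrC.
by rewrite tdiagE // mul_diag_mx mul_mx_diag !mxE /wt mulrBl [X in _ - X]mulrC.
Qed.

Lemma tdiag_comm z y : tdiag z -> tdiag y -> z *m y = y *m z.
Proof.
move=> dz dy; apply: tconj_inj; rewrite !tconjM (tdiagE dz) (tdiagE dy) !mulmx_diag.
by congr diag_mx; apply/rowP => i; rewrite !mxE mulrC.
Qed.

Lemma replica_tdiag z f : tdiag z ->
  tconj (replica z f) = diag_mx (\row_i f (tcoord z i)).
Proof.
move=> dz; rewrite {1}(tdiag_repr dz) replica_diag // /tconj !mulmxA mulmxV // mul1mx.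
by rewrite mulmxK //; congr diag_mx; apply/rowP => i; rewrite !mxE.
Qed.

Lemma tcoord_replica z f i : tdiag z -> tcoord (replica z f) i = f (tcoord z i).
Proof. by move=> dz; rewrite {1}/tcoord replica_tdiag // mxE eqxx mulr1n mxE. Qed.

Lemma tconj_n0 x : x != 0 -> exists i j, tconj x i j != 0.
Proof.
move=> xn; have [[i [j H]]|no] := pselect (exists i j, tconj x i j != 0).
  by exists i, j.
case/eqP: xn; apply: tconj_inj; rewrite tconj0; apply/matrixP => i j; rewrite [RHS]mxE.
by apply/eqP; apply: contra_notT no => H; exists i, j.
Qed.

Lemma tconj_eigen z x c i j : tdiag z -> bracket z x = c *: x -> tconj x i j != 0 ->
  c = wt i j z.
Proof.
move=> dz E xn; have := tconj_bracket x i j dz; rewrite E.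
rewrite -[c *: x]addr0 tconjP tconj0 addr0 mxE.
by move/(mulIf xn).
Qed.

(** A nonzero power [x ^+ k] has eigenvalue [k c], and there are only finitely many eigenvalues. *)
Lemma eigen_nilpotent z x c : tdiag z -> bracket z x = c *: x -> c != 0 ->
  nilpotent_mx x.
Proof.
move=> dz E cn; apply: contrapT => nx.
have pow k : bracket z (x ^+ k) = (k%:R * c) *: x ^+ k.
  elim: k => [|k IH].
    by rewrite expr0 mul0r scale0r /bracket -[1]/(1%:M) mulmx1 mul1mx subrr.
  have -> : x ^+ k.+1 = x *m x ^+ k by exact: exprS.
  have -> : bracket z (x *m x ^+ k) = bracket z x *m x ^+ k + x *m bracket z (x ^+ k).
    by rewrite /bracket mulmxBl mulmxBr !mulmxA addrA subrK.
  by rewrite E IH -scalemxAl -scalemxAr -scalerDl -natr1 mulrDl mul1r addrC.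
pose s := [seq wt ij.1 ij.2 z | ij <- enum {: 'I_n * 'I_n}].
pose t := [seq (k%:R * c : K) | k <- iota 0 (size s).+1].
have ut : uniq t.
  rewrite map_inj_uniq ?iota_uniq // => k l /(mulIf cn) /eqP.
  by rewrite eqr_nat => /eqP.
have ts : {subset t <= s}.
  move=> _ /mapP[k _ ->]; have xk : x ^+ k != 0.
    by apply/eqP => x0; apply: nx; exists k.
  have [i [j ij]] := tconj_n0 xk; apply/mapP; exists (i, j); first by rewrite mem_enum.
  exact: tconj_eigen (pow k) ij.
by have := uniq_leq_size ut ts; rewrite size_map size_iota ltnn.
Qed.

Definition wtdec v y : seq (K * mat) :=
  [seq (wt ij.1 ij.2 v, tconj y ij.1 ij.2 *: (invmx a *m delta_mx ij.1 ij.2 *m a))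
     | ij <- index_enum ('I_n * 'I_n)%type].

Lemma wtdec_sum v y : \sum_(w <- wtdec v y) w.2 = y.
Proof.
rewrite big_map /= -[RHS]tconjK [in RHS](matrix_sum_delta (tconj y)).
rewrite pair_bigA /= mulmx_sumr mulmx_suml; apply: eq_bigr => ij _.
by rewrite -scalemxAr -scalemxAl.
Qed.

Lemma wtdec_eigen v y w : tdiag v -> w \in wtdec v y -> bracket v w.2 = w.1 *: w.2.
Proof.
move=> dv /mapP[[i j] _ ->] /=; apply: tconj_inj; apply/matrixP => k l.
have tZ c u : tconj (c *: u) = c *: tconj u by rewrite -[c *: u]addr0 tconjP tconj0 addr0.
have sc c (A : mat) : (c *: A) k l = c * A k l by rewrite mxE.
rewrite tconj_bracket // !tZ !sc.
have -> : tconj (invmx a *m delta_mx i j *m a) = delta_mx i j.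
  by rewrite /tconj !mulmxA mulmxV // mul1mx mulmxK.
rewrite [delta_mx i j k l]mxE.
by have [/andP[/eqP -> /eqP ->] //|_] := boolP ((k == i) && (l == j)); rewrite !mulr0.
Qed.

Variable te : set mat.
Hypotheses (te_diag : te `<=` tdiag) (te_sub : is_subspace te).
Hypothesis te_replica : forall z f, te z -> add_hom f -> te (replica z f).

Definition treal z := te z /\ forall i, tcoord z i \is Num.real.

Lemma treal0 : treal 0.
Proof.
split; first by case: te_sub.
by move=> i; rewrite /tcoord tconj0 mxE.
Qed.

Lemma trealP (c : R) x y : treal x -> treal y -> treal (c%:C *: x + y).
Proof.
move=> [tx rx] [ty ry]; split; first by case: te_sub => _; apply.
by move=> i; rewrite tcoordP realD // realM // complex_real.
Qed.

Lemma add_homC (f : K -> R) : add_hom f -> add_hom (fun u : K => (f u)%:C).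
Proof. by move=> [f0 fD]; split=> [|x y]; rewrite ?f0 ?fD // rmorphD. Qed.

Lemma treal_replica z (f : K -> R) : te z -> add_hom f ->
  treal (replica z (fun u : K => (f u)%:C)).
Proof.
move=> tz hf; split; first by apply: te_replica => //; exact: add_homC.
by move=> i; rewrite tcoord_replica ?complex_real //; exact: te_diag.
Qed.

(** An element at which no nonzero difference of weights vanishes separates the weights of [te];
    pairs [(i, i)] include comparison with the weight 0. *)
Definition wtdiff (q : 'I_n * 'I_n * ('I_n * 'I_n)) z : K :=
  wt q.1.1 q.1.2 z - wt q.2.1 q.2.2 z.

Lemma wtdiffP q c x y : wtdiff q (c *: x + y) = c * wtdiff q x + wtdiff q y.
Proof. by rewrite /wtdiff !wtP [in RHS]mulrBr opprD addrACA. Qed.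

Lemma avoid_nat (s : seq K) : exists k : nat, k%:R \notin s.
Proof.
apply: contrapT => no; pose t := [seq (k%:R : K) | k <- iota 0 (size s).+1].
have ut : uniq t.
  by rewrite map_inj_uniq ?iota_uniq // => k l /eqP; rewrite eqr_nat => /eqP.
have ts : {subset t <= s}.
  move=> _ /mapP[k _ ->]; have [//|nk] := boolP (k%:R \in s).
  by case: no; exists k.
by have := uniq_leq_size ut ts; rewrite size_map size_iota ltnn.
Qed.

(* A vector space is not a finite union of proper subspaces. *)
Lemma generic_element : exists v, treal v /\
  forall q z, te z -> wtdiff q z != 0 -> wtdiff q v != 0.
Proof.
suff H (s : seq ('I_n * 'I_n * ('I_n * 'I_n))) : exists v, treal v /\
    forall q z, q \in s -> te z -> wtdiff q z != 0 -> wtdiff q v != 0.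
  have [v [tv Hv]] := H (enum {: 'I_n * 'I_n * ('I_n * 'I_n)}).
  by exists v; split=> // q z tz; apply: Hv => //; rewrite mem_enum.
elim: s => [|q s [v [tv Hv]]]; first by exists 0; split=> //; exact: treal0.
have [[z [tz qz]]|no] := pselect (exists z, te z /\ wtdiff q z != 0); last first.
  exists v; split=> // q' z; rewrite inE => /orP[/eqP -> tz qz|]; last exact: Hv.
  by case: no; exists z.
(* The replicas of [z] for the real and the imaginary part have real coordinates, and by additivity
   [wtdiff q] is nonzero on one of them. *)
have [w [tw qw]] : exists w, treal w /\ wtdiff q w != 0.
  have dz := te_diag tz.
  have E (f : K -> R) : add_hom f ->
      wtdiff q (replica z (fun u : K => (f u)%:C)) = (f (wtdiff q z))%:C.
    move=> [f0 fD]; rewrite /wtdiff /wt !tcoord_replica //.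
    have fN (u : K) : f (- u) = - f u by apply/eqP; rewrite -addr_eq0 -fD addNr f0.
    by rewrite !(fD, fN) !(rmorphD, rmorphN).
  have [re0|ren] := eqVneq (complex.Re (wtdiff q z)) 0; last first.
    exists (replica z (fun u : K => (complex.Re u)%:C)); split.
      by apply: treal_replica => //; exact: Re_add_hom.
    by rewrite (E _ (@Re_add_hom R)) fmorph_eq0.
  exists (replica z (fun u : K => (complex.Im u)%:C)); split.
    by apply: treal_replica => //; exact: Im_add_hom.
  rewrite (E _ (@Im_add_hom R)) fmorph_eq0; apply: contraNneq qz => im0.
  by move: re0 im0; case: (wtdiff q z) => r i /= -> ->.
(* Each [q'] that is nonzero on [w] excludes a single value of [k]. *)
have [k Hk] := avoid_nat [seq - wtdiff q' v / wtdiff q' w | q' <- q :: s].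
exists (k%:R *: w + v); split.
  have -> : k%:R = (k%:R)%:C :> K by rewrite rmorph_nat.
  exact: trealP.
have good q' : q' \in q :: s -> wtdiff q' v != 0 \/ wtdiff q' w != 0 ->
    wtdiff q' (k%:R *: w + v) != 0.
  move=> qs nz; rewrite wtdiffP; have [w0|wn] := eqVneq (wtdiff q' w) 0.
    by rewrite w0 mulr0 add0r; case: nz => //; rewrite w0 eqxx.
  apply: contra Hk; rewrite addr_eq0 => /eqP E; apply/mapP; exists q' => //.
  by rewrite -E mulfK.
move=> q' z'; rewrite inE => /orP[/eqP -> tz' qz'|qs tz' qz'].
  by apply: good; [rewrite mem_head | right].
by apply: good; [rewrite inE qs orbT | left; exact: Hv qz'].
Qed.

Variable v : mat.
Hypotheses (tv : te v) (gen : forall q z, te z -> wtdiff q z != 0 -> wtdiff q v != 0).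

Lemma generic_wt i j k l z : te z -> wt i j v = wt k l v -> wt i j z = wt k l z.
Proof.
move=> tz E; apply/eqP; rewrite -subr_eq0; apply: contraT => H.
have := gen (q := ((i, j), (k, l))) tz H; rewrite /wtdiff /= E subrr eqxx //.
Qed.

Lemma generic_eigen x c : x != 0 -> bracket v x = c *: x -> exists i j,
  c = wt i j v /\ forall z, te z -> bracket z x = wt i j z *: x.
Proof.
move=> xn E; have dv := te_diag tv; have [i [j ij]] := tconj_n0 xn.
exists i, j; have cE := tconj_eigen dv E ij; split=> // z tz.
apply: tconj_inj; apply/matrixP => k l; rewrite tconj_bracket; last exact: te_diag.
rewrite -[_ *: x]addr0 tconjP tconj0 addr0 [RHS]mxE.
have [->|kl] := eqVneq (tconj x k l) 0; first by rewrite !mulr0.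
congr (_ * _); apply: generic_wt => //.
by rewrite -cE -(tconj_eigen dv E kl).
Qed.

Lemma wt0_generic i j z : te z -> wt i j v = 0 -> wt i j z = 0.
Proof.
move=> tz E; have ii u : wt i i u = 0 by rewrite /wt subrr.
by rewrite -(ii z); apply: generic_wt => //; rewrite ii.
Qed.

(** * Weights on a parabolic subgroup and its unipotent radical *)

Section Parabolic.
Variables (G T P U B : set mat).
Hypotheses (aG : algebraic_group G) (aT : algebraic_group T) (TG : T `<=` G).
Hypothesis T_diag : forall g, T g -> tdiag g.
Hypothesis te_t : te `<=` Lie T.
Hypotheses (aP : algebraic_group P) (PG : P `<=` G).
Hypotheses (bB : borel_subgroup G B) (BP : B `<=` P).
Hypothesis uU : unipotent_radical P U.
Hypothesis lP : levi_factor P (centralizer G te).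

Local Notation L := (centralizer G te).

Let sG : is_subgroup G. Proof. by case: aG. Qed.
Let aUU : algebraic_group U. Proof. by case: uU => -[]. Qed.
Let sP : is_subgroup P. Proof. by case: aP. Qed.
Let sU : is_subgroup U. Proof. by case: aUU. Qed.
Let UP : U `<=` P. Proof. by case: uU => -[_ _ _ []]. Qed.
Let LP : L `<=` P. Proof. by case: lP. Qed.
Let LU1 : L `&` U = [set 1%:M]. Proof. by case: lP => _ _ /(_ _ uU)[]. Qed.
Let LUP x : P x -> exists l w, [/\ L l, U w & x = l *m w].
Proof. by case: lP => _ _ /(_ _ uU)[_ ->]. Qed.
Let nU g x : P g -> U x -> U (g *m x *m invmx g).
Proof. by case: uU => -[_ _ _ [_ H]] _; exact: H. Qed.
Let GU g : G g -> g \in unitmx. Proof. by case: sG => H _ _ _; exact: H. Qed.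

Lemma TP : T `<=` P.
Proof.
move=> g Tg; apply: LP; split; first exact: TG.
by move=> z tz; apply: tdiag_comm; [exact: T_diag | exact: te_diag].
Qed.

Lemma te_P : te `<=` Lie P. Proof. by move=> z /te_t; apply: LieS; exact: TP. Qed.
Lemma te_G : te `<=` Lie G. Proof. by move=> z /te_t; apply: LieS; exact: TG. Qed.

(** The trace is constant on [U]. Differentiating it along the conjugation replica [k] and then
    along [x] shows that [x k] has trace 0. *)
Lemma Lie_unipotent_nilpotent x : Lie U x -> nilpotent_mx x.
Proof.
move=> ux; apply: trace_conj_nilpotent; set k := replica x _.
have uk : Lie U k by apply: Lie_replica => //; split=> [|? ?]; rewrite ?rmorph0 ?rmorphD.
pose q := lpoly (@mxtrace K n) - mpoly.mpolyC (n * n) (n%:R : K).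
have Vq : vanish U q.
  move=> g Ug; rewrite /q mxevalD mxevalN mxevalC (mxeval_lpoly (@mxtrace K n)) /=.
  have nil : nilpotent_mx (g - 1%:M) by case: uU => -[_ _ uni _] _; exact: uni.
  have := nilpotent_trace nil; rewrite linearB /= mxtrace1 => /eqP; rewrite subr_eq0 => /eqP ->.
  by rewrite subrr.
have lin (w : mat) : GRing.linear_for *%R (fun y : mat => \tr (y *m w)).
  by move=> c x1 x2; rewrite mulmxDl -scalemxAl linearP.
pose l (w : mat) : {linear mat -> K | *%R} := HB.pack (fun y : mat => \tr (y *m w))
  (GRing.isLinear.Build K mat K *%R _ (lin w)).
have [_ U1 _ _] := sU.
have := vanish_Dmx sU ux (vanish_Dmx sU uk Vq) U1.
rewrite /q !DmxD !DmxN !DmxC ?Dmx0 ?subr0 (Dmx_lpoly k (@mxtrace K n)) (Dmx_lpoly x (l k)).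
have -> : lpoly (fun y => l k (y *m x)) = lpoly (l (x *m k)).
  by apply: eq_lpoly => y /=; rewrite mulmxA.
by rewrite (mxeval_lpoly (l (x *m k))) /= mul1mx.
Qed.

(** Commuting with [te] puts [exp x] into [L], which meets [U] trivially; then [x u = exp x - 1 = 0]
    with [u] invertible. *)
Lemma radical_te_trivial x : Lie U x -> (forall z, te z -> bracket z x = 0) -> x = 0.
Proof.
move=> ux zx; have [M xM] := Lie_unipotent_nilpotent ux.
have comm z : te z -> x *m z = z *m x.
  by move=> /zx /eqP; rewrite /bracket subr_eq0 => /eqP.
have Ux : U (mexp M x) by rewrite -[x]scale1r; case: aUU => ? ?; exact: Lie_mexp.
have Lx : L (mexp M x).
  split; first exact/PG/UP.
  move=> z tz; rewrite mexp.unlock mulmx_suml mulmx_sumr; apply: eq_bigr => k _.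
  rewrite -scalemxAl -scalemxAr; congr (_ *: _); elim: (k : nat) => [|j IH].
    by rewrite expr0 [LHS]mul1mx [RHS]mulmx1.
  have -> : x ^+ j.+1 = x *m x ^+ j by exact: exprS.
  by rewrite -mulmxA IH !mulmxA comm.
have [u [uu E _ _]] := mexp1_factor xM.
have e1 : mexp M x = 1%:M by have : (L `&` U) (mexp M x) by []; rewrite LU1.
by move: E; rewrite e1 subrr => E; rewrite -(mulmxK uu x) -E mul0mx.
Qed.

Lemma parabolic_eigen_radical x z c : Lie P x -> te z -> bracket z x = c *: x ->
  c != 0 -> Lie U x.
Proof.
move=> px tz E cn; have dz := te_diag tz.
have [M xM] := eigen_nilpotent dz E cn.
(* As [f c] is nonzero, the element [t] built from [f] scales [x] by a factor [phi c] other than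
   1. *)
have [f [hf fc]] : exists f : K -> R, add_hom f /\ f c != 0.
  have [re0|ren] := eqVneq (complex.Re c) 0; last by exists (@complex.Re R); split=> //; exact: Re_add_hom.
  exists (@complex.Im R); split; first exact: Im_add_hom.
  by apply: contraNneq cn => im0; move: re0 im0; case: (c) => r i /= -> ->.
pose phi (y : K) : K := (expR (1 * f y))%:C.
have hphi : exp_hom phi by exact: real_exp_hom.
pose t := replica z phi.
have tU : t \in unitmx by exact: replica_exp_unit.
have Gt : G t by case: aG => _ zG; apply: replica_in_group => //; exact: te_G.
have Lt : L t.
  split=> // y ty; apply: replica_comm; exact: tdiag_comm (te_diag tz) (te_diag ty).
have tL l : L l -> t *m l = l *m t.
  by move=> [_ lz]; apply: replica_comm; rewrite lz.
have tx : t *m x = phi c *: (x *m t).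
  apply: tconj_inj; rewrite -[_ *: _]addr0 tconjP tconj0 addr0 !tconjM.
  rewrite replica_tdiag // mul_diag_mx mul_mx_diag; apply/matrixP => i j.
  rewrite [LHS]mxE [X in X * _]mxE [RHS]mxE [X in _ = _ * X]mxE [X in _ = _ * (_ * X)]mxE.
  have [->|xn] := eqVneq (tconj x i j) 0; first by rewrite mulr0 mul0r mulr0.
  have -> : tcoord z i = c + tcoord z j by rewrite (tconj_eigen dz E xn) /wt subrK.
  by rewrite hphi.2 -mulrA; congr (_ * _); rewrite mulrC.
have phi1 : phi c - 1 != 0.
  rewrite subr_eq0 /phi mul1r; apply: contra fc => /eqP/complexI.
  by rewrite -expR0 => /expR_inj ->.
(* Write exp (s' x) = l w along P = L U; the element t is central in L, so its
   commutator with exp (s' x) lies in U. *)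
have expU s : U (mexp M (s *: x)).
  have [sP' zP] := aP.
  (* The commutator of [t] and [exp (s' x)] has parameter [(phi c - 1) s'], and every [s] is of this
     form. *)
  suff H s' : U (mexp M (((phi c - 1) * s') *: x)).
    by have := H ((phi c - 1)^-1 * s); rewrite mulrA divff // mul1r.
  have Py : P (mexp M (s' *: x)) by exact: Lie_mexp.
  have tE : t *m mexp M (s' *: x) = mexp M ((phi c * s') *: x) *m t.
    rewrite !mexp.unlock mulmx_sumr mulmx_suml; apply: eq_bigr => k _.
    rewrite -scalemxAl -scalemxAr; congr (_ *: _).
    elim: (k : nat) => [|j IH]; first by rewrite !expr0 [LHS]mulmx1 [RHS]mul1mx.
    have -> : (s' *: x) ^+ j.+1 = (s' *: x) *m (s' *: x) ^+ j by exact: exprS.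
    have -> : ((phi c * s') *: x) ^+ j.+1 = ((phi c * s') *: x) *m ((phi c * s') *: x) ^+ j.
      by exact: exprS.
    rewrite -[RHS]mulmxA -IH !mulmxA -scalemxAr tx -!scalemxAl scalerA.
    by rewrite mulrC.
  have [l [w [Ll Uw yE]]] := LUP Py.
  have lU : l \in unitmx by apply: GU; case: Ll.
  have wU : w \in unitmx by case: sU => H _ _ _; exact: H.
  have -> : mexp M (((phi c - 1) * s') *: x) =
      l *m (t *m w *m invmx t *m invmx w) *m invmx l.
    rewrite mulrBl mul1r mexpD // -mexp_inv //.
    have -> : mexp M ((phi c * s') *: x) = t *m mexp M (s' *: x) *m invmx t.
      by rewrite tE mulmxK.
    rewrite yE; have -> : invmx (l *m w) = invmx w *m invmx l.
      have lwU : l *m w \in unitmx by rewrite unitmx_mul lU.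
      apply: (can_inj (mulKmx lwU)); rewrite mulmxV // mulmxA -(mulmxA l) mulmxV //.
      by rewrite mulmx1 mulmxV.
    by rewrite !mulmxA tL.
  have [_ _ UM UV] := sU.
  apply: nU; first exact: LP.
  apply: UM; last exact: UV.
  by apply: nU => //; exact: LP.
exact: mexp_Lie xM _ expU.
Qed.

(* Under the hypothesis x is orthogonal to Lie P for the trace form. *)
Lemma root_in_parabolic x c : Lie G x -> bracket v x = c *: x -> c != 0 ->
  (forall y, Lie P y -> bracket v y = - c *: y -> y = 0) -> Lie P x.
Proof.
move=> gx E cn noy; apply: (LieS BP); apply: (borel_perp aG bB) => // y /(LieS BP) py.
have dv := te_diag tv; have Pv := te_P tv.
have [p0 pP] := Lie_subspace P.
(* [Lie P] is stable under [bracket v], so it contains the component of [y] for [- c], which then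
   vanishes by hypothesis. *)
have sum_c : \sum_(w <- wtdec v y) (w.1 == - c)%:R *: w.2 = 0.
  apply: noy.
    apply: (@geneig_sum _ _ _ (bracket_linr v) (Lie P) p0 pP _ (wtdec v y)
      (fun mu => (mu == - c)%:R)).
    - by move=> w pw; exact: Lie_bracket.
    - by move=> w /(wtdec_eigen dv); exact: geneig_eigen.
    - by rewrite wtdec_sum.
  have br0 : bracket v 0 = 0 by rewrite /bracket mulmx0 mul0mx subrr.
  rewrite big_seq; apply: (big_ind (fun w => bracket v w = - c *: w)).
  - by rewrite br0 scaler0.
  - by move=> w1 w2 e1 e2; have := bracket_linr v 1 w1 w2; rewrite !scale1r e1 e2 scalerDr.
  - move=> w /(wtdec_eigen dv) wE; have [e|_] := eqVneq w.1 (- c).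
      by rewrite !scale1r wE e.
    by rewrite !scale0r br0 scaler0.
(* By invariance of the trace form, eigenvectors whose eigenvalues do not add up to 0 are
   orthogonal. *)
have tr0 w : w \in wtdec v y -> w.1 != - c -> \tr (x *m w.2) = 0.
  move=> /(wtdec_eigen dv) wE ne.
  have : \tr (bracket v x *m w.2) + \tr (x *m bracket v w.2) = 0.
    rewrite /bracket mulmxBl mulmxBr !linearB /= [\tr (x *m (v *m _))](_ : _ = \tr (x *m v *m w.2));
      last by rewrite mulmxA.
    rewrite addrA subrK [X in X - _](_ : _ = \tr (v *m (x *m w.2))); last by rewrite mulmxA.
    by rewrite mxtrace_mulC mulmxA subrr.
  rewrite E wE -scalemxAl -scalemxAr !linearZ /= -mulrDl => /eqP.
  by rewrite mulf_eq0 addrC addr_eq0 (negbTE ne) /= => /eqP.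
transitivity (\tr (x *m \sum_(w <- wtdec v y) (w.1 == - c)%:R *: w.2)); last first.
  by rewrite sum_c mulmx0 linear0.
rewrite -[y in LHS](wtdec_sum v) !mulmx_sumr !linear_sum /= big_seq [RHS]big_seq.
apply: eq_bigr => w ws; have [e|ne] := eqVneq w.1 (- c); first by rewrite scale1r.
by rewrite scale0r mulmx0 linear0 tr0.
Qed.

Definition occurs (m : set mat) i j := exists x, [/\ m x, x != 0 &
  forall z, te z -> bracket z x = wt i j z *: x].

(** Weight vectors in [Lie P] with a nonzero weight lie in [Lie U]. So if the opposite weight is
    missing on [Lie U], it is missing on [Lie P], and [root_in_parabolic] applies. *)
Lemma occurs_radical i j : occurs (Lie G) i j -> wt i j v != 0 ->
  occurs (Lie U) i j \/ occurs (Lie U) j i.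
Proof.
move=> [x [gx xn xE]] wn; have [oji|nji] := pselect (occurs (Lie U) j i); first by right.
left; exists x; split=> //; apply: (parabolic_eigen_radical _ tv (xE _ tv)) => //.
apply: (root_in_parabolic gx (xE _ tv)) => // y py yE.
apply/eqP; apply: contra_notT nji => yn; exists y.
have wN : - wt i j v = wt j i v by rewrite /wt opprB.
split=> //; first by apply: (parabolic_eigen_radical py tv yE); rewrite oppr_eq0.
have [k [l [Ekl yz]]] := generic_eigen yn yE.
by move=> z tz; rewrite yz //; congr (_ *: _); apply: generic_wt; rewrite // -Ekl wN.
Qed.

Lemma occurs_radical_n0 i j : occurs (Lie U) i j -> wt i j v != 0.
Proof.
move=> [x [ux xn xE]]; apply: contra xn => /eqP w0; apply/eqP/radical_te_trivial => //.
by move=> z tz; rewrite xE // (wt0_generic tz w0) scale0r.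
Qed.

End Parabolic.

End TorusWeights.

(** * Integrality of the eigenvalues of ad h *)

Section BracketSpectrum.
Variables (R : realType) (n : nat).
Local Notation K := R[i].
Local Notation mat := 'M[K]_n.
Implicit Types (e f h x y z p : mat).

Lemma bracket_mx z : exists Z : 'M[K]_(n * n), forall v, v *m Z = mxvec (bracket z (vec_mx v)).
Proof.
pose f : {linear mat -> mat} := HB.pack (bracket z)
  (GRing.isLinear.Build K mat mat _ _ (fun c x y => bracket_linr z c x y)).
by exists (lin_mx f) => v; rewrite -[v in LHS]vec_mxK mul_vec_lin.
Qed.

Lemma bracket_spectrum z : exists s : seq K,
  forall c x, x != 0 -> bracket z x = c *: x -> c \in s.
Proof.
have [Z HZ] := bracket_mx z.
have [rs Ers] := closed_field_poly_normal (char_poly Z).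
exists rs => c x xn E; have : root (char_poly Z) c.
  apply: (@eigenvalue_mod _ _ 0 Z (mxvec x)).
  - by rewrite mul0mx sub0mx.
  - by rewrite submx0 mxvec_eq0.
  - by rewrite HZ mxvecK E linearZ subrr sub0mx.
rewrite Ers rootZ ?root_prod_XsubC // lead_coef_eq0.
exact/monic_neq0/char_poly_monic.
Qed.

Lemma bracket_eigenvector (V : set mat) z : is_subspace V ->
  (forall x, V x -> V (bracket z x)) -> (exists2 x, V x & x != 0) ->
  exists x c, [/\ V x, x != 0 & bracket z x = c *: x].
Proof.
move=> [V0 VP] Vz [x Vx xn]; have [Z HZ] := bracket_mx z.
have [A HA] : exists A : 'M[K]_(n * n), forall v, (v <= A)%MS <-> V (vec_mx v).
  apply: subspace_mx => [|c u v Vu Vv]; first by rewrite linear0.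
  by rewrite linearP; exact: VP.
have [|||v [c [/HA Vv nv E]]] := @eigenvector_mod _ _ 0 A Z.
- by rewrite mul0mx sub0mx.
- by apply: sub_mulmx_row => v /HA Vv; apply/HA; rewrite HZ mxvecK; exact: Vz.
- apply/negP => A0; have : (mxvec x <= A)%MS by apply/HA; rewrite mxvecK.
  by move=> /submx_trans /(_ A0); rewrite submx0 mxvec_eq0 (negbTE xn).
exists (vec_mx v), c; split=> //; first by rewrite vec_mx_eq0 -submx0.
move: E; rewrite submx0 HZ subr_eq0 => /eqP /(congr1 vec_mx).
by rewrite mxvecK linearZ.
Qed.

Lemma bracket_ladder z (y : nat -> mat) c d : d != 0 ->
  (forall k, bracket z (y k) = (c + k%:R * d) *: y k) -> exists k, y k = 0.
Proof.
move=> dn yE; apply: contrapT => no; have [s Hs] := bracket_spectrum z.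
pose t := [seq c + k%:R * d | k <- iota 0 (size s).+1].
have ut : uniq t.
  rewrite map_inj_uniq ?iota_uniq // => k l /addrI /(mulIf dn) /eqP.
  by rewrite eqr_nat => /eqP.
have ts : {subset t <= s}.
  move=> _ /mapP[k _ ->]; apply: Hs (yE k); apply/eqP => yk.
  by apply: no; exists k.
by have := uniq_leq_size ut ts; rewrite size_map size_iota ltnn.
Qed.

Lemma bracket_jacobi x y z :
  bracket x (bracket y z) = bracket (bracket x y) z + bracket y (bracket x z).
Proof.
rewrite /bracket !mulmxBr !mulmxBl !mulmxA !opprB.
move: (x *m y *m z) (x *m z *m y) (y *m z *m x) (z *m y *m x) (y *m x *m z) (z *m x *m y).
by move=> m1 m2 m3 m4 m5 m6; apply/matrixP => i j; rewrite !mxE; ring.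
Qed.

(** Raise [x] to a highest weight vector [y] of weight [lam = m + 2 k0], then lower it. At the first
    [j0] where step [j0 + 1] gives 0, the formula [eY] forces [lam = j0]. Both strings end because
    the spectrum is finite. *)
Lemma sl2_integral e h f x m : bracket h e = 2%:R *: e -> bracket h f = - (2%:R *: f) ->
  bracket e f = h -> x != 0 -> bracket h x = m *: x -> exists k : int, m = k%:~R.
Proof.
move=> he hf ef xn hx.
have br0r z : bracket z 0 = 0 by rewrite /bracket mulmx0 mul0mx subrr.
have brZr z c y : bracket z (c *: y) = c *: bracket z y.
  by have := bracket_linr z c y 0; rewrite br0r !addr0.
have brZl z c y : bracket (c *: z) y = c *: bracket z y.
  by rewrite /bracket -scalemxAl -scalemxAr scalerBr.
have two0 : 2%:R != 0 :> K by rewrite pnatr_eq0.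
pose X k := iter k (bracket e) x.
have hX k : bracket h (X k) = (m + k%:R * 2%:R) *: X k.
  elim: k => [|k IH]; first by rewrite mul0r addr0.
  rewrite /X iterS bracket_jacobi he brZl -/(X k) IH brZr -scalerDl -natr1.
  by congr (_ *: _); ring.
have exX : exists k, X k == 0.
  by have [k Ek] := bracket_ladder two0 hX; exists k; rewrite Ek.
have [k0 Xk0 mink0] := ex_minnP exX.
case: k0 Xk0 mink0 => [|k0] Xk0 mink0; first by rewrite /X /= (negbTE xn) in Xk0.
set y := X k0; have yn : y != 0.
  by apply/negP => y0; have := mink0 _ y0; rewrite ltnn.
have ey : bracket e y = 0 by apply/eqP.
set lam := m + k0%:R * 2%:R; have hy : bracket h y = lam *: y := hX k0.
pose Y j := iter j (bracket f) y.
have hY j : bracket h (Y j) = (lam + j%:R * - 2%:R) *: Y j.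
  elim: j => [|j IH]; first by rewrite mul0r addr0.
  rewrite /Y iterS bracket_jacobi hf -scaleNr brZl -/(Y j) IH brZr -scalerDl -natr1.
  by congr (_ *: _); ring.
have eY j : bracket e (Y j.+1) = (j.+1%:R * (lam - j%:R)) *: Y j.
  elim: j => [|j IH].
    rewrite /Y /= bracket_jacobi ef hy ey br0r addr0; congr (_ *: _).
    by rewrite subr0 mul1r.
  rewrite {1}/Y iterS bracket_jacobi ef -/(Y j.+1) hY IH brZr -[bracket f (Y j)]/(Y j.+1).
  rewrite -scalerDl; congr (_ *: _); rewrite -!natr1; ring.
have exY : exists j, Y j == 0.
  by have [|j Ej] := bracket_ladder _ hY; rewrite ?oppr_eq0 //; exists j; rewrite Ej.
have [j0 Yj0 minj0] := ex_minnP exY.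
case: j0 Yj0 minj0 => [|j0] Yj0 minj0; first by rewrite /Y /= (negbTE yn) in Yj0.
have Yn : Y j0 != 0 by apply/negP => y0; have := minj0 _ y0; rewrite ltnn.
have := eY j0; rewrite (eqP Yj0) br0r => /esym/eqP.
rewrite scaler_eq0 (negbTE Yn) orbF mulf_eq0 pnatr_eq0 /= subr_eq0 => /eqP lamE.
exists (j0%:Z - (k0 * 2)%:Z); rewrite rmorphB /= -!pmulrn natrM -lamE /lam.
by rewrite addrK.
Qed.

End BracketSpectrum.

Lemma finite_sum_seq (V : zmodType) (I : choiceType) (y : I -> V) (s : seq I) :
  uniq s -> (forall i, y i != 0 -> i \in s) ->
  \sum_(i \in [set: I]) y i = \sum_(i <- s) y i.
Proof.
move=> us ys; rewrite (fsbigE s) //; last first.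
  by move=> i _; apply: contraNeq => /ys.
by apply: eq_bigl => i; rewrite in_setT.
Qed.

Lemma finite_support_seq (V : zmodType) (I : choiceType) (y : I -> V) :
  finite_set [set i | y i != 0] ->
  exists s : seq I, uniq s /\ forall i, y i != 0 -> i \in s.
Proof.
move=> /finite_seqP[s Es]; exists (undup s); split; first exact: undup_uniq.
by move=> i yi; rewrite mem_undup; have : [set i | y i != 0] i by []; rewrite Es.
Qed.

(** * Integers between two reals *)

Definition same_unit_interval (R : realType) (x y : R) : Prop :=
  forall k : int, ~ (x < k%:~R < y) /\ ~ (y < k%:~R < x).

Section UnitIntervals.
Variable R : realType.
Implicit Types x y : R.

(** The two bounds are the integers nearest to [x] strictly on either side; for an integer [x] this
    allows [y] on both sides up to distance 1. *)
Lemma adjacent_same_unit_interval x y :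
  int_below x <= y <= int_above x <-> same_unit_interval x y.
Proof.
rewrite /int_below /int_above; split=> [/andP[le1 le2] k|H].
- split=> /andP[lt1 lt2].
    have : Num.floor x < k by rewrite floor_lt_int.
    rewrite -lezD1 -(ler_int R) => /(le_trans le2) /(lt_le_trans lt2).
    by rewrite ltxx.
  have : k < Num.ceil x by rewrite ceil_gt_int.
  by rewrite -lezD1 -lerBrDr -(ler_int R) => /le_trans /(_ le1) /(lt_le_trans lt1); rewrite ltxx.
- apply/andP; split; rewrite leNgt; apply/negP => lt.
    by case: (H (Num.ceil x - 1)) => _; apply; rewrite lt ceilB1_lt.
  by case: (H (Num.floor x + 1)) => + _; apply; rewrite lt floorD1_gt.
Qed.

Lemma same_unit_intervalD (m : int) x y :
  same_unit_interval (m%:~R + x) (m%:~R + y) <-> same_unit_interval x y.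
Proof.
split=> H k.
  have := H (m + k); rewrite intrD !ltrD2l //.
have := H (k - m); rewrite intrB !ltrBrDl !ltrBlDl //.
Qed.

Lemma same_unit_intervalN x y : same_unit_interval (- x) (- y) <-> same_unit_interval x y.
Proof.
suff N (u v : R) : same_unit_interval u v -> same_unit_interval (- u) (- v).
  by split; [move=> /N; rewrite !opprK | exact: N].
move=> H k; have [h1 h2] := H (- k); split=> /andP[lt1 lt2].
  by apply: h2; rewrite intrN ltrNr lt2 ltrNl lt1.
by apply: h1; rewrite intrN ltrNr lt2 ltrNl lt1.
Qed.

End UnitIntervals.

(** * Adjacency of gradings in terms of weights *)

Section Adjacency.
Variables (R : realType) (n : nat).
Local Notation K := R[i].
Local Notation mat := 'M[K]_n.
Implicit Types (x y z : mat).

Lemma bracket_comm0 x y : x *m y = y *m x -> bracket x y = 0.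
Proof. by move=> E; rewrite /bracket E subrr. Qed.

Lemma bracket0 x : bracket x 0 = 0.
Proof. by rewrite /bracket mulmx0 mul0mx subrr. Qed.

Lemma bracket0l x : bracket 0 x = 0.
Proof. by rewrite /bracket mulmx0 mul0mx subrr. Qed.

Lemma bracketZ x c y : bracket x (c *: y) = c *: bracket x y.
Proof. by have := bracket_linr x c y 0; rewrite bracket0 !addr0. Qed.

Lemma bracketDl x y z : bracket (x + y) z = bracket x z + bracket y z.
Proof. by have := bracket_linl z 1 x y; rewrite !scale1r. Qed.

Lemma bracketC x y z : x *m y = y *m x -> bracket x (bracket y z) = bracket y (bracket x z).
Proof. by move=> E; rewrite bracket_jacobi (bracket_comm0 E) bracket0l add0r. Qed.

Lemma eigen_subspace z c : is_subspace [set x | bracket z x = c *: x].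
Proof.
split=> [|b x y /= ex ey]; first by rewrite /= bracket0 scaler0.
by rewrite bracket_linr ex ey scalerDr !scalerA mulrC.
Qed.

Lemma subspaceI (V W : set mat) : is_subspace V -> is_subspace W -> is_subspace (V `&` W).
Proof.
move=> [V0 VP] [W0 WP]; split=> // c x y [Vx Wx] [Vy Wy].
by split; [exact: VP | exact: WP].
Qed.

(* Eigenvectors for distinct eigenvalues are independent. *)
Lemma bigraded_component D1 D2 (s : seq (R * R)) (w : R * R -> mat) x i j :
  uniq s ->
  (forall ij, bracket D1 (w ij) = ij.1%:C *: w ij /\ bracket D2 (w ij) = ij.2%:C *: w ij) ->
  bracket D1 x = i%:C *: x -> bracket D2 x = j%:C *: x ->
  x = \sum_(ij <- s) w ij -> x = if (i, j) \in s then w (i, j) else 0.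
Proof.
move=> us wE x1 x2 xE.
have P0 (D : mat) : forall c u u', u = 0 -> u' = 0 -> c *: u + u' = 0 :> mat.
  by move=> c u u' -> ->; rewrite scaler0 addr0.
have comp D (t : seq (K * mat)) (y : mat) (c : K) :
    (forall u, u \in t -> bracket D u.2 = u.1 *: u.2) -> bracket D y = c *: y ->
    y = \sum_(u <- t) u.2 -> y = \sum_(u <- t) (u.1 == c)%:R *: u.2.
  move=> tE yc yE.
  have := @geneig_sum _ _ _ (bracket_linr D) (fun u => u = 0) erefl (P0 D) _
    ((c, - y) :: t) (fun mu => (mu == c)%:R).
  rewrite !big_cons /= eqxx scale1r -yE addNr => H.
  apply/eqP; rewrite -subr_eq0 -oppr_eq0 opprB addrC; apply/eqP; apply: H => //.
  - by move=> u ->; rewrite bracket0.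
  - move=> u; rewrite inE => /orP[/eqP ->|/tE]; last exact: geneig_eigen.
    by apply: geneig_eigen; rewrite /= -scaleN1r bracketZ yc scalerA mulrC -scalerA.
have xE1 : x = \sum_(ij <- s) (ij.1 == i)%:R *: w ij.
  rewrite (comp D1 [seq (ij.1%:C, w ij) | ij <- s] x i%:C) ?big_map //=.
    by apply: eq_bigr => ij _; rewrite (inj_eq (@complexI R)).
  by move=> u /mapP[ij _ ->]; case: (wE ij).
have xE2 : x = \sum_(ij <- s) (ij.2 == j)%:R *: ((ij.1 == i)%:R *: w ij).
  rewrite (comp D2 [seq (ij.2%:C, (ij.1 == i)%:R *: w ij) | ij <- s] x j%:C) ?big_map //=.
    by apply: eq_bigr => ij _; rewrite (inj_eq (@complexI R)).
  move=> u /mapP[ij _ ->] /=; rewrite bracketZ; case: (wE ij) => _ ->.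
  by rewrite !scalerA mulrC.
rewrite xE2; case: ifP => [ins|nins].
  rewrite (bigD1_seq (i, j)) //= !eqxx !scale1r big1 ?addr0 // => -[k l] /= ne.
  have [El|_] := eqVneq l j; last by rewrite scale0r.
  have [Ek|_] := eqVneq k i; last by rewrite scale0r scaler0.
  by rewrite El Ek eqxx in ne.
rewrite big_seq big1 // => -[k l] /= kls.
have [El|_] := eqVneq l j; last by rewrite scale0r.
have [Ek|_] := eqVneq k i; last by rewrite scale0r scaler0.
by rewrite El Ek nins in kls.
Qed.

Variables (a : mat) (te : set mat) (v : mat).
Hypotheses (aU : a \in unitmx) (te_diag : te `<=` (fun z => tdiag a z)).
Hypotheses (tv : te v) (gen : forall q z, te z -> wtdiff a q z != 0 -> wtdiff a q v != 0).
Variables (g : set mat) (h p p' : mat).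
Hypotheses (sg : is_subspace g) (gh : forall x, g x -> g (bracket h x)).
Hypothesis gte : forall z x, te z -> g x -> g (bracket z x).
Hypothesis hte : forall z, te z -> h *m z = z *m h.
Hypothesis h_int : forall x m, x != 0 -> bracket h x = m *: x -> exists k : int, m = k%:~R.

Local Notation occ := (occurs a te g).

(** An eigenvector of [bracket v] determines a weight of [te] by genericity; the vectors of that
    weight in [V] form a space stable under [bracket h]. *)
Lemma joint_eigenvector (V : set mat) : is_subspace V -> V `<=` g ->
  (forall z x, te z -> V x -> V (bracket z x)) -> (forall x, V x -> V (bracket h x)) ->
  (exists2 x, V x & x != 0) ->
  exists x k l (m : int), [/\ V x, x != 0, forall z, te z -> bracket z x = wt a k l z *: x,
    bracket h x = m%:~R *: x & occ k l].
Proof.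
move=> sV Vg Vte Vh nV.
have [x0 [c [Vx0 x0n x0E]]] := bracket_eigenvector sV (fun x => Vte v x tv) nV.
have [k [l [_ kl]]] := generic_eigen aU te_diag tv gen x0n x0E.
pose V' : set mat := V `&` [set x | forall z, te z -> bracket z x = wt a k l z *: x].
have sV' : is_subspace V'.
  apply: subspaceI => //; split=> [z _|b x y ex ey z tz]; first by rewrite bracket0 scaler0.
  by rewrite bracket_linr ex // ey // scalerDr !scalerA mulrC.
have V'h x : V' x -> V' (bracket h x).
  move=> [Vx xE]; split; first exact: Vh.
  by move=> z tz; rewrite bracketC ?hte // xE // bracketZ.
have [|x [m [[Vx xE] xn hx]]] := bracket_eigenvector sV' V'h; first by exists x0.
have [m' Em] := h_int xn hx; exists x, k, l, m'; split=> //; first by rewrite -Em.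
by exists x; split=> //; exact: Vg.
Qed.

Hypotheses (tp : te p) (tp' : te p').
Hypothesis real_p : forall i j, occ i j -> wt a i j p \is Num.real.
Hypothesis real_p' : forall i j, occ i j -> wt a i j p' \is Num.real.
Hypothesis dp : direct_sum g [set: R] (Gamma g h p).
Hypothesis dp' : direct_sum g [set: R] (Gamma g h p').

Let hp_comm : (h + p) *m (h + p') = (h + p') *m (h + p).
Proof.
rewrite !mulmxDl !mulmxDr (hte tp) (hte tp') (tdiag_comm aU (te_diag tp) (te_diag tp')).
by rewrite -!addrA; congr (_ + _); rewrite addrCA.
Qed.

Let Gamma_subspace q j : is_subspace (Gamma g h q j).
Proof. by apply: subspaceI => //; exact: eigen_subspace. Qed.

Let eigen_bidegree x k l (m : int) q : te q -> (occ k l -> wt a k l q \is Num.real) -> occ k l ->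
  (forall z, te z -> bracket z x = wt a k l z *: x) -> bracket h x = m%:~R *: x ->
  bracket (h + q) x = (m%:~R + complex.Re (wt a k l q))%:C *: x.
Proof.
move=> tq rq okl xE hx; rewrite bracketDl hx xE // -scalerDl; congr (_ *: _).
rewrite rmorphD rmorph_int; congr (_ + _).
by apply/esym/RRe_real/rq.
Qed.

Let Gamma_stable q z j x : te q -> z *m h = h *m z -> z *m q = q *m z ->
  (forall y, g y -> g (bracket z y)) -> Gamma g h q j x -> Gamma g h q j (bracket z x).
Proof.
move=> tq zh zq gz [gx xE]; split; first exact: gz.
have hqz : (h + q) *m z = z *m (h + q) by rewrite mulmxDl mulmxDr zh zq.
by rewrite bracketC // xE bracketZ.
Qed.

Let te_comm z y : te z -> te y -> z *m y = y *m z.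
Proof. by move=> tz ty; apply: (tdiag_comm aU); exact: te_diag. Qed.

Lemma nonzero_bidegree i j x : Gamma g h p i x -> Gamma g h p' j x -> x != 0 ->
  exists k l (m : int), [/\ occ k l, i = m%:~R + complex.Re (wt a k l p)
    & j = m%:~R + complex.Re (wt a k l p')].
Proof.
move=> Gx Gx' xn.
have [|||||y [k [l [m [[[gy yE] [_ yE']] yn yte hy okl]]]]] :=
  joint_eigenvector (V := Gamma g h p i `&` Gamma g h p' j).
- exact: subspaceI.
- by move=> z [[]].
- move=> z u tz [Gu Gu']; split.
    by apply: Gamma_stable => //; [rewrite hte | exact: te_comm | move=> ?; exact: gte].
  by apply: Gamma_stable => //; [rewrite hte | exact: te_comm | move=> ?; exact: gte].
- by move=> u [Gu Gu']; split; apply: Gamma_stable => //; rewrite hte.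
- by exists x.
exists k, l, m; have := eigen_bidegree tp (@real_p k l) okl yte hy.
have := eigen_bidegree tp' (@real_p' k l) okl yte hy.
rewrite yE yE' => E' E.
have inj (c d : R) : c%:C *: y = d%:C *: y -> c = d.
  move/eqP; rewrite -subr_eq0 -scalerBl scaler_eq0 (negbTE yn) orbF subr_eq0.
  by move=> /eqP/complexI.
by split=> //; exact: inj.
Qed.

(** A bigraded decomposition always exists because [h + p] and [h + p'] commute: each component for
    [p] is split according to [p']. The condition on weights only restricts the bidegrees that
    occur. *)
Lemma adjacentP : adjacent_gradings g (Gamma g h p) (Gamma g h p') <->
  forall i j, occ i j ->
    same_unit_interval (complex.Re (wt a i j p)) (complex.Re (wt a i j p')).
Proof.
split=> [[_ adj] i j oij|H].
  have [x0 [gx0 x0n x0E]] := oij.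
  pose V : set mat := g `&` [set x | forall z, te z -> bracket z x = wt a i j z *: x].
  have sV : is_subspace V.
    apply: subspaceI => //; split=> [z _|b x y ex ey z tz]; first by rewrite bracket0 scaler0.
    by rewrite bracket_linr ex // ey // scalerDr !scalerA mulrC.
  have Vh x : V x -> V (bracket h x).
    move=> [gx xE]; split; first exact: gh.
    by move=> z tz; rewrite bracketC ?hte // xE // bracketZ.
  have [|x [m [[gx xE] xn hx]]] := bracket_eigenvector sV Vh; first by exists x0.
  have [m' Em] := h_int xn hx; rewrite Em in hx.
  have x1 := eigen_bidegree tp (@real_p i j) oij xE hx.
  have x2 := eigen_bidegree tp' (@real_p' i j) oij xE hx.
  have [y [[fy yD yN yx] _]] := adj x gx.
  have [s [us ys]] := finite_support_seq fy.
  rewrite (finite_sum_seq us ys) in yx.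
  apply/(same_unit_intervalD m')/adjacent_same_unit_interval; apply: contrapT => nD.
  case/eqP: xn; rewrite (bigraded_component us _ x1 x2 yx).
    by case: ifP => // _; apply: yN => /= D; apply: nD.
  move=> ij; have [D|D] := pselect (int_below ij.1 <= ij.2 <= int_above ij.1).
    by have [[_ ->] [_ ->]] := yD _ D.
  by rewrite yN // !bracket0 !scaler0.
split=> [ij _ x [[]]//|x gx].
have [_ dP] := dp; have [_ dP'] := dp'.
have [y1 [[fy1 y1G _ xE1] _]] := dP x gx.
have gy1 i : g (y1 i) by have [] := y1G i I.
(* The last clause gives zero components the zero splitting, which keeps the support of the double
   family finite. *)
have /choice[y2 Hy2] : forall i, exists y2 : R -> mat,
    [/\ finite_set [set j | y2 j != 0], forall j, Gamma g h p i (y2 j),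
        forall j, Gamma g h p' j (y2 j), y1 i = \sum_(j \in [set: R]) y2 j
      & y1 i = 0 -> forall j, y2 j = 0].
  move=> i; have [y10|y1n] := eqVneq (y1 i) 0.
    have z0 q j : Gamma g h q j 0 by case: (Gamma_subspace q j).
    exists (fun=> 0); split=> //.
      by rewrite (_ : [set j | _] = set0) // -subset0 => j /=; rewrite eqxx.
    by rewrite y10 fsbig1.
  have [y [[fy yG _ yE] _]] := dP' _ (gy1 i).
  exists y; split=> // [j|j|]; [|exact: yG|by move=> E; rewrite E eqxx in y1n].
  have [s [us ys]] := finite_support_seq fy.
  have [ns|ins] := boolP (j \in s); last first.
    suff -> : y j = 0 by case: (Gamma_subspace p i).
    by apply/eqP; apply: contraNT ins; exact: ys.
  have -> : y j = \sum_(u <- [seq (k%:C, y k) | k <- s]) (u.1 == j%:C)%:R *: u.2.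
    rewrite big_map (bigD1_seq j) //= eqxx scale1r big1 ?addr0 // => k kj.
    by rewrite (inj_eq (@complexI R)) (negbTE kj) scale0r.
  have [G0 GP] := Gamma_subspace p i.
  (* Projecting to the eigenvalue [j] of [h + p'] preserves the eigenspaces of [h + p]. *)
  apply: (@geneig_sum _ _ _ (bracket_linr (h + p')) (Gamma g h p i) G0 GP _ _
    (fun mu => (mu == j%:C)%:R)).
  - move=> u [gu uE]; split.
      by rewrite bracketDl -[bracket h u]scale1r; case: sg => _; apply; [exact: gh | exact: gte].
    by rewrite bracketC // uE bracketZ.
  - by move=> u /mapP[k _ ->] /=; apply: geneig_eigen; have [] := yG k I.
  - rewrite big_map /= -(finite_sum_seq us ys) -yE; exact: y1G.
have [s1 [us1 ys1]] := finite_support_seq fy1.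
have /choice[s2 Hs2] : forall i, exists s : seq R, uniq s /\ forall j, y2 i j != 0 -> j \in s.
  by move=> i; case: (Hy2 i) => fy2 _ _ _ _; exact: finite_support_seq.
pose y (ij : R * R) := y2 ij.1 ij.2.
pose s := [seq (i, j) | i <- s1, j <- s2 i].
have us : uniq s.
  apply: allpairs_uniq_dep => //; first by move=> i _; case: (Hs2 i).
  by move=> [i j] [k l] _ _ /= [-> ->].
have ys ij : y ij != 0 -> ij \in s.
  case: ij => i j; rewrite /y /= => yn; apply/allpairsPdep; exists i, j; split=> //.
    by apply: ys1; apply: contraNneq yn => y10; case: (Hy2 i) => _ _ _ _ ->.
  by case: (Hs2 i) => _; apply.
have fin (w : R * R -> mat) (t : seq (R * R)) : (forall ij, w ij != 0 -> ij \in t) ->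
    finite_set [set ij | w ij != 0].
  by move=> wt; apply: (@sub_finite_set _ _ [set` t]) => // ij /wt.
have yG ij : Gamma g h p ij.1 (y ij) /\ Gamma g h p' ij.2 (y ij).
  by case: (Hy2 ij.1) => _ h1 h2 _ _; split; [exact: h1 | exact: h2].
have eig (w : R * R -> mat) ij : Gamma g h p ij.1 (w ij) -> Gamma g h p' ij.2 (w ij) ->
    bracket (h + p) (w ij) = ij.1%:C *: w ij /\ bracket (h + p') (w ij) = ij.2%:C *: w ij.
  by move=> [_ ->] [_ ->].
exists y; split.
  split=> [|ij _|ij nD|]; [exact: fin ys | exact: yG | |].
    apply/eqP; apply: contra_notT nD => yn; have [Gy Gy'] := yG ij.
    have [k [l [m [okl E1 E2]]]] := nonzero_bidegree Gy Gy' yn.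
    apply/adjacent_same_unit_interval; rewrite E1 E2.
    by apply/same_unit_intervalD; exact: H.
  rewrite (finite_sum_seq us ys) xE1 (finite_sum_seq us1 ys1).
  rewrite big_allpairs_dep; apply: eq_bigr => i _.
  have [us2 ys2] := Hs2 i; case: (Hy2 i) => _ _ _ -> _.
  by rewrite (finite_sum_seq us2 ys2).
move=> y' [fy' y'G y'N xE'].
have [t [ut yt]] := finite_support_seq fy'.
apply/funext => ij; apply/eqP; rewrite -subr_eq0; apply/eqP.
have y'G' kl : Gamma g h p kl.1 (y' kl) /\ Gamma g h p' kl.2 (y' kl).
  have [D|D] := pselect (int_below kl.1 <= kl.2 <= int_above kl.1); first exact: y'G.
  by rewrite y'N //; split; [case: (Gamma_subspace p kl.1) | case: (Gamma_subspace p' kl.2)].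
pose r := undup (s ++ t).
have wE kl : bracket (h + p) (y kl - y' kl) = kl.1%:C *: (y kl - y' kl) /\
    bracket (h + p') (y kl - y' kl) = kl.2%:C *: (y kl - y' kl).
  have [e1 e2] := eig _ _ (yG kl).1 (yG kl).2.
  have [e3 e4] := eig _ _ (y'G' kl).1 (y'G' kl).2.
  have -> : y kl - y' kl = -1 *: y' kl + y kl by rewrite scaleN1r addrC.
  by rewrite !bracket_linr e1 e2 e3 e4 !scalerDr !scalerA !(mulrC (-1)).
(* Two decompositions of [x] differ by a bigraded family with sum 0; its members vanish by
   [bigraded_component] applied to the zero vector. *)
have sum0 : 0 = \sum_(kl <- r) (y kl - y' kl).
  rewrite sumrB; have ur : uniq r by exact: undup_uniq.
  rewrite -(finite_sum_seq (y := y) ur); last by move=> kl /ys; rewrite mem_undup mem_cat => ->.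
  rewrite -(finite_sum_seq (y := y') ur); last first.
    by move=> kl /yt; rewrite mem_undup mem_cat orbC => ->.
  rewrite -xE' (finite_sum_seq us ys) big_allpairs_dep xE1 (finite_sum_seq us1 ys1).
  apply/esym/eqP; rewrite subr_eq0; apply/eqP/eq_bigr => i _.
  have [us2 ys2] := Hs2 i; case: (Hy2 i) => _ _ _ -> _.
  by rewrite (finite_sum_seq us2 ys2).
have z1 : bracket (h + p) 0 = ij.1%:C *: 0 by rewrite bracket0 scaler0.
have z2 : bracket (h + p') 0 = ij.2%:C *: 0 by rewrite bracket0 scaler0.
have := bigraded_component (undup_uniq _) wE z1 z2 sum0.
rewrite -surjective_pairing; case: ifP => [_ <- //|nin _].
have [y0 y'0] : y ij = 0 /\ y' ij = 0.
  move/negbT: nin; rewrite mem_undup mem_cat negb_or => /andP[n1 n2].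
  by split; apply/eqP; [apply: contraNT n1; exact: ys | apply: contraNT n2; exact: yt].
by rewrite y0 y'0 subrr.
Qed.

End Adjacency.

(** * The topology of the space of matrices *)

Section MatrixTopology.
Variables (R : realType) (n : nat).
Local Notation K := R[i].
Local Notation mat := 'M[K]_n.

(** Radii of balls in [mat] are elements of [K]; positivity makes them real. *)
Lemma ball_mxP (p q : mat) (e : R) : 0 < e ->
  ball p (e%:C : K) q <-> forall k l, `|p k l - q k l| < e%:C.
Proof.
move=> e0; have eC : 0 < e%:C :> K by rewrite ltcR.
by rewrite /ball /= /mx_ball; split=> [[_]|] H; [exact: H | split].
Qed.

Lemma nbhs_mxP (p : mat) (B : set mat) : nbhs p B <->
  exists2 e : R, 0 < e & forall q : mat, (forall k l, `|p k l - q k l| < e%:C) -> B q.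
Proof.
split=> [/nbhs_ballP[[a b]]|[e e0 H]].
  rewrite /= ltcE /= => /andP[/eqP -> a0] H; exists a => // q pq; apply: H.
  exact: (ball_mxP p q a0).2.
apply/nbhs_ballP; exists e%:C; first by rewrite /= ltcR.
by move=> q pq; apply: H; exact: (ball_mxP p q e0).1.
Qed.

Lemma real_nonneg (c : K) : 0 <= c -> exists2 r : R, 0 <= r & c = r%:C.
Proof. by case: c => r s; rewrite lecE /= => /andP[/eqP -> r0]; exists r. Qed.

Lemma Re_linear_continuous (l : {linear mat -> K | *%R}) :
  continuous (fun z : mat => complex.Re (l z)).
Proof.
move=> p B /nbhs_ballP[eps /= eps0 HB].
have [S S0 SE] : exists2 S : R, 0 <= S & \sum_k `|l (vec_mx (delta_mx 0 k))| = S%:C.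
  by apply: real_nonneg; apply: sumr_ge0.
have S1 : 0 < S + 1 by rewrite ltr_wpDl.
apply/nbhs_mxP; exists (eps / (S + 1)); first by rewrite divr_gt0.
move=> q pq; apply: HB; rewrite /ball /=.
have -> : complex.Re (l p) - complex.Re (l q) = complex.Re (l (p - q)).
  by rewrite linearB /=; case: (l p) => a b; case: (l q).
rewrite -ltcR; apply: le_lt_trans (normc_ge_Re _) _.
have -> : l (p - q) = \sum_k mxvec (p - q) 0 k * l (vec_mx (delta_mx 0 k)).
  rewrite -{1}(mxvecK (p - q)) {1}(row_sum_delta (mxvec (p - q))) !linear_sum /=.
  by apply: eq_bigr => k _; rewrite !linearZ.
apply: le_lt_trans (ler_norm_sum _ _ _) _.
apply: (@le_lt_trans _ _ (\sum_k (eps / (S + 1))%:C * `|l (vec_mx (delta_mx 0 k))|)).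
  apply: ler_sum => k _; rewrite normrM ler_wpM2r //.
  by case/mxvec_indexP: k => i j; rewrite mxvecE !mxE ltW.
rewrite -mulr_sumr SE -rmorphM ltcR /= mulrAC ltr_pdivrMr // mulrDr mulr1.
by rewrite ltrDl.
Qed.

Lemma line_continuous (p d : mat) : continuous (fun s : R => p + s%:C *: d : mat).
Proof.
move=> s0 B /nbhs_mxP[e e0 H].
have [S S0 SE] : exists2 S : R, 0 <= S & \sum_k \sum_l `|d k l| = S%:C.
  by apply: real_nonneg; apply: sumr_ge0 => k _; apply: sumr_ge0.
have S1 : 0 < S + 1 by rewrite ltr_wpDl.
apply/nbhs_ballP; exists (e / (S + 1)); first by rewrite /= divr_gt0.
move=> s; rewrite /ball /= => ss; apply: H => k l; rewrite !mxE.
have -> : p k l + s0%:C * d k l - (p k l + s%:C * d k l) = (s0 - s)%:C * d k l.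
  by rewrite rmorphB /= mulrBl opprD addrACA subrr add0r.
have dS : `|d k l| <= S%:C.
  rewrite -SE (bigD1 k) //= (bigD1 l) //= -!addrA lerDl.
  by rewrite addr_ge0 //; apply: sumr_ge0 => // ? _; apply: sumr_ge0.
rewrite normrM normc_def /= expr0n /= addr0 sqrtr_sqr.
apply: (@le_lt_trans _ _ (`|s0 - s|%:C * S%:C)).
  by rewrite ler_wpM2l // lecR.
rewrite -rmorphM ltcR /=; apply: (@le_lt_trans _ _ (e / (S + 1) * S)).
  by rewrite ler_wpM2r // ltW.
by rewrite mulrAC ltr_pdivrMr // mulrDr mulr1 ltrDl.
Qed.

(** Half-open, because [p] may lie on a wall: the segment stays in an alcove and [p] is recovered in
    its closure. *)
Lemma segment_connected (p d : mat) :
  connected [set p + s%:C *: d | s in `]0%R, 1%R] : set R].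
Proof.
apply: connected_continuous_connected.
  by apply/connected_intervalP; exact: interval_is_interval.
exact/continuous_subspaceT/line_continuous.
Qed.

Lemma segment_closure (p d : mat) :
  closure [set p + s%:C *: d | s in `]0%R, 1%R] : set R] p.
Proof.
move=> B pB; have := @line_continuous p d 0 B; rewrite /= scale0r addr0 => /(_ pB).
move=> /nbhs_ballP[e /= e0 H].
pose s := Num.min 1 (e / 2); exists (p + s%:C *: d); split.
  exists s => //=; rewrite in_itv /= ge_min lexx andbT lt_min ltr01 divr_gt0 //.
apply: H; rewrite /ball /= sub0r normrN ger0_norm ?le_min ?ler01 ?divr_ge0 ?ltW //.
by rewrite /s gt_min; apply/orP; right; rewrite ltr_pdivrMr // ltr_pMr // ltr1n.
Qed.

End MatrixTopology.

(** * Unit intervals along segments *)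

Section AlcoveWalls.
Variable R : realType.
Implicit Types x y c : R.

(* If [x = y] is an integer, the interval is the one on the side given by the
   sign of [c]. *)
Lemma same_unit_interval_room x y c : same_unit_interval x y -> c != 0 ->
  exists (k : int) (d : R), [/\ 0 < d, k%:~R <= x <= (k + 1)%:~R,
    k%:~R <= y <= (k + 1)%:~R & forall e, 0 < e < d ->
      k%:~R < (x + y) / 2 + e * c < (k + 1)%:~R].
Proof.
move=> H c0; set m := (x + y) / 2.
have mE : x + y = m + m by rewrite /m -splitr.
have bounds (k : int) : k%:~R <= m -> m <= (k + 1)%:~R ->
    k%:~R <= x <= (k + 1)%:~R /\ k%:~R <= y <= (k + 1)%:~R.
  move=> km mk; have [h1 h2] := H k; have [h3 h4] := H (k + 1).
  split; apply/andP; split; rewrite leNgt; apply/negP => lt.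
  - by apply: h1; rewrite lt /=; lra.
  - by apply: h4; rewrite lt andbT; lra.
  - by apply: h2; rewrite lt /=; lra.
  - by apply: h3; rewrite lt andbT; lra.
have [cpos|cneg] := ltP 0 c.
  exists (Num.floor m), (((Num.floor m + 1)%:~R - m) / c).
  have lt := floorD1_gt m; have le := floor_le m.
  have [hx hy] := bounds _ le (ltW lt).
  split=> //; first by rewrite divr_gt0 // subr_gt0.
  move=> e /andP[e0]; rewrite ltr_pdivlMr // ltrBrDl => ->; rewrite andbT.
  by apply: le_lt_trans le _; rewrite ltrDl mulr_gt0.
have cn : 0 < - c by rewrite oppr_gt0 lt_neqAle c0.
pose k := (Num.ceil m - 1)%R.
have lt : k%:~R < m by exact: ceilB1_lt.
have le : m <= (k + 1)%:~R by rewrite /k subrK ceil_ge.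
exists k, ((m - k%:~R) / (- c)).
have [hx hy] := bounds k (ltW lt) le.
split=> //; first by rewrite divr_gt0 // subr_gt0.
move=> e /andP[e0]; rewrite ltr_pdivlMr // mulrN => h; apply/andP; split; first lra.
by apply: lt_le_trans le; rewrite gtrDl -oppr_gt0 -mulrN mulr_gt0.
Qed.

(** A segment from a point of the closed interval to an interior point is interior except possibly
    at its start [s = 0]. *)
Lemma segment_not_integer (k0 k : int) s x c : 0 < s <= 1 ->
  k0%:~R <= x <= (k0 + 1)%:~R -> k0%:~R < c < (k0 + 1)%:~R ->
  (1 - s) * x + s * c <> k%:~R.
Proof.
move=> /andP[s0 s1] /andP[x1 x2] /andP[c1 c2] kE.
have l1 : k0%:~R < k%:~R :> R by rewrite -kE; nra.
have l2 : k%:~R < (k0 + 1)%:~R :> R by rewrite -kE; nra.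
move: l1 l2; rewrite !ltr_int ltzD1 => l1 l2.
by have := lt_le_trans l1 l2; rewrite ltxx.
Qed.

Lemma uniform_room (I : finType) (P : I -> R -> Prop) :
  (forall i, exists2 d, 0 < d & forall e, 0 < e < d -> P i e) ->
  exists2 e, 0 < e & forall i, P i e.
Proof.
move=> H; suff [d d0 Hd] : exists2 d, 0 < d & forall i, i \in enum I ->
    forall e, 0 < e < d -> P i e.
  exists (d / 2); first by rewrite divr_gt0.
  move=> i; apply: (Hd i); first by rewrite mem_enum.
  by rewrite divr_gt0 //= ltr_pdivrMr // ltr_pMr // ltr1n.
elim: (enum I) => [|i s [d d0 Hd]]; first by exists 1.
have [d' d'0 Hd'] := H i; exists (Num.min d d'); first by rewrite lt_min d0.
move=> j; rewrite inE => js e; rewrite lt_min => /andP[e0 /andP[ed ed']].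
case/orP: js => [/eqP ->|js]; first by apply: Hd'; rewrite e0.
by apply: (Hd j js); rewrite e0.
Qed.

End AlcoveWalls.

(** * Alcoves in terms of weights *)

Section Alcoves.
Variables (R : realType) (n : nat).
Local Notation K := R[i].
Local Notation mat := 'M[K]_n.
Variables (a : mat) (te : set mat) (v : mat).
Hypotheses (aU : a \in unitmx) (te_diag : te `<=` (fun z => tdiag a z)).
Hypotheses (te_sub : is_subspace te) (tv : treal a te v).
Hypothesis gen : forall q z, te z -> wtdiff a q z != 0 -> wtdiff a q v != 0.
Variables (g u : set mat).
Hypotheses (sg : is_subspace g) (gte : forall z x, te z -> g x -> g (bracket z x)).
Hypotheses (ug : u `<=` g) (u_n0 : forall i j, occurs a te u i j -> wt a i j v != 0).

Local Notation E := (real_form g te).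
Local Notation Phip := (weights te u).

(** An eigenspace of [bracket q] in [g] is stable under [bracket v], so it contains a weight vector
    of [te], and the eigenvalue is the value of that weight at [q]. *)
Lemma real_formP q : E q <->
  te q /\ forall i j, occurs a te g i j -> wt a i j q \is Num.real.
Proof.
split=> [[tq H]|[tq H]]; split=> //.
  by move=> i j [x [gx xn xE]]; apply: (H _ x) => //; exact: xE.
move=> c x gx xn xE; have [te0 teP] := te_sub.
pose V : set mat := g `&` [set y | bracket q y = c *: y].
have sV : is_subspace V by apply: subspaceI => //; exact: eigen_subspace.
have Vv y : V y -> V (bracket v y).
  move=> [gy yE]; split; first by apply: gte => //; case: tv.
  rewrite /= bracketC ?yE ?bracketZ //.
  by apply: (tdiag_comm aU); apply: te_diag => //; case: tv.
have [|y [d [[gy yE] yn yv]]] := bracket_eigenvector sV Vv; first by exists x.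
have [i [j [_ yte]]] := generic_eigen aU te_diag tv.1 gen yn yv.
have oij : occurs a te g i j by exists y.
have : wt a i j q *: y = c *: y by rewrite -yte.
move/eqP; rewrite -subr_eq0 -scalerBl scaler_eq0 (negbTE yn) orbF subr_eq0 => /eqP <-.
exact: H.
Qed.

Lemma occurs_weights i j : occurs a te u i j -> Phip (wt a i j).
Proof. by move=> [x [ux xn xE]]; exists x. Qed.

Lemma weights_occurs b : Phip b -> exists i j, occurs a te u i j /\
  forall z, te z -> b z = wt a i j z.
Proof.
move=> [x [ux xn] xE].
have [i [j [_ xte]]] := generic_eigen aU te_diag tv.1 gen xn (xE _ tv.1).
exists i, j; split; first by exists x.
move=> z tz; have : b z *: x = wt a i j z *: x by rewrite -xE // xte.
by move/eqP; rewrite -subr_eq0 -scalerBl scaler_eq0 (negbTE xn) orbF subr_eq0 => /eqP.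
Qed.

Let X := E `\` \bigcup_(b in Phip) \bigcup_k hyperplane E b k.

Let mem_X q : X q <-> E q /\ forall i j, occurs a te u i j ->
  forall k : int, wt a i j q != k%:~R.
Proof.
split=> [[Eq nH]|[Eq H]]; split=> //.
  move=> i j oij k; apply/eqP => wk; apply: nH; exists (wt a i j).
    exact: occurs_weights.
  by exists k.
move=> [b Pb [k _ [_ bk]]]; have [i [j [oij bE]]] := weights_occurs Pb.
by have := H i j oij k; rewrite -bE ?bk ?eqxx //; case: Eq.
Qed.

Let occ_ug i j : occurs a te u i j -> occurs a te g i j.
Proof. by move=> [x [/ug gx xn xE]]; exists x. Qed.

Let E_Re q i j : E q -> occurs a te u i j -> (complex.Re (wt a i j q))%:C = wt a i j q.
Proof. by move=> /real_formP[_ H] /occ_ug o; apply/RRe_real/H. Qed.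

Lemma wt_continuous i j : continuous (fun z : mat => complex.Re (wt a i j z)).
Proof.
have lin : GRing.linear_for *%R (wt a i j) by move=> c x y; exact: wtP.
pose l : {linear mat -> K | *%R} := HB.pack (wt a i j)
  (GRing.isLinear.Build K mat K *%R _ lin).
exact: (@Re_linear_continuous R n l).
Qed.

Variables (p p' : mat).
Hypotheses (Ep : E p) (Ep' : E p').

(** The weight maps the alcove to a connected set of reals free of integers; an integer strictly
    between its values at two points of the closure would also lie between values on the alcove. *)
Lemma alcove_same_unit_interval A i j : alcove E Phip A -> closure A p -> closure A p' ->
  occurs a te u i j ->
  same_unit_interval (complex.Re (wt a i j p)) (complex.Re (wt a i j p')).
Proof.
move=> [q Xq ->] Ap Ap' oij; set C := connected_component _ _ in Ap Ap'.
pose phi (z : mat) := complex.Re (wt a i j z).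
have cphi : continuous phi := @wt_continuous i j.
have CX : C `<=` X by exact: connected_component_sub.
have conn : connected (phi @` C).
  apply: connected_continuous_connected; first exact: component_connected.
  exact/continuous_subspaceT.
have noint (k : int) : ~ (phi @` C) k%:~R.
  move=> [z /CX /mem_X[Ez H] zk]; have := H i j oij k.
  by rewrite -E_Re // -/(phi z) zk rmorph_int eqxx.
have near (B : set R) z : open B -> closure C z -> B (phi z) -> exists2 x, C x & B (phi x).
  move=> oB Cz Bz; have [|x [Cx Bx]] := Cz (phi @^-1` B); last by exists x.
  by apply: cphi; exact: open_nbhs_nbhs.
have key z z' (k : int) : closure C z -> closure C z' -> ~ (phi z < k%:~R < phi z').
  move=> Cz Cz' /andP[lt1 lt2].
  have [x Cx xk] := near [set r | r < k%:~R] z (@open_lt _ _) Cz lt1.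
  have [x' Cx' xk'] := near [set r | r > k%:~R] z' (@open_gt _ _) Cz' lt2.
  apply: (noint k); move/connected_intervalP: conn => int.
  apply: (int (phi x) (phi x')); [by exists x | by exists x' |].
  by rewrite (ltW xk) (ltW xk').
by move=> k; split; exact: key.
Qed.

Lemma alcove_exists :
  (forall i j, occurs a te u i j ->
     same_unit_interval (complex.Re (wt a i j p)) (complex.Re (wt a i j p'))) ->
  exists A, [/\ alcove E Phip A, closure A p & closure A p'].
Proof.
move=> H; have [te0 teP] := te_sub.
have [tp rp] := (real_formP p).1 Ep; have [tp' rp'] := (real_formP p').1 Ep'.
have v_real i j : wt a i j v \is Num.real by apply: rpredB; case: tv.
pose good (ij : 'I_n * 'I_n) (e : R) := occurs a te u ij.1 ij.2 -> exists k : int,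
  [/\ k%:~R <= complex.Re (wt a ij.1 ij.2 p) <= (k + 1)%:~R,
      k%:~R <= complex.Re (wt a ij.1 ij.2 p') <= (k + 1)%:~R &
      k%:~R < (complex.Re (wt a ij.1 ij.2 p) + complex.Re (wt a ij.1 ij.2 p')) / 2 +
        e * complex.Re (wt a ij.1 ij.2 v) < (k + 1)%:~R].
have [|e e0 He] := @uniform_room R _ good.
  move=> [i j]; have [oij|no] := pselect (occurs a te u i j); last by exists 1 => // e _ /no.
  have wn : complex.Re (wt a i j v) != 0.
    apply: contra (u_n0 oij) => /eqP r0.
    by rewrite -(RRe_real (v_real i j)) r0.
  have [k [d [d0 h1 h2 h3]]] := same_unit_interval_room (H i j oij) wn.
  by exists d => // e ed _; exists k; split=> //; exact: h3.
(* The midpoint may lie on walls containing both [p] and [p']; since no weight on [u] vanishes at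
   [v], a small move along [v] leaves them all. The summand 0 gives the shape to which [teP]
   applies. *)
pose q : mat := (2^-1)%:C *: p + ((2^-1)%:C *: p' + (e%:C *: v + 0)).
have tq : te q by do 3 apply: (teP) => //; case: tv.
have wtq i j : wt a i j q = (2^-1)%:C * wt a i j p + ((2^-1)%:C * wt a i j p' + e%:C * wt a i j v).
  by rewrite /q addr0 !wtP -[e%:C *: v]addr0 wtP /wt /tcoord tconj0 !mxE subrr addr0.
have Re_mul (c : R) (z : K) : complex.Re (c%:C * z) = c * complex.Re z.
  by case: z => x y /=; rewrite mul0r subr0.
have Re_add (z w : K) : complex.Re (z + w) = complex.Re z + complex.Re w.
  by case: z; case: w.
(* The half-open segments from [p] and [p'] to [q] meet no wall, so both lie in the component of
   [q]. *)
have in_X s z : E z -> z = p \/ z = p' -> 0 < s <= 1 -> X (z + s%:C *: (q - z)).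
  move=> Ez zp /andP[s0 s1]; have [tz rz] := (real_formP z).1 Ez.
  have wtE i j : wt a i j (z + s%:C *: (q - z)) = (1 - s)%:C * wt a i j z + s%:C * wt a i j q.
    have -> : z + s%:C *: (q - z) = (1 - s)%:C *: z + s%:C *: q.
      by rewrite rmorphB /= rmorph1 scalerBl scale1r scalerBr addrA addrAC.
    by rewrite wtP -[s%:C *: q]addr0 wtP /wt /tcoord tconj0 !mxE subrr addr0.
  have Ezs : E (z + s%:C *: (q - z)).
    apply/real_formP; split.
      rewrite addrC; apply: (teP) => //; rewrite addrC -scaleN1r; exact: teP.
    move=> i j oij; rewrite wtE wtq.
    have rm (c : R) (x : K) : x \is Num.real -> c%:C * x \is Num.real.
      by move=> xr; rewrite realM // complex_real.
    apply: realD; first exact/rm/rz.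
    apply/rm/realD; first exact/rm/rp.
    by apply: realD; apply: rm => //; exact: rp'.
  apply/mem_X; split=> // i j oij k.
  have [k0 [hp hp' hm]] := He (i, j) oij.
  have hz : k0%:~R <= complex.Re (wt a i j z) <= (k0 + 1)%:~R by case: zp => ->.
  apply/eqP => wk; have := congr1 (@complex.Re R) wk.
  rewrite wtE Re_add !Re_mul wtq (Re_add (_ * wt a i j p)) (Re_add (_ * wt a i j p')) !Re_mul.
  rewrite -(rmorph_int (real_complex R)) /= => kE.
  apply: (segment_not_integer (k := k) _ hz hm); last first.
    rewrite -kE; congr (_ + s * _); rewrite /= mulrDl addrA.
    by congr (_ + _ + _); exact: mulrC.
  by rewrite s0.
have Xq : X q.
  have := in_X 1 p Ep (or_introl erefl); rewrite ltr01 lexx => /(_ isT).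
  by rewrite scale1r addrC subrK.
exists (connected_component X q); split; first by exists q.
- apply: (closure_subset _ (@segment_closure R n p (q - p))).
  apply: connected_component_max => //; last exact: segment_connected.
    by exists 1; rewrite ?scale1r 1?addrC ?subrK //= in_itv /= ltr01 lexx.
  move=> t [s] /=; rewrite in_itv /= => s01 <-; apply: in_X => //; by left.
- apply: (closure_subset _ (@segment_closure R n p' (q - p'))).
  apply: connected_component_max => //; last exact: segment_connected.
    by exists 1; rewrite ?scale1r 1?addrC ?subrK //= in_itv /= ltr01 lexx.
  move=> t [s] /=; rewrite in_itv /= => s01 <-; apply: in_X => //; by right.
Qed.

Lemma alcoveP : (exists A, [/\ alcove E Phip A, closure A p & closure A p']) <->
  forall i j, occurs a te u i j ->
     same_unit_interval (complex.Re (wt a i j p)) (complex.Re (wt a i j p')).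
Proof.
split; last exact: alcove_exists.
by move=> [A [Aa Ap Ap']] i j; exact: (alcove_same_unit_interval Aa).
Qed.

End Alcoves.

Theorem theorem25 (R : realType) (n : nat) (G : set 'M[R[i]]_n)
    (e h f : 'M[R[i]]_n) (T P U : set 'M[R[i]]_n) :
  let g := Lie G in
  let C := centralizer G [set h] in
  let Ce := centralizer C [set e] in
  let t := Lie T in
  let te := lie_centralizer t [set e] in
  let E := real_form g te in
  let L := centralizer G te in
  let u := Lie U in
  let Phip := weights te u in
  connected_semisimple G ->
  g e -> nilpotent_mx e ->
  sl2_triple g e h f ->
  maximal_torus G T -> T `<=` C ->
  (exists2 S, maximal_torus Ce S & S `<=` T) ->
  parabolic_subgroup G P -> levi_factor P L -> unipotent_radical P U ->
  forall p p' : 'M[R[i]]_n,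
    good_grading_polytope g E e h p -> good_grading_polytope g E e h p' ->
    (adjacent_gradings g (Gamma g h p) (Gamma g h p') <->
     exists A : set 'M[R[i]]_n,
       [/\ alcove E Phip A, closure A p & closure A p']).
Proof.
move=> g C Ce t te E L u Phip ssG ge _ [[_ gh _] [he hf ef]] mT TC _ pP lP uU p p'.
move=> [Ep [[_ dp _] _ _ _]] [Ep' [[_ dp' _] _ _ _]].
have [aG _ _] := ssG; have [sG _] := aG.
have [[[aT _ [a aU T_diag]] TG] _] := mT; have [sT _] := aT.
have [aP PG [B bB BP]] := pP.
(* The off-diagonal entries in the diagonalizing basis are linear forms vanishing on [T]. *)
have t_diag z : t z -> tdiag a z.
  move=> tz; apply/is_diag_mxP => i j ij.
  apply: (@Lie_linear _ _ T z (mxentry a (invmx a) i j) 0) tz => x Tx.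
  by have /is_diag_mxP := T_diag _ Tx; apply.
have te_t : te `<=` t by move=> z [].
have te_diag : te `<=` (fun z => tdiag a z) by move=> z /te_t /t_diag.
have te_sub : is_subspace te.
  have [t0 tP] := Lie_subspace T; split=> [|c x y [tx xe] [ty ye]].
    by split=> // _ ->; exact: bracket0l.
  split=> [|z ez]; first exact: tP.
  by rewrite bracket_linl xe // ye // scaler0 addr0.
have te_replica z k : te z -> add_hom k -> te (replica z k).
  move=> [tz ze] hk; split=> [|_ ->]; first exact: Lie_replica.
  apply: bracket_comm0; apply: replica_comm; apply/eqP; rewrite -subr_eq0; apply/eqP.
  exact: ze.
have [v [tv gen]] := generic_element aU te_diag te_sub te_replica.
have hte z : te z -> h *m z = z *m h.
  move=> /te_t tz; apply/esym; apply: (Lie_commute _ tz) => x /TC[_ xh].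
  exact: xh.
have te_g z x : te z -> g x -> g (bracket z x).
  by move=> /te_t tz gx; apply: Lie_bracket => //; exact: LieS TG _ tz.
have h_int x m : x != 0 -> bracket h x = m *: x -> exists k : int, m = k%:~R.
  exact: (sl2_integral he hf ef).
have sg := Lie_subspace G.
have realE q : E q -> te q /\ forall i j, occurs a te g i j -> wt a i j q \is Num.real.
  by move/(real_formP aU te_diag te_sub tv gen sg te_g q).
have [tp rp] := realE _ Ep; have [tp' rp'] := realE _ Ep'.
have UG : u `<=` g.
  by apply: LieS; case: uU => -[_ _ _ [UP _]] _ x /UP; exact: PG.
have u_n0 i j : occurs a te u i j -> wt a i j v != 0.
  exact: (occurs_radical_n0 gen PG uU lP).
have adjP := adjacentP aU te_diag tv.1 gen sg (fun x gx => Lie_bracket sG gh gx) te_g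
  hte h_int tp tp' rp rp' dp dp'.
have alcP := alcoveP aU te_diag te_sub tv gen sg te_g UG u_n0 Ep Ep'.
split=> [/adjP H|/alcP H].
  apply/alcP => i j [x [ux xn xE]]; apply: H; exists x; split=> //; exact: UG.
(* A weight vanishing at the generic [v] vanishes on [te], so both of its values are 0. *)
apply/adjP => i j oij; have [w0|wn] := eqVneq (wt a i j v) 0.
  rewrite !(wt0_generic gen _ w0) // => k.
  by split=> /andP[/lt_trans lt /lt]; rewrite ltxx.
have [|/H] := occurs_radical aU te_diag tv.1 gen aG TG T_diag te_t aP bB BP uU lP oij wn.
  exact: H.
have wtN q : complex.Re (wt a j i q) = - complex.Re (wt a i j q).
  have -> : wt a j i q = - wt a i j q by rewrite /wt opprB.
  by case: (wt a i j q).
by rewrite !wtN => /same_unit_intervalN.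
Qed.
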